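(* Let $n\in\mathbb{N}$ and $\varepsilon>0$. Then there exist non-empty open sets $W_1,W_2,W_3\subset(1-\varepsilon,1+\varepsilon)^n$ (sets of mass vectors $(m_1,\dots,m_n)$) and non-empty open sets $U_1,U_2,U_3\subset\mathbb{R}^n\times\mathbb{R}^n$ (sets of initial data $(q,v)$ with $q_1<q_2<\dots<q_n$), such that, setting $V_i:=W_i\times U_i$, for every $(m,q,v)\in V_i$ the system of $n$ point particles with masses $m$ and initial positions $q$ and velocities $v$ at time $0$ undergoes only binary collisions and the number of collisions occurring at positive times equals (1) $n-1=\binom{n-1}{1}$ if $(m,q,v)\in V_1$; (2) $\binom{n}{2}$ if $(m,q,v)\in V_2$; (3) $\binom{n+1}{3}$ if $(m,q,v)\in V_3$.
   Context: Dynamics: $n$ point particles of masses $m_1,\dots,m_n>0$ move on $\mathbb{R}$ with positions $q_1(t)\le\dots\le q_n(t)$, order preserved. Between collisions each particle moves with constant velocity. A collision is an instant where $q_i=q_{i+1}$; in a binary collision of particles $i$ and $i+1$ with incoming velocities $v_i,v_{i+1}$, the outgoing velocities are $v_i'=\frac{(m_i-m_{i+1})v_i+2m_{i+1}v_{i+1}}{m_i+m_{i+1}}$, $v_{i+1}'=\frac{(m_{i+1}-m_i)v_{i+1}+2m_i v_i}{m_i+m_{i+1}}$ (elastic collision: conservation of momentum and kinetic energy); all other velocities are unchanged. The sets $W_i$ lie in an arbitrarily small neighbourhood of the diagonal $m_1=\dots=m_n=1$ of mass space. *)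

(* Defs.v *)
From Stdlib Require Import Reals Lra Arith.
Open Scope R_scope.

(* Vectors in R^n are represented as functions nat -> R; only the
   coordinates 0 .. n-1 matter (particle i is index i-1 of the paper). *)

Fixpoint binom (n k : nat) : nat :=
  match n, k with
  | _, O => 1%nat
  | O, S _ => 0%nat
  | S n', S k' => (binom n' k' + binom n' k)%nat
  end.

Definition openRn (n : nat) (P : (nat -> R) -> Prop) : Prop :=
  forall x, P x -> exists r, 0 < r /\
    forall y, (forall i, (i < n)%nat -> Rabs (y i - x i) < r) -> P y.

Definition openRn2 (n : nat) (P : (nat -> R) -> (nat -> R) -> Prop) : Prop :=
  forall q v, P q v -> exists r, 0 < r /\
    forall q' v', (forall i, (i < n)%nat -> Rabs (q' i - q i) < r /\ Rabs (v' i - v i) < r) ->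
      P q' v'.

Fixpoint ncoinc (q : nat -> R) (k : nat) : nat :=
  match k with
  | O => O
  | S k' => Nat.add (ncoinc q k') (if Req_EM_T (q k') (q (S k')) then 1%nat else 0%nat)
  end.

Definition collide (n : nat) (m q v : nat -> R) (i : nat) : R :=
  if andb (Nat.ltb (S i) n) (if Req_EM_T (q i) (q (S i)) then true else false) then
    ((m i - m (S i)) * v i + 2 * m (S i) * v (S i)) / (m i + m (S i))
  else if andb (andb (Nat.ltb 0 i) (Nat.ltb i n))
                (if Req_EM_T (q (pred i)) (q i) then true else false) then
    ((m i - m (pred i)) * v i + 2 * m (pred i) * v (pred i)) / (m (pred i) + m i)
  else v i.

(* run n m q v k : starting at time 0 (of the current segment) from positions q
   and velocities v, the system of n particles with masses m undergoes only
   binary collisions, and exactly k collisions occur at positive times. *)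
Inductive run (n : nat) (m : nat -> R) : (nat -> R) -> (nat -> R) -> nat -> Prop :=
| run_free : forall q v,
    (forall s, 0 < s -> forall i, (S i < n)%nat -> q i + s * v i < q (S i) + s * v (S i)) ->
    run n m q v O
| run_coll : forall q v T k,
    0 < T ->
    (forall s, 0 < s < T -> forall i, (S i < n)%nat -> q i + s * v i < q (S i) + s * v (S i)) ->
    (exists i, (S i < n)%nat /\ q i + T * v i = q (S i) + T * v (S i)) ->
    (forall i, (S (S i) < n)%nat ->
        ~ (q i + T * v i = q (S i) + T * v (S i) /\
           q (S i) + T * v (S i) = q (S (S i)) + T * v (S (S i)))) ->
    run n m (fun i => q i + T * v i)
            (collide n m (fun i => q i + T * v i) v) k ->
    run n m q v (Nat.add (ncoinc (fun i => q i + T * v i) (pred n)) k).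

(* Main.v *)
Require Import Defs.
From Stdlib Require Import Reals Lra Lia List Permutation FunctionalExtensionality.
From Coquelicot Require Import Coquelicot.
Import ListNotations.
Open Scope R_scope.

(** Particles of equal mass exchange velocities, so their collisions are the
    crossings of free lines: one fast particle crossing an expanding array gives
    n - 1 collisions, and n lines in reversed order without triple points give
    binom n 2.  Motions without triple collisions that end in an expanding state
    persist under small changes of masses and initial data, which provides the
    open sets.

    For binom (n+1) 3 take masses 1 + d rho^i with d small, and add particles one
    at a time.  After k particles have had their collisions and fly apart, a new
    particle of velocity -1/d crosses all of them (k collisions).  Since d times
    1/d is of order one, this pulse kicks the array by velocities of order one,
    proportional to the differences rho^(i+1) - rho^i; by convexity of i |-> rho^i
    the kicks reverse the order of the array, whose lines now all cross again
    (binom k 2 collisions).  Altogether k + binom k 2 = binom (k+1) 2 new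
    collisions.  The particle hit last escapes and ends at distance of order 1/d
    from the others, so the next pulse is sent from its side; reflecting the line
    then replaces rho by 1/rho. *)

(** * Limits along a filter *)

(** Three choices make the induction close. The kicks are proportional to [rho ^ i] and the array is
    placed at positions proportional to the inverse powers: position times velocity is then
    constant, which excludes triple points. After the reversal the velocities are the same numbers
    in increasing order, so a long flight makes the positions proportional to them; reflected and
    rescaled, this is the placement required for [/ rho]. Finally, a pulse may be analysed on an
    array at rest although the array flies apart: multiplying all earlier velocities by a small
    constant leaves the earlier collisions unchanged.

    The obstacle is that two scales occur. The pulse has speed of order 1/d and hence no limit, so
    it is followed by explicit estimates ([ss_pulse]). The rest has equal-mass limits, to which
    stability applies: at scale 1 the K kicked particles close to each other reverse (binom K 2
    collisions), at scale 1/d the far particle crosses them (K more). *)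

Section Limits.
Context {U : Type} (F : (U -> Prop) -> Prop) {FF : Filter F}.

Definition tends (f : U -> R) (l : R) : Prop := filterlim f F (locally l).

Lemma lim_eps (f : U -> R) (l : R) :
  tends f l <-> forall e, 0 < e -> F (fun u => Rabs (f u - l) < e).
Proof.
  unfold tends. rewrite filterlim_locally. split.
  - intros H e he. exact (H (mkposreal e he)).
  - intros H e. exact (H e (cond_pos e)).
Qed.

Lemma lim_const (c : R) : tends (fun _ => c) c.
Proof. apply filterlim_const. Qed.

Lemma lim_eq (f : U -> R) (x y : R) : x = y -> tends f x -> tends f y.
Proof. intros ->. auto. Qed.

Lemma lim_plus (f g : U -> R) (a b : R) :
  tends f a -> tends g b -> tends (fun u => f u + g u) (a + b).
Proof.
  intros hf hg. exact (filterlim_comp_2 _ _ Rplus hf hg (filterlim_plus a b)).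
Qed.

Lemma lim_mult (f g : U -> R) (a b : R) :
  tends f a -> tends g b -> tends (fun u => f u * g u) (a * b).
Proof.
  intros hf hg. exact (filterlim_comp_2 _ _ Rmult hf hg (filterlim_mult (K := R_AbsRing) a b)).
Qed.

Lemma lim_opp (f : U -> R) (a : R) : tends f a -> tends (fun u => - f u) (- a).
Proof. intros hf. exact (filterlim_comp _ _ _ _ _ _ _ _ hf (filterlim_opp a)). Qed.

Lemma lim_minus (f g : U -> R) (a b : R) :
  tends f a -> tends g b -> tends (fun u => f u - g u) (a - b).
Proof. intros hf hg. exact (lim_plus _ _ _ _ hf (lim_opp _ _ hg)). Qed.

Lemma lim_div (f g : U -> R) (a b : R) :
  b <> 0 -> tends f a -> tends g b -> tends (fun u => f u / g u) (a / b).
Proof.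
  intros hb hf hg. apply lim_mult; [exact hf|].
  exact (filterlim_comp _ _ _ _ _ _ _ _ hg (continuous_Rinv b hb)).
Qed.

Lemma lim_lt (f g : U -> R) (a b : R) :
  a < b -> tends f a -> tends g b -> F (fun u => f u < g u).
Proof.
  intros hab hf hg. rewrite lim_eps in hf, hg.
  assert (he : 0 < (b - a) / 2) by lra.
  generalize (filter_and _ _ (hf _ he) (hg _ he)). apply filter_imp.
  intros u [h1 h2]. apply Rabs_def2 in h1. apply Rabs_def2 in h2. lra.
Qed.

Lemma lim_abs_lt (f : U -> R) (a B : R) :
  Rabs a < B -> tends f a -> F (fun u => Rabs (f u) < B).
Proof.
  intros hab hf. apply Rabs_def2 in hab.
  generalize (filter_and _ _ (lim_lt _ _ _ _ (proj1 hab) hf (lim_const B))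
     (lim_lt _ _ _ _ (proj2 hab) (lim_const (- B)) hf)).
  apply filter_imp. intros u [h1 h2]. apply Rabs_def1; lra.
Qed.

Lemma filter_forall_nat (P : nat -> U -> Prop) (n : nat) :
  (forall i, (i < n)%nat -> F (P i)) -> F (fun u => forall i, (i < n)%nat -> P i u).
Proof.
  induction n as [|n IH]; intros H.
  - apply filter_forall. intros u i hi. lia.
  - generalize (filter_and _ _ (IH (fun i hi => H i (Nat.lt_lt_succ_r _ _ hi)))
                  (H n (Nat.lt_succ_diag_r n))).
    apply filter_imp. intros u [h1 h2] i hi.
    destruct (Nat.eq_dec i n) as [->|hn]; [exact h2|apply h1; lia].
Qed.

Lemma filter_forall_range (P : nat -> U -> Prop) (a b : nat) :
  (forall i, (a <= i)%nat -> (i < b)%nat -> F (P i)) ->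
  F (fun u => forall i, (a <= i)%nat -> (i < b)%nat -> P i u).
Proof.
  intros H.
  assert (H1 : F (fun u => forall i, (i < b)%nat -> (a <= i)%nat -> P i u)).
  { apply filter_forall_nat. intros i hi.
    destruct (Compare_dec.le_dec a i) as [h|h].
    - generalize (H i h hi). apply filter_imp. auto.
    - apply filter_forall. intros u h1. contradiction. }
  revert H1. apply filter_imp. auto.
Qed.

End Limits.

Lemma at_right_lt (e : R) : 0 < e -> at_right 0 (fun h => 0 < h < e).
Proof.
  intros he. exists (mkposreal e he). intros y hy h0.
  split; [exact h0|]. change (Rabs (y - 0) < e) in hy.
  apply Rabs_def2 in hy. lra.
Qed.

Lemma lim_id_right : tends (at_right 0) (fun h => h) 0.
Proof.
  apply lim_eps; [apply filter_filter|]. intros e he.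
  generalize (at_right_lt e he). apply filter_imp. intros h hh.
  apply Rabs_def1; lra.
Qed.

Lemma at_right_ex (P : R -> Prop) :
  at_right 0 P -> exists e, 0 < e /\ forall h, 0 < h < e -> P h.
Proof.
  intros [e He]. exists e. split; [apply cond_pos|]. intros h hh.
  apply He; [|lra]. change (Rabs (h - 0) < e). apply Rabs_def1; lra.
Qed.

Lemma argmin_list (f : nat -> R) (l : list nat) :
  l <> [] -> exists x, In x l /\ forall y, In y l -> f x <= f y.
Proof.
  induction l as [|x l IH]; [congruence|]. intros _.
  destruct l as [|z l].
  - exists x. split; [left; reflexivity|]. intros y [->|[]]. lra.
  - destruct IH as (w & hw & hmin); [discriminate|].
    destruct (Rle_dec (f x) (f w)) as [h|h].
    + exists x. split; [left; reflexivity|]. intros y [->|hy]; [lra|].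
      specialize (hmin y hy). lra.
    + exists w. split; [right; exact hw|]. intros y [<-|hy]; [lra|auto].
Qed.

Lemma bounded_range (f : nat -> R) (n : nat) :
  exists B, 0 < B /\ forall i, (i < n)%nat -> Rabs (f i) < B.
Proof.
  induction n as [|n [B [hB H]]].
  - exists 1. split; [lra|]. intros; lia.
  - exists (Rmax B (Rabs (f n) + 1)). split.
    + eapply Rlt_le_trans; [exact hB|apply Rmax_l].
    + intros i hi. destruct (Nat.eq_dec i n) as [->|hn].
      * pose proof (Rmax_r B (Rabs (f n) + 1)). lra.
      * pose proof (Rmax_l B (Rabs (f n) + 1)).
        assert (Rabs (f i) < B) by (apply H; lia). lra.
Qed.

(** * Small-step dynamics *)

Definition cA (m v : nat -> R) (i : nat) : R :=
  ((m i - m (S i)) * v i + 2 * m (S i) * v (S i)) / (m i + m (S i)).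

Definition cB (m v : nat -> R) (i : nat) : R :=
  ((m (S i) - m i) * v (S i) + 2 * m i * v i) / (m i + m (S i)).

(** Meant for selections [s] in which no two pairs share a particle. Simultaneous collisions then
    become a single velocity map, which can be compared with [collide]. *)
Definition mcoll (s : nat -> bool) (m v : nat -> R) (i : nat) : R :=
  if s i then cA m v i
  else match i with
       | O => v O
       | S j => if s j then cB m v j else v (S j)
       end.

Definition coll (m v : nat -> R) (i : nat) : nat -> R := mcoll (Nat.eqb i) m v.

Definition flow (q v : nat -> R) (t : R) : nat -> R := fun i => q i + t * v i.

Definition bounded_on (a b : nat) (B : R) (q : nat -> R) : Prop :=
  forall i, (a <= i)%nat -> (i < b)%nat -> Rabs (q i) < B.

Definition strict_on (a b : nat) (q : nat -> R) : Prop :=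
  forall i, (a <= i)%nat -> (S i < b)%nat -> q i < q (S i).

Definition weak_on (a b : nat) (q : nat -> R) : Prop :=
  forall i, (a <= i)%nat -> (S i < b)%nat -> q i <= q (S i).

(** In a weakly ordered configuration this is exactly the absence of three coinciding particles. *)
Definition notriple_on (a b : nat) (q : nat -> R) : Prop :=
  forall i, (a <= i)%nat -> (S (S i) < b)%nat -> q i < q (S (S i)).

(* Only the particles a .. b-1 interact, all others move freely; they stay in
   (-B, B).  Simultaneous collisions are sequences of collision steps with no
   flow in between. *)
Inductive ss (a b : nat) (m : nat -> R) (B : R) :
  (nat -> R) -> (nat -> R) -> R -> nat -> (nat -> R) -> (nat -> R) -> Prop :=
| ss_nil : forall q v, bounded_on a b B q -> ss a b m B q v 0 0%nat q v
| ss_flow : forall q v T T' k q' v',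
    0 <= T ->
    (forall s, 0 < s < T -> strict_on a b (flow q v s)) ->
    notriple_on a b (flow q v T) ->
    bounded_on a b B q ->
    ss a b m B (flow q v T) v T' k q' v' ->
    ss a b m B q v (T + T') k q' v'
| ss_coll : forall q v i T k q' v',
    (a <= i)%nat -> (S i < b)%nat ->
    q i = q (S i) -> v (S i) < v i ->
    (forall j, (a <= j)%nat -> S j = i -> q j < q i) ->
    ((S (S i) < b)%nat -> q (S i) < q (S (S i))) ->
    bounded_on a b B q ->
    ss a b m B q (coll m v i) T k q' v' ->
    ss a b m B q v T (S k) q' v'.

Lemma flow_add (q v : nat -> R) (s t : R) : flow (flow q v s) v t = flow q v (s + t).
Proof. apply functional_extensionality. intros i. unfold flow. ring. Qed.

Lemma flow_0 (q v : nat -> R) : flow q v 0 = q.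
Proof. apply functional_extensionality. intros i. unfold flow. ring. Qed.

Lemma flow_lt_between (q v : nat -> R) (t r : R) (i j : nat) :
  q i < q j -> flow q v t i < flow q v t j -> 0 <= r <= t -> flow q v r i < flow q v r j.
Proof.
  unfold flow. intros h0 h1 hr.
  destruct (Rle_dec 0 (v j - v i)) as [h|h].
  - assert (0 <= r * (v j - v i)) by (apply Rmult_le_pos; lra). lra.
  - assert (r * (v i - v j) <= t * (v i - v j)) by (apply Rmult_le_compat_r; lra). lra.
Qed.

Lemma ss_mono (a b : nat) (m : nat -> R) (B B' : R) q v T k q' v' :
  B <= B' -> ss a b m B q v T k q' v' -> ss a b m B' q v T k q' v'.
Proof.
  intros hB H.
  assert (hb : forall x, bounded_on a b B x -> bounded_on a b B' x).
  { intros x hx i h1 h2. specialize (hx i h1 h2). lra. }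
  induction H.
  - apply ss_nil. auto.
  - apply ss_flow; auto.
  - apply (ss_coll a b m B' q v i); auto.
Qed.

Lemma ss_app (a b : nat) (m : nat -> R) (B : R) q v T k q1 v1 T' k' q2 v2 :
  ss a b m B q v T k q1 v1 -> ss a b m B q1 v1 T' k' q2 v2 ->
  ss a b m B q v (T + T') (k + k') q2 v2.
Proof.
  intros H H'. induction H.
  - rewrite Rplus_0_l. exact H'.
  - rewrite Rplus_assoc. apply ss_flow; auto.
  - simpl. apply (ss_coll a b m B q v i); auto.
Qed.

Lemma ss_app_ex (a b : nat) (m : nat -> R) (B B' : R) q v T k q1 v1 T' k' q2 v2 :
  ss a b m B q v T k q1 v1 -> ss a b m B' q1 v1 T' k' q2 v2 ->
  ss a b m (Rmax B B') q v (T + T') (k + k') q2 v2.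
Proof.
  intros H H'. apply (ss_app a b m _ q v T k q1 v1).
  - apply (ss_mono a b m B); [apply Rmax_l|exact H].
  - apply (ss_mono a b m B'); [apply Rmax_r|exact H'].
Qed.

Lemma ss_bounded_start (a b : nat) (m : nat -> R) (B : R) q v T k q' v' :
  ss a b m B q v T k q' v' -> bounded_on a b B q.
Proof. intros H. destruct H; assumption. Qed.

Lemma ss_bounded_end (a b : nat) (m : nat -> R) (B : R) q v T k q' v' :
  ss a b m B q v T k q' v' -> bounded_on a b B q'.
Proof. intros H. induction H; assumption. Qed.

Lemma ss_time_nonneg (a b : nat) (m : nat -> R) (B : R) q v T k q' v' :
  ss a b m B q v T k q' v' -> 0 <= T.
Proof. intros H. induction H; lra. Qed.

Lemma coll_out (m v : nat -> R) (i j : nat) : j <> i -> j <> S i -> coll m v i j = v j.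
Proof.
  intros h1 h2. unfold coll, mcoll.
  destruct (Nat.eqb_spec i j); [congruence|].
  destruct j as [|j]; [reflexivity|].
  destruct (Nat.eqb_spec i j); [congruence|reflexivity].
Qed.

Lemma coll_l (m v : nat -> R) (i : nat) : coll m v i i = cA m v i.
Proof. unfold coll, mcoll. rewrite Nat.eqb_refl. reflexivity. Qed.

Lemma coll_r (m v : nat -> R) (i : nat) : coll m v i (S i) = cB m v i.
Proof.
  unfold coll, mcoll. destruct (Nat.eqb_spec i (S i)); [lia|].
  rewrite Nat.eqb_refl. reflexivity.
Qed.

(** An elastic collision reverses the relative velocity, whatever the masses; hence a pair that has
    just collided separates. *)
Lemma cB_minus_cA (m v : nat -> R) (i : nat) :
  0 < m i -> 0 < m (S i) -> cB m v i - cA m v i = v i - v (S i).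
Proof. intros h1 h2. unfold cA, cB. field. lra. Qed.

Lemma ss_out (a b : nat) (m : nat -> R) (B : R) q v T k q' v' :
  ss a b m B q v T k q' v' ->
  forall i, (i < a)%nat \/ (b <= i)%nat -> q' i = q i + T * v i /\ v' i = v i.
Proof.
  intros H. induction H; intros j hj.
  - split; [ring|reflexivity].
  - destruct (IHss j hj) as [h1 h2]. split; [|exact h2].
    rewrite h1. unfold flow. ring.
  - destruct (IHss j hj) as [h1 h2].
    rewrite coll_out in h1, h2 by lia. auto.
Qed.

(** A free particle that is beyond the bound [B] at both ends of the time interval is beyond it
    throughout, its motion being affine. So it never meets the interacting particles, and one such
    neighbour may be added on either side without changing the count. *)
Lemma ss_extend (a a' b b' : nat) (m : nat -> R) (B B' : R) q v T k q' v' :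
  (a' <= a <= S a')%nat -> (b <= b' <= S b)%nat -> (a <= b)%nat -> 0 < B <= B' ->
  ss a b m B q v T k q' v' ->
  ((a' < a)%nat -> - B' < q a' <= - B /\ - B' < q a' + T * v a' <= - B) ->
  ((b < b')%nat -> B <= q b < B' /\ B <= q b + T * v b < B') ->
  ss a' b' m B' q v T k q' v'.
Proof.
  intros ha hb hab hB H.
  assert (hs : forall x, bounded_on a b B x -> ((a' < a)%nat -> - B' < x a' <= - B) ->
            ((b < b')%nat -> B <= x b < B') -> bounded_on a' b' B' x).
  { intros x hx hl hr i h1 h2. destruct (Compare_dec.lt_dec i a) as [h|h].
    - replace i with a' by lia. specialize (hl ltac:(lia)). rewrite Rabs_left1 by lra. lra.
    - destruct (Compare_dec.lt_dec i b) as [h'|h'].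
      + specialize (hx i ltac:(lia) h'). lra.
      + replace i with b by lia. specialize (hr ltac:(lia)). rewrite Rabs_right by lra. lra. }
  induction H; intros hl hr.
  - apply ss_nil. apply hs; auto; intros h; [apply hl|apply hr]; exact h.
  - pose proof (ss_bounded_start _ _ _ _ _ _ _ _ _ _ H3) as hbe.
    pose proof (ss_time_nonneg _ _ _ _ _ _ _ _ _ _ H3) as hT'.
    assert (lin : forall x y lo hi s S0, 0 <= s <= S0 -> lo <= x <= hi -> lo <= x + S0 * y <= hi ->
              lo <= x + s * y <= hi).
    { intros x y lo hi s S0 hs0 g1 g2. destruct (Rle_dec 0 y) as [hy|hy].
      - assert (0 <= s * y) by (apply Rmult_le_pos; lra).
        assert (s * y <= S0 * y) by (apply Rmult_le_compat_r; lra). lra.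
      - assert (s * - y <= S0 * - y) by (apply Rmult_le_compat_r; lra).
        assert (0 <= s * - y) by (apply Rmult_le_pos; lra). lra. }
    assert (inn : forall j s, (a <= j)%nat -> (j < b)%nat -> 0 <= s <= T -> Rabs (flow q v s j) < B).
    { intros j s j1 j2 hst. specialize (H2 j j1 j2). specialize (hbe j j1 j2).
      unfold flow in *.
      apply Rle_lt_trans with (Rmax (Rabs (q j)) (Rabs (q j + T * v j))).
      - set (W := Rmax (Rabs (q j)) (Rabs (q j + T * v j))).
        assert (w1 : Rabs (q j) <= W) by apply Rmax_l.
        assert (w2 : Rabs (q j + T * v j) <= W) by apply Rmax_r.
        apply Rabs_le. apply Rabs_le_between in w1. apply Rabs_le_between in w2.
        apply (lin _ _ _ _ s T); assumption.
      - apply Rmax_lub_lt; assumption. }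
    assert (left : (a' < a)%nat -> forall s, 0 <= s <= T + T' -> - B' < q a' + s * v a' <= - B).
    { intros h s hst. destruct (hl h) as [g1 g2].
      set (lo := Rmin (q a') (q a' + (T + T') * v a')).
      assert (lo <= q a') by apply Rmin_l. assert (lo <= q a' + (T + T') * v a') by apply Rmin_r.
      assert (- B' < lo) by (apply Rmin_glb_lt; lra).
      assert (lo <= q a' + s * v a' <= - B) by (apply (lin _ _ _ _ s (T + T')); lra). lra. }
    assert (right : (b < b')%nat -> forall s, 0 <= s <= T + T' -> B <= q b + s * v b < B').
    { intros h s hst. destruct (hr h) as [g1 g2].
      set (hi := Rmax (q b) (q b + (T + T') * v b)).
      assert (q b <= hi) by apply Rmax_l. assert (q b + (T + T') * v b <= hi) by apply Rmax_r.
      assert (hi < B') by (apply Rmax_lub_lt; lra).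
      assert (B <= q b + s * v b <= hi) by (apply (lin _ _ _ _ s (T + T')); lra). lra. }
    assert (ltl : (a' < a)%nat -> forall j s, (a <= j)%nat -> (j < b')%nat -> 0 <= s <= T ->
              flow q v s a' < flow q v s j).
    { intros h j s j1 j2 hst. specialize (left h s ltac:(lra)). unfold flow at 1.
      destruct (Compare_dec.lt_dec j b) as [hj|hj].
      - specialize (inn j s j1 hj hst). apply Rabs_def2 in inn. lra.
      - replace j with b by lia. specialize (right ltac:(lia) s ltac:(lra)). unfold flow. lra. }
    assert (ltr : (b < b')%nat -> forall j s, (a' <= j)%nat -> (j < b)%nat -> 0 <= s <= T ->
              flow q v s j < flow q v s b).
    { intros h j s j1 j2 hst. specialize (right h s ltac:(lra)). unfold flow at 2.
      destruct (Compare_dec.lt_dec j a) as [hj|hj].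
      - replace j with a' by lia. specialize (left ltac:(lia) s ltac:(lra)). unfold flow. lra.
      - specialize (inn j s ltac:(lia) j2 hst). apply Rabs_def2 in inn. lra. }
    apply ss_flow.
    + exact H.
    + intros s hst i hi1 hi2. destruct (Compare_dec.lt_dec i a) as [h|h].
      * replace i with a' by lia. apply ltl; try lia; lra.
      * destruct (Compare_dec.lt_dec (S i) b) as [h'|h'].
        -- apply H0; auto; lia.
        -- replace (S i) with b by lia. apply ltr; try lia; lra.
    + intros i hi1 hi2. destruct (Compare_dec.lt_dec i a) as [h|h].
      * replace i with a' by lia. apply ltl; try lia; lra.
      * destruct (Compare_dec.lt_dec (S (S i)) b) as [h'|h'].
        -- apply H1; lia.
        -- replace (S (S i)) with b by lia. apply ltr; try lia; lra.
    + apply hs; auto; intros h; [apply hl|apply hr]; exact h.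
    + apply IHss; intros h; unfold flow; rewrite Rplus_assoc, <- Rmult_plus_distr_r.
      * split; apply left; auto; lra.
      * split; apply right; auto; lra.
  - apply (ss_coll a' b' m B' q v i); auto; try lia.
    + intros j hj1 hj2. destruct (Compare_dec.lt_dec j a) as [h|h].
      * replace j with a' by lia. specialize (H5 i ltac:(lia) ltac:(lia)). apply Rabs_def2 in H5.
        destruct (hl ltac:(lia)). lra.
      * apply H3; lia.
    + intros hi. destruct (Compare_dec.lt_dec (S (S i)) b) as [h|h].
      * apply H4; lia.
      * replace (S (S i)) with b by lia. specialize (H5 (S i) ltac:(lia) ltac:(lia)). apply Rabs_def2 in H5.
        destruct (hr ltac:(lia)). lra.
    + apply hs; auto; intros h; [apply hl|apply hr]; exact h.
    + apply IHss; intros h; rewrite coll_out by lia; auto.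
Qed.

(** * Symmetries: scaling and reflection *)

Lemma mcoll_scale (s : nat -> bool) (m v : nat -> R) (c : R) :
  mcoll s m (fun i => c * v i) = (fun i => c * mcoll s m v i).
Proof.
  apply functional_extensionality. intros i. unfold mcoll, cA, cB, Rdiv.
  destruct (s i); [ring|]. destruct i as [|i]; [ring|]. destruct (s i); ring.
Qed.

(** The collision law is linear in the velocities and does not see positions, so space and speed
    scale independently. This serves to slow an array down almost to rest and to pass between the
    scales 1 and 1/d. *)
Lemma ss_scale (a b : nat) (m : nat -> R) (B : R) q v T k q' v' (x y : R) :
  0 < x -> 0 < y ->
  ss a b m B q v T k q' v' ->
  ss a b m (x * B) (fun i => x * q i) (fun i => y * v i) (x / y * T) k
     (fun i => x * q' i) (fun i => y * v' i).
Proof.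
  intros hx hy H.
  assert (hs : forall z, bounded_on a b B z -> bounded_on a b (x * B) (fun i => x * z i)).
  { intros z hz i h1 h2. rewrite Rabs_mult, (Rabs_right x) by lra.
    apply Rmult_lt_compat_l; auto. }
  assert (hf : forall q v t, flow (fun i => x * q i) (fun i => y * v i) (x / y * t) =
                 (fun i => x * flow q v t i)).
  { intros q0 v0 t. apply functional_extensionality. intros i. unfold flow. field. lra. }
  assert (hxy : 0 < x / y) by (apply Rdiv_lt_0_compat; lra).
  induction H.
  - rewrite Rmult_0_r. apply ss_nil. auto.
  - rewrite Rmult_plus_distr_l. apply ss_flow.
    + apply Rmult_le_pos; lra.
    + intros s hst.
      replace s with (x / y * (y / x * s)) by (field; lra). rewrite hf.
      intros i h1 h2. apply Rmult_lt_compat_l; [exact hx|]. apply H0; auto.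
      assert (0 < y / x) by (apply Rdiv_lt_0_compat; lra).
      split; [apply Rmult_lt_0_compat; lra|].
      apply Rmult_lt_reg_l with (x / y); [exact hxy|].
      replace (x / y * (y / x * s)) with s by (field; lra). lra.
    + rewrite hf. intros i h1 h2. apply Rmult_lt_compat_l; auto.
    + auto.
    + rewrite hf. exact IHss.
  - apply (ss_coll a b m (x * B) _ _ i); auto.
    + rewrite H1. reflexivity.
    + apply Rmult_lt_compat_l; auto.
    + intros j h1 h2. apply Rmult_lt_compat_l; auto.
    + intros h. apply Rmult_lt_compat_l; auto.
    + unfold coll in *. rewrite mcoll_scale. exact IHss.
Qed.

(** Indices from [n] on stay fixed, so that [mirror_coll] is an equality of functions on all of
    [nat]. *)
Definition rv (n i : nat) : nat := if Nat.ltb i n then (n - 1 - i)%nat else i.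

Definition mirror (n : nat) (q : nat -> R) : nat -> R := fun i => - q (rv n i).

Lemma rv_lt (n i : nat) : (i < n)%nat -> rv n i = (n - 1 - i)%nat.
Proof. intros h. unfold rv. destruct (Nat.ltb_spec i n); [reflexivity|lia]. Qed.

Lemma rv_ge (n i : nat) : (n <= i)%nat -> rv n i = i.
Proof. intros h. unfold rv. destruct (Nat.ltb_spec i n); [lia|reflexivity]. Qed.

Lemma mirror_coll (n i : nat) (m v : nat -> R) :
  (S i < n)%nat ->
  mirror n (coll m v i) = coll (fun j => m (rv n j)) (mirror n v) (n - 2 - i).
Proof.
  intros hi. apply functional_extensionality. intros j. unfold mirror at 1.
  destruct (Nat.eq_dec j (n - 2 - i)) as [->|h1].
  - rewrite coll_l, rv_lt by lia.
    replace (n - 1 - (n - 2 - i))%nat with (S i) by lia. rewrite coll_r.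
    unfold cA, cB, mirror. rewrite !rv_lt by lia.
    replace (n - 1 - (n - 2 - i))%nat with (S i) by lia.
    replace (n - 1 - S (n - 2 - i))%nat with i by lia.
    rewrite (Rplus_comm (m (S i))). unfold Rdiv. ring.
  - destruct (Nat.eq_dec j (S (n - 2 - i))) as [->|h2].
    + rewrite coll_r, rv_lt by lia.
      replace (n - 1 - S (n - 2 - i))%nat with i by lia. rewrite coll_l.
      unfold cA, cB, mirror. rewrite !rv_lt by lia.
      replace (n - 1 - (n - 2 - i))%nat with (S i) by lia.
      replace (n - 1 - S (n - 2 - i))%nat with i by lia.
      rewrite (Rplus_comm (m (S i))). unfold Rdiv. ring.
    + rewrite (coll_out _ _ (n - 2 - i)) by assumption. unfold mirror.
      destruct (Nat.ltb_spec j n) as [h|h].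
      * rewrite rv_lt by assumption. rewrite coll_out by lia. reflexivity.
      * rewrite rv_ge by assumption. rewrite coll_out by lia. reflexivity.
Qed.

Lemma mirror_pair (n i : nat) (q : nat -> R) :
  (S i < n)%nat -> mirror n q i = - q (S (n - 2 - i)) /\ mirror n q (S i) = - q (n - 2 - i)%nat.
Proof.
  intros h. unfold mirror. rewrite !rv_lt by lia.
  split; do 2 f_equal; lia.
Qed.

Lemma ss_mirror (n : nat) (m : nat -> R) (B : R) q v T k q' v' :
  ss 0 n m B q v T k q' v' ->
  ss 0 n (fun j => m (rv n j)) B (mirror n q) (mirror n v) T k (mirror n q') (mirror n v').
Proof.
  intros H.
  assert (hs : forall z, bounded_on 0 n B z -> bounded_on 0 n B (mirror n z)).
  { intros z hz i h1 h2. unfold mirror. rewrite Rabs_Ropp. apply hz; [lia|].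
    rewrite rv_lt; lia. }
  assert (hf : forall q v t, flow (mirror n q) (mirror n v) t = mirror n (flow q v t)).
  { intros q0 v0 t. apply functional_extensionality. intros i. unfold flow, mirror. ring. }
  induction H.
  - apply ss_nil. auto.
  - apply ss_flow; auto.
    + intros s hst. rewrite hf. intros i h1 h2.
      destruct (mirror_pair n i (flow q v s) h2) as [-> ->].
      apply Ropp_lt_contravar. apply H0; [exact hst|lia|lia].
    + rewrite hf. intros i h1 h2. unfold mirror. rewrite !rv_lt by lia.
      apply Ropp_lt_contravar.
      replace (n - 1 - i)%nat with (S (S (n - 1 - S (S i)))) by lia. apply H1; lia.
    + rewrite hf. exact IHss.
  - assert (hi : (S (n - 2 - i) < n)%nat) by lia.
    destruct (mirror_pair n (n - 2 - i) q hi) as [e1 e2].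
    destruct (mirror_pair n (n - 2 - i) v hi) as [e3 e4].
    replace (n - 2 - (n - 2 - i))%nat with i in * by lia.
    apply (ss_coll 0 n _ B _ _ (n - 2 - i)); auto; try lia.
    + rewrite e1, e2, H1. reflexivity.
    + rewrite e3, e4. lra.
    + intros j h1 h2.
      assert (hj : (S j < n)%nat) by lia.
      rewrite e1. unfold mirror. rewrite rv_lt by lia.
      apply Ropp_lt_contravar. replace (n - 1 - j)%nat with (S (S i)) by lia.
      apply H4. lia.
    + intros h. rewrite e2. unfold mirror. rewrite rv_lt by lia.
      apply Ropp_lt_contravar. apply H3; lia.
    + rewrite <- mirror_coll by assumption. exact IHss.
Qed.

(** * Simultaneous collisions and the relation with [run] *)

Definition cnt (s : nat -> bool) (a b : nat) : nat := length (filter s (seq a (b - 1 - a))).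

Definition touchb (a b : nat) (q : nat -> R) (i : nat) : bool :=
  (Nat.leb a i && Nat.ltb (S i) b && (if Req_EM_T (q i) (q (S i)) then true else false))%bool.

(** Touching pairs occur both just before and just after their collision; the sign of the relative
    velocity tells which of them still have to collide. *)
Definition pendb (a b : nat) (q v : nat -> R) (i : nat) : bool :=
  (touchb a b q i && (if Rlt_dec (v (S i)) (v i) then true else false))%bool.

Lemma touchb_spec (a b : nat) (q : nat -> R) (i : nat) :
  touchb a b q i = true <-> (a <= i)%nat /\ (S i < b)%nat /\ q i = q (S i).
Proof.
  unfold touchb. rewrite !Bool.andb_true_iff, Nat.leb_le, Nat.ltb_lt.
  destruct (Req_EM_T (q i) (q (S i))); intuition congruence.
Qed.

Lemma pendb_spec (a b : nat) (q v : nat -> R) (i : nat) :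
  pendb a b q v i = true <->
  (a <= i)%nat /\ (S i < b)%nat /\ q i = q (S i) /\ v (S i) < v i.
Proof.
  unfold pendb. rewrite Bool.andb_true_iff, touchb_spec.
  destruct (Rlt_dec (v (S i)) (v i)); intuition congruence.
Qed.

Lemma bool_eq_iff (x y : bool) : (x = true <-> y = true) -> x = y.
Proof. destruct x, y; intuition congruence. Qed.

Lemma cnt_false (s : nat -> bool) (a b : nat) :
  (forall i, (a <= i)%nat -> (S i < b)%nat -> s i = false) -> cnt s a b = 0%nat.
Proof.
  intros H. unfold cnt.
  assert (G : forall l, (forall i, In i l -> s i = false) -> length (filter s l) = 0%nat).
  { induction l as [|x l IH]; intros h; [reflexivity|]. simpl.
    rewrite (h x) by (left; reflexivity). apply IH. intros i hi. apply h. right. exact hi. }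
  apply G. intros i hi. apply in_seq in hi. apply H; lia.
Qed.

Lemma cnt_0_inv (s : nat -> bool) (a b : nat) :
  cnt s a b = 0%nat -> forall i, (a <= i)%nat -> (S i < b)%nat -> s i = false.
Proof.
  unfold cnt. intros H i h1 h2.
  destruct (s i) eqn:e; [|reflexivity].
  assert (hin : In i (filter s (seq a (b - 1 - a)))).
  { apply filter_In. split; [apply in_seq; lia|exact e]. }
  destruct (filter s (seq a (b - 1 - a))); [destruct hin|discriminate].
Qed.

Lemma cnt_remove (s : nat -> bool) (a b i : nat) :
  s i = true -> (a <= i)%nat -> (S i < b)%nat ->
  cnt s a b = S (cnt (fun j => (s j && negb (Nat.eqb i j))%bool) a b).
Proof.
  intros hi h1 h2. unfold cnt.
  assert (hin : In i (seq a (b - 1 - a))) by (apply in_seq; lia).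
  assert (hnd : NoDup (seq a (b - 1 - a))) by apply seq_NoDup.
  revert hin hnd. generalize (seq a (b - 1 - a)).
  induction l as [|x l IH]; intros hin hnd; [destruct hin|].
  inversion hnd as [|? ? hx hl]; subst. simpl.
  destruct (Nat.eq_dec i x) as [->|hn].
  - rewrite hi, Nat.eqb_refl. simpl. f_equal. f_equal.
    apply filter_ext_in. intros y hy. destruct (Nat.eqb_spec x y); [congruence|].
    rewrite Bool.andb_true_r. reflexivity.
  - destruct hin as [e|hin]; [congruence|].
    destruct (Nat.eqb_spec i x); [congruence|].
    rewrite Bool.andb_true_r. destruct (s x); simpl; rewrite IH; auto.
Qed.

Lemma mcoll_false (s : nat -> bool) (m v : nat -> R) :
  (forall i, s i = false) -> mcoll s m v = v.
Proof.
  intros H. apply functional_extensionality. intros i. unfold mcoll. rewrite H.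
  destruct i; [reflexivity|]. rewrite H. reflexivity.
Qed.

(** Disjoint pairs act on disjoint velocities, so the collision of one selected pair may be carried
    out before the others. *)
Lemma mcoll_remove (s : nat -> bool) (m v : nat -> R) (i : nat) :
  s i = true -> (forall j, S j = i -> s j = false) -> s (S i) = false ->
  mcoll (fun j => (s j && negb (Nat.eqb i j))%bool) m (coll m v i) = mcoll s m v.
Proof.
  intros h0 h1 h2. apply functional_extensionality. intros j.
  unfold mcoll at 1 2.
  destruct (Nat.eq_dec i j) as [<-|hij].
  - rewrite Nat.eqb_refl, h0. simpl. destruct i as [|i].
    + rewrite coll_l. reflexivity.
    + rewrite (h1 i eq_refl). simpl. rewrite coll_l. reflexivity.
  - destruct (Nat.eqb_spec i j); [congruence|]. rewrite Bool.andb_true_r.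
    destruct (s j) eqn:ej.
    + assert (j <> S i) by congruence.
      assert (S j <> i) by (intros e; rewrite (h1 j e) in ej; discriminate).
      unfold cA. rewrite !coll_out by lia. reflexivity.
    + destruct j as [|j].
      * rewrite coll_out by lia. reflexivity.
      * destruct (Nat.eqb_spec i j) as [<-|hn2].
        -- rewrite h0. simpl. rewrite coll_r. reflexivity.
        -- rewrite Bool.andb_true_r. destruct (s j) eqn:ej'.
           ++ assert (j <> S i) by congruence.
              unfold cB. rewrite !coll_out by lia. reflexivity.
           ++ rewrite coll_out by lia. reflexivity.
Qed.

Definition pos_on (a b : nat) (m : nat -> R) : Prop :=
  forall i, (a <= i)%nat -> (i < b)%nat -> 0 < m i.

(** Pair [i] separates once it has collided, and its neighbours are strictly apart from it, so no
    pending pair is created or lost other than [i]. *)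
Lemma pendb_coll (a b : nat) (m q v : nat -> R) (i : nat) :
  pos_on a b m -> (a <= i)%nat -> (S i < b)%nat -> v (S i) < v i ->
  (forall j, (a <= j)%nat -> S j = i -> q j < q i) ->
  ((S (S i) < b)%nat -> q (S i) < q (S (S i))) ->
  pendb a b q (coll m v i) = (fun j => (pendb a b q v j && negb (Nat.eqb i j))%bool).
Proof.
  intros hm h1 h2 hv hl hr. apply functional_extensionality. intros j.
  apply bool_eq_iff. rewrite Bool.andb_true_iff, !pendb_spec.
  destruct (Nat.eqb_spec i j) as [<-|hn].
  - rewrite coll_l, coll_r. split; [|intuition discriminate].
    intros (_ & _ & _ & h). pose proof (cB_minus_cA m v i (hm i h1 ltac:(lia)) (hm (S i) ltac:(lia) h2)).
    lra.
  - simpl. split.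
    + intros (g1 & g2 & g3 & g4).
      assert (j <> S i) by (intros ->; specialize (hr g2); lra).
      assert (S j <> i) by (intros e; specialize (hl j g1 e); rewrite <- e in hl; lra).
      rewrite !coll_out in g4 by lia. auto.
    + intros ((g1 & g2 & g3 & g4) & _).
      assert (j <> S i) by (intros ->; specialize (hr g2); lra).
      assert (S j <> i) by (intros e; specialize (hl j g1 e); rewrite <- e in hl; lra).
      rewrite !coll_out by lia. auto.
Qed.

Lemma affine_limit_nonneg (g d T : R) :
  0 < T -> (forall s, 0 < s < T -> 0 < g + s * d) -> 0 <= g + T * d.
Proof.
  intros hT H. destruct (Rle_dec 0 (g + T * d)) as [h|h]; [exact h|]. exfalso.
  set (x := g + T / 2 * d). set (y := g + T * d).
  assert (hx : 0 < x) by (apply H; lra).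
  assert (hy : y < 0) by (unfold y; lra).
  (* This ratio locates the zero of the affine function between the times T/2 and T; positivity at
     that time is the contradiction. *)
  assert (hr : 0 < x / (x - y) < 1).
  { split; [apply Rdiv_lt_0_compat; lra|].
    apply Rmult_lt_reg_r with (x - y); [lra|]. unfold Rdiv.
    rewrite Rmult_assoc, Rinv_l by lra. lra. }
  assert (hz : 0 < g + (T / 2 + T / 2 * (x / (x - y))) * d).
  { apply H. split; nra. }
  assert (e : g + (T / 2 + T / 2 * (x / (x - y))) * d = x + (y - x) * (x / (x - y))).
  { unfold x, y. field. unfold x, y in hx, hy. lra. }
  rewrite e in hz.
  assert ((y - x) * (x / (x - y)) = - x) by (field; lra). lra.
Qed.

Section FlowFacts.
Context (a b : nat) (q v : nat -> R) (T : R).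
Context (hT : 0 < T) (hs : forall s, 0 < s < T -> strict_on a b (flow q v s)).

Lemma flow_weak : weak_on a b (flow q v T).
Proof.
  intros i h1 h2.
  assert (0 <= (q (S i) - q i) + T * (v (S i) - v i)).
  { apply affine_limit_nonneg; [exact hT|]. intros s hst.
    specialize (hs s hst i h1 h2). unfold flow in hs. lra. }
  unfold flow. lra.
Qed.

(** An approaching pair that already touches would lose its order at once. *)
Lemma flow_start_not_pending (i : nat) : pendb a b q v i = false.
Proof.
  destruct (pendb a b q v i) eqn:e; [|reflexivity].
  apply pendb_spec in e. destruct e as (h1 & h2 & h3 & h4).
  specialize (hs (T / 2) ltac:(lra) i h1 h2). unfold flow in hs. nra.
Qed.

(** A pair that touches at the end has just closed a positive gap, hence is approaching. *)
Lemma flow_end_pending : pendb a b (flow q v T) v = touchb a b (flow q v T).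
Proof.
  apply functional_extensionality. intros i. apply bool_eq_iff.
  rewrite pendb_spec, touchb_spec. split; [intuition|].
  intros (h1 & h2 & h3). repeat split; auto.
  specialize (hs (T / 2) ltac:(lra) i h1 h2). unfold flow in hs, h3. nra.
Qed.

End FlowFacts.

Lemma increasing_not_pending (a b : nat) (q v : nat -> R) :
  strict_on a b v -> forall i, pendb a b q v i = false.
Proof.
  intros hv i. destruct (pendb a b q v i) eqn:e; [|reflexivity].
  apply pendb_spec in e. destruct e as (h1 & h2 & h3 & h4).
  specialize (hv i h1 h2). lra.
Qed.

Lemma strict_not_pending (a b : nat) (q v : nat -> R) :
  strict_on a b q -> forall i, pendb a b q v i = false.
Proof.
  intros hv i. destruct (pendb a b q v i) eqn:e; [|reflexivity].
  apply pendb_spec in e. destruct e as (h1 & h2 & h3 & h4).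
  specialize (hv i h1 h2). lra.
Qed.

Lemma ncoinc_cnt (q : nat -> R) (n : nat) : ncoinc q (pred n) = cnt (touchb 0 n q) 0 n.
Proof.
  assert (G : forall k, ncoinc q k =
     length (filter (fun i => if Req_EM_T (q i) (q (S i)) then true else false) (seq 0 k))).
  { induction k as [|k IH]; [reflexivity|].
    rewrite seq_S, filter_app, length_app, <- IH. simpl.
    destruct (Req_EM_T (q k) (q (S k))); reflexivity. }
  rewrite G. unfold cnt. replace (n - 1 - 0)%nat with (pred n) by lia. f_equal.
  apply filter_ext_in. intros i hi. apply in_seq in hi. unfold touchb.
  destruct (Nat.ltb_spec (S i) n); [reflexivity|lia].
Qed.

Lemma collide_mcoll (n : nat) (m q v : nat -> R) :
  collide n m q v = mcoll (touchb 0 n q) m v.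
Proof.
  apply functional_extensionality. intros i. unfold collide, mcoll, touchb. simpl.
  destruct (Nat.ltb (S i) n && (if Req_EM_T (q i) (q (S i)) then true else false))%bool;
    [reflexivity|].
  destruct i as [|i]; reflexivity.
Qed.

(** A flow step of [ss] may end where nothing touches, whereas a finite segment of [run] ends with a
    collision. Such a flow step is absorbed into the segment that follows. *)
Lemma run_shift (n : nat) (m q v : nat -> R) (T : R) (k : nat) :
  0 < T -> (forall s, 0 < s < T -> strict_on 0 n (flow q v s)) ->
  strict_on 0 n (flow q v T) -> run n m (flow q v T) v k -> run n m q v k.
Proof.
  intros hT hs he H. remember (flow q v T) as Q eqn:eQ. destruct H as [Q v H|Q v T0 k hT0 H1 H2 H3 H4].
  - apply run_free. intros s hs0 i hi.
    destruct (Rlt_dec s T) as [h|h]; [apply hs; [lra|lia|exact hi]|].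
    destruct (Req_EM_T s T) as [->|hn].
    + specialize (he i ltac:(lia) hi). rewrite eQ in he. exact he.
    + specialize (H (s - T) ltac:(lra) i hi). rewrite eQ in H. unfold flow in H. lra.
  - assert (eq : (fun i => Q i + T0 * v i) = (fun i => q i + (T + T0) * v i)).
    { apply functional_extensionality. intros i. rewrite eQ. unfold flow. ring. }
    assert (eqi : forall i, Q i + T0 * v i = q i + (T + T0) * v i).
    { intros i. rewrite eQ. unfold flow. ring. }
    rewrite eq in *. apply run_coll; auto.
    + lra.
    + intros s hs0 i hi.
      destruct (Rlt_dec s T) as [h|h]; [apply hs; [lra|lia|exact hi]|].
      destruct (Req_EM_T s T) as [->|hn].
      * specialize (he i ltac:(lia) hi). rewrite eQ in he. exact he.
      * specialize (H1 (s - T) ltac:(lra) i hi). rewrite eQ in H1. unfold flow in H1. lra.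
    + destruct H2 as (i & hi & hi'). exists i. rewrite !eqi in hi'. auto.
    + intros i hi. specialize (H3 i hi). rewrite !eqi in H3. exact H3.
Qed.

(* A state with approaching touching pairs is compared with [run] started after
   all these pairs have collided. *)
Lemma ss_run_pending (n : nat) (m : nat -> R) (B : R) q v T k q' v' :
  pos_on 0 n m -> ss 0 n m B q v T k q' v' -> weak_on 0 n q -> strict_on 0 n v' ->
  exists k', k = (cnt (pendb 0 n q v) 0 n + k')%nat /\
             run n m q (mcoll (pendb 0 n q v) m v) k'.
Proof.
  intros hm H. induction H; intros hq hv.
  - pose proof (increasing_not_pending 0 n q v hv) as hp. exists 0%nat. split.
    + rewrite cnt_false; auto.
    + rewrite mcoll_false by exact hp. apply run_free. intros s hs i hi.
      specialize (hq i ltac:(lia) hi). specialize (hv i ltac:(lia) hi). nra.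
  - destruct (Req_EM_T T 0) as [->|hT].
    { rewrite flow_0 in *. auto. }
    assert (hT0 : 0 < T) by lra.
    pose proof (flow_start_not_pending 0 n q v T hT0 H0) as hp.
    pose proof (flow_end_pending 0 n q v T hT0 H0) as hpe.
    pose proof (flow_weak 0 n q v T hT0 H0) as hw.
    destruct (IHss hw hv) as (k' & ek & hr). rewrite hpe in ek, hr.
    rewrite (mcoll_false (pendb 0 n q v)) by exact hp.
    rewrite (cnt_false (pendb 0 n q v)) by auto. simpl.
    exists k. split; [reflexivity|].
    destruct (Nat.eq_dec (cnt (touchb 0 n (flow q v T)) 0 n) 0) as [e0|e0].
    + pose proof (cnt_0_inv _ _ _ e0) as hnt.
      rewrite e0 in ek. simpl in ek. subst k'.
      rewrite mcoll_false in hr.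
      * apply (run_shift n m q v T); auto.
        intros i h1 h2. specialize (hw i h1 h2). specialize (hnt i h1 h2).
        destruct (Req_EM_T (flow q v T i) (flow q v T (S i))) as [e|e]; [|lra].
        assert (touchb 0 n (flow q v T) i = true) by (apply touchb_spec; auto). congruence.
      * intros i. destruct (touchb 0 n (flow q v T) i) eqn:e; [|reflexivity].
        pose proof (proj1 (touchb_spec _ _ _ _) e) as (h1 & h2 & _).
        rewrite hnt in e by assumption. discriminate.
    + rewrite ek, <- ncoinc_cnt. apply run_coll; auto.
      * intros s hs i hi. apply H0; [exact hs|lia|exact hi].
      * destruct (filter (touchb 0 n (flow q v T)) (seq 0 (n - 1 - 0))) as [|i l] eqn:e.
        { unfold cnt in e0. rewrite e in e0. elim e0. reflexivity. }
        assert (hin : In i (filter (touchb 0 n (flow q v T)) (seq 0 (n - 1 - 0)))).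
        { rewrite e. left. reflexivity. }
        apply filter_In in hin. destruct hin as [_ hin]. apply touchb_spec in hin.
        exists i. split; apply hin.
      * intros i hi [e1 e2]. specialize (H1 i ltac:(lia) hi). unfold flow in H1. lra.
      * rewrite collide_mcoll. exact hr.
  - pose proof (pendb_coll 0 n m q v i hm H H0 H2 H3 H4) as hpc.
    destruct (IHss hq hv) as (k' & ek & hr). rewrite hpc in ek, hr.
    assert (hpi : pendb 0 n q v i = true) by (apply pendb_spec; auto).
    rewrite mcoll_remove in hr.
    + exists k'. split; [|exact hr]. rewrite (cnt_remove _ 0 n i hpi H H0), ek. reflexivity.
    + exact hpi.
    + intros j e. destruct (pendb 0 n q v j) eqn:ej; [|reflexivity].
      apply pendb_spec in ej. specialize (H3 j ltac:(lia) e). rewrite <- e in H3. lra.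
    + destruct (pendb 0 n q v (S i)) eqn:ej; [|reflexivity].
      apply pendb_spec in ej. specialize (H4 (proj1 (proj2 ej))). lra.
Qed.

Lemma ss_run (n : nat) (m : nat -> R) (B : R) q v T k q' v' :
  pos_on 0 n m -> ss 0 n m B q v T k q' v' -> strict_on 0 n q -> strict_on 0 n v' ->
  run n m q v k.
Proof.
  intros hm H hq hv.
  destruct (ss_run_pending n m B q v T k q' v' hm H) as (k' & ek & hr).
  - intros i h1 h2. left. apply hq; auto.
  - exact hv.
  - pose proof (strict_not_pending 0 n q v hq) as hp.
    rewrite mcoll_false in hr by exact hp. rewrite cnt_false in ek by auto.
    simpl in ek. subst k'. exact hr.
Qed.

(** * Stability of the dynamics under perturbation *)

Definition hit (q v : nat -> R) (i : nat) : R := (q (S i) - q i) / (v i - v (S i)).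

(** The time at which particle [j] collides. The default 0 is harmless: a particle in no selected
    pair keeps its velocity, and [layer_pos] then does not depend on [tau]. *)
Definition tau (s : nat -> bool) (q v : nat -> R) (j : nat) : R :=
  if s j then hit q v j
  else match j with O => 0 | S i => if s i then hit q v i else 0 end.

Definition layer_pos (s : nat -> bool) (m q v : nat -> R) (h : R) (j : nat) : R :=
  q j + tau s q v j * v j + (h - tau s q v j) * mcoll s m v j.

Lemma Rabs_mult_le (t x M : R) : 0 <= t -> Rabs x <= M -> - (t * M) <= t * x <= t * M.
Proof.
  intros ht hx. assert (- M <= x <= M).
  { pose proof (Rle_abs x). pose proof (Rle_abs (- x)). rewrite Rabs_Ropp in *. lra. }
  nra.
Qed.

(* During a time h too short for any other encounter, the pairs selected by s
   collide, in whatever order their hitting times dictate. *)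
Lemma ss_layer (a b : nat) (m : nat -> R) (B M : R) (N : nat) :
  pos_on a b m ->
  forall s q v h, cnt s a b = N -> 0 <= h ->
  (forall i, s i = true -> (a <= i)%nat /\ (S i < b)%nat /\ q i <= q (S i) /\ v (S i) < v i /\
     q (S i) - q i <= h * (v i - v (S i)) /\ Rabs (cA m v i) <= M /\ Rabs (cB m v i) <= M) ->
  (forall i, (a <= i)%nat -> (S i < b)%nat -> s i = true \/ q i + 2 * (M * h) < q (S i) \/
     (q i <= q (S i) /\ v i < v (S i))) ->
  (forall i, (a <= i)%nat -> (S (S i) < b)%nat ->
     q i + 2 * (M * h) < q (S i) \/ q (S i) + 2 * (M * h) < q (S (S i))) ->
  (forall i, (a <= i)%nat -> (i < b)%nat -> Rabs (v i) <= M) ->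
  (forall i, (a <= i)%nat -> (i < b)%nat -> Rabs (q i) + M * h < B) ->
  ss a b m B q v h N (layer_pos s m q v h) (mcoll s m v).
Proof.
  intros hm. induction N as [|N IH]; intros s q v h hN hh hs c2 c3 hv hq.
  - assert (hf : forall i, s i = false).
    { intros i. destruct (s i) eqn:e; [|reflexivity].
      destruct (hs i e) as (h1 & h2 & _).
      rewrite (cnt_0_inv s a b hN i h1 h2) in e. discriminate. }
    assert (hM : (a < b)%nat -> 0 <= M * h).
    { intros hab. apply Rmult_le_pos; [|exact hh].
      pose proof (hv a ltac:(lia) hab). pose proof (Rabs_pos (v a)). lra. }
    assert (bd : forall i s, (a <= i)%nat -> (i < b)%nat -> 0 <= s <= h ->
               - (M * h) <= s * v i <= M * h).
    { intros i t h1 h2 ht.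
      pose proof (Rabs_mult_le t (v i) M ltac:(lra) (hv i h1 h2)).
      assert (0 <= M) by (pose proof (hv i h1 h2); pose proof (Rabs_pos (v i)); lra).
      assert (t * M <= M * h) by nra. lra. }
    rewrite mcoll_false by exact hf.
    replace (layer_pos s m q v h) with (flow q v h).
    2:{ apply functional_extensionality. intros j. unfold layer_pos, tau, flow.
        rewrite mcoll_false by exact hf. rewrite hf.
        destruct j; [ring|]. rewrite hf. ring. }
    replace h with (h + 0) at 1 by ring.
    apply ss_flow.
    + exact hh.
    + intros t ht i h1 h2.
      pose proof (bd i t h1 ltac:(lia) ltac:(lra)). pose proof (bd (S i) t ltac:(lia) h2 ltac:(lra)).
      unfold flow. destruct (c2 i h1 h2) as [e|[h3|[h3 h4]]].
      * rewrite hf in e. discriminate.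
      * lra.
      * nra.
    + intros i h1 h2.
      assert (w : forall i, (a <= i)%nat -> (S i < b)%nat -> flow q v h i <= flow q v h (S i)).
      { intros i0 g1 g2. pose proof (bd i0 h g1 ltac:(lia) ltac:(lra)).
        pose proof (bd (S i0) h ltac:(lia) g2 ltac:(lra)).
        unfold flow. destruct (c2 i0 g1 g2) as [e|[h3|[h3 h4]]].
        - rewrite hf in e. discriminate.
        - lra.
        - nra. }
      pose proof (w i h1 ltac:(lia)). pose proof (w (S i) ltac:(lia) h2).
      pose proof (bd i h h1 ltac:(lia) ltac:(lra)). pose proof (bd (S i) h ltac:(lia) ltac:(lia) ltac:(lra)).
      pose proof (bd (S (S i)) h ltac:(lia) ltac:(lia) ltac:(lra)).
      unfold flow in *. destruct (c3 i h1 h2); lra.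
    + intros i h1 h2. specialize (hq i h1 h2). specialize (hM ltac:(lia)). lra.
    + apply ss_nil. intros i h1 h2. specialize (hq i h1 h2).
      pose proof (bd i h h1 h2 ltac:(lra)).
      pose proof (Rabs_triang (q i) (h * v i)).
      assert (Rabs (h * v i) <= M * h) by (apply Rabs_le; lra).
      unfold flow. lra.
  - assert (hne : filter s (seq a (b - 1 - a)) <> []).
    { intros e. unfold cnt in hN. rewrite e in hN. discriminate. }
    (* The pair that meets first. After its collision the other selected pairs form a layer of
       duration [h - t], to which the induction hypothesis applies. *)
    destruct (argmin_list (hit q v) _ hne) as (i & hin & hmin).
    apply filter_In in hin. destruct hin as [_ hi].
    destruct (hs i hi) as (hi1 & hi2 & hi3 & hi4 & hi5 & hi6 & hi7).
    assert (hM0 : 0 <= M) by (pose proof (Rabs_pos (cA m v i)); lra).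
    set (t := hit q v i) in *.
    assert (htd : t * (v i - v (S i)) = q (S i) - q i) by (unfold t, hit; field; lra).
    assert (ht : 0 <= t <= h).
    { split.
      - unfold t, hit. apply Rmult_le_pos; [lra|]. left. apply Rinv_0_lt_compat. lra.
      - apply Rmult_le_reg_r with (v i - v (S i)); lra. }
    assert (hmin' : forall j, s j = true -> t <= hit q v j).
    { intros j hj. apply hmin. apply filter_In. split; [|exact hj].
      destruct (hs j hj) as (g1 & g2 & _). apply in_seq. lia. }
    assert (bd : forall j r, (a <= j)%nat -> (j < b)%nat -> 0 <= r ->
               - (r * M) <= r * v j <= r * M).
    { intros j r h1 h2 hr. apply Rabs_mult_le; auto. }
    assert (bdt : forall j r, (a <= j)%nat -> (j < b)%nat -> 0 <= r <= t ->
               - (M * h) <= r * v j <= M * h /\ r * M <= M * h).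
    { intros j r h1 h2 hr. pose proof (bd j r h1 h2 ltac:(lra)).
      assert (r * M <= M * h) by nra. lra. }
    (* A selected pair meets within time [h] at speeds at most [M], so its gap is at most 2Mh. The
       gaps next to it are therefore long, and selected pairs are disjoint. *)
    assert (nofar : forall j, s j = true -> ~ (q j + 2 * (M * h) < q (S j))).
    { intros j hj hf. destruct (hs j hj) as (g1 & g2 & g3 & g4 & g5 & _).
      pose proof (Rabs_mult_le h (v j) M hh (hv j g1 ltac:(lia))).
      pose proof (Rabs_mult_le h (v (S j)) M hh (hv (S j) ltac:(lia) g2)). nra. }
    assert (farR : (S (S i) < b)%nat -> q (S i) + 2 * (M * h) < q (S (S i))).
    { intros h2. destruct (c3 i hi1 h2) as [g|g]; [elim (nofar i hi g)|exact g]. }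
    assert (farL : forall j, (a <= j)%nat -> S j = i -> q j + 2 * (M * h) < q i).
    { intros j h1 e. destruct (c3 j h1 ltac:(lia)) as [h2|h2].
      - rewrite e in h2. exact h2.
      - rewrite e in h2. elim (nofar i hi h2). }
    assert (sR : s (S i) = false).
    { destruct (s (S i)) eqn:e; [|reflexivity].
      destruct (hs _ e) as (_ & g2 & _). elim (nofar _ e). apply farR. exact g2. }
    assert (sL : forall j, S j = i -> s j = false).
    { intros j e. destruct (s j) eqn:ej; [|reflexivity].
      destruct (hs _ ej) as (g1 & _). elim (nofar _ ej). rewrite e. apply farL; auto. }
    set (s' := fun j => (s j && negb (Nat.eqb i j))%bool).
    set (q1 := flow q v t). set (v1 := coll m v i).
    assert (s's : forall j, s' j = true -> s j = true /\ j <> i).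
    { intros j. unfold s'. rewrite Bool.andb_true_iff, Bool.negb_true_iff, Nat.eqb_neq. intuition. }
    assert (v1o : forall j, s' j = true -> v1 j = v j /\ v1 (S j) = v (S j)).
    { intros j hj. destruct (s's j hj) as [g1 g2]. unfold v1.
      assert (j <> S i) by congruence.
      assert (S j <> i) by (intros e; rewrite (sL j e) in g1; discriminate).
      split; apply coll_out; lia. }
    assert (far1 : forall j, (a <= j)%nat -> (S j < b)%nat ->
               q j + 2 * (M * h) < q (S j) -> q1 j + 2 * (M * (h - t)) < q1 (S j)).
    { intros j g1 g2 g3. pose proof (bd j t g1 ltac:(lia) ltac:(lra)).
      pose proof (bd (S j) t ltac:(lia) g2 ltac:(lra)). unfold q1, flow. nra. }
    assert (hMh : 0 <= M * h) by nra.
    assert (gap : forall j r, s j = true -> 0 <= r -> (r < t -> q j + r * v j < q (S j) + r * v (S j)) /\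
                     (r <= t -> q j + r * v j <= q (S j) + r * v (S j))).
    { intros j r hj hr. destruct (hs j hj) as (g1 & g2 & g3 & g4 & _).
      assert (e : hit q v j * (v j - v (S j)) = q (S j) - q j) by (unfold hit; field; lra).
      specialize (hmin' j hj). split; intros hrt; nra. }
    assert (hIH : ss a b m B q1 v1 (h - t) N (layer_pos s' m q1 v1 (h - t)) (mcoll s' m v1)).
    { apply IH.
      - rewrite (cnt_remove s a b i hi hi1 hi2) in hN. injection hN. auto.
      - lra.
      - intros j hj. destruct (s's j hj) as [g1 g2]. destruct (v1o j hj) as [e1 e2].
        destruct (hs j g1) as (k1 & k2 & k3 & k4 & k5 & k6 & k7).
        assert (cA m v1 j = cA m v j) by (unfold cA; rewrite e1, e2; reflexivity).
        assert (cB m v1 j = cB m v j) by (unfold cB; rewrite e1, e2; reflexivity).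
        repeat split; try lia; try congruence.
        + unfold q1, flow. apply (proj2 (gap j t g1 ltac:(lra))). lra.
        + unfold q1, flow. rewrite e1, e2. lra.
      (* Pair [i] now touches and separates; this is the case for which the gap hypothesis has its
         third alternative. *)
      - intros j g1 g2. destruct (Nat.eq_dec j i) as [->|hn].
        + right. right. split.
          * unfold q1, flow. lra.
          * unfold v1. rewrite coll_l, coll_r.
            pose proof (cB_minus_cA m v i (hm i hi1 ltac:(lia)) (hm (S i) ltac:(lia) hi2)). lra.
        + destruct (c2 j g1 g2) as [e|[e|[e1 e2]]].
          * left. unfold s'. rewrite e. destruct (Nat.eqb_spec i j); [congruence|reflexivity].
          * right. left. apply far1; auto.
          * destruct (Nat.eq_dec j (S i)) as [->|h1].
            { right. left. apply far1; auto. }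
            destruct (Nat.eq_dec (S j) i) as [h2|h2].
            { right. left. apply far1; auto. rewrite h2. apply farL; auto. }
            right. right. split.
            -- unfold q1, flow. nra.
            -- unfold v1. rewrite !coll_out by lia. exact e2.
      - intros j g1 g2. destruct (c3 j g1 g2); [left|right]; apply far1; auto; lia.
      - intros j g1 g2. unfold v1. destruct (Nat.eq_dec j i) as [->|h1].
        + rewrite coll_l. exact hi6.
        + destruct (Nat.eq_dec j (S i)) as [->|h2].
          * rewrite coll_r. exact hi7.
          * rewrite coll_out by assumption. auto.
      - intros j g1 g2. specialize (hq j g1 g2). pose proof (bd j t g1 g2 ltac:(lra)).
        pose proof (Rabs_triang (q j) (t * v j)).
        assert (Rabs (t * v j) <= t * M) by (apply Rabs_le; lra).
        unfold q1, flow. nra. }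
    assert (ev : mcoll s' m v1 = mcoll s m v) by (apply mcoll_remove; auto).
    assert (eq : layer_pos s' m q1 v1 (h - t) = layer_pos s m q v h).
    { apply functional_extensionality. intros j. unfold layer_pos. rewrite ev.
      assert (hij : forall j, s j = true -> j <> i -> hit q1 v1 j = hit q v j - t).
      { intros l hl hn. assert (hl' : s' l = true).
        { unfold s'. rewrite hl. destruct (Nat.eqb_spec i l); [congruence|reflexivity]. }
        destruct (v1o l hl') as [e1 e2]. destruct (hs l hl) as (_ & _ & _ & g4 & _).
        unfold hit, q1, flow. rewrite e1, e2. field. lra. }
      assert (s'o : forall j, j <> i -> s' j = s j).
      { intros l hl. unfold s'. destruct (Nat.eqb_spec i l); [congruence|]. apply Bool.andb_true_r. }
      assert (s'i : s' i = false) by (unfold s'; rewrite Nat.eqb_refl; apply Bool.andb_false_r).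
      unfold tau. destruct (Nat.eq_dec j i) as [->|h1].
      - rewrite hi, s'i. fold t.
        assert (e0 : match i with O => 0 | S i0 => if s' i0 then hit q1 v1 i0 else 0 end = 0).
        { destruct i as [|i0]; [reflexivity|]. rewrite s'o by lia. rewrite (sL i0 eq_refl). reflexivity. }
        rewrite e0. unfold q1, flow. ring.
      - rewrite s'o by assumption. destruct (s j) eqn:ej.
        + rewrite hij by auto.
          assert (v1 j = v j). { apply v1o. rewrite s'o; auto. }
          unfold q1, flow. rewrite H. ring.
        + destruct j as [|j].
          * assert (mcoll s m v 0%nat = v 0%nat) by (unfold mcoll; rewrite ej; reflexivity).
            rewrite H. unfold q1, flow. ring.
          * destruct (Nat.eq_dec j i) as [->|h2].
            -- rewrite s'i, hi. fold t. unfold q1, flow. ring.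
            -- rewrite s'o by assumption. destruct (s j) eqn:ej'.
               ++ rewrite hij by auto.
                  assert (v1 (S j) = v (S j)). { apply v1o. rewrite s'o; auto. }
                  unfold q1, flow. rewrite H. ring.
               ++ assert (mcoll s m v (S j) = v (S j)) by (unfold mcoll; rewrite ej, ej'; reflexivity).
                  rewrite H. unfold q1, flow. ring. }
    rewrite ev, eq in hIH.
    replace h with (t + (h - t)) at 1 by ring.
    apply ss_flow.
    + lra.
    + intros r hr j g1 g2. unfold flow. destruct (c2 j g1 g2) as [e|[e|[e1 e2]]].
      * apply (gap j r e); lra.
      * pose proof (bdt j r g1 ltac:(lia) ltac:(lra)). pose proof (bdt (S j) r ltac:(lia) g2 ltac:(lra)). lra.
      * nra.
    + assert (w : forall j, (a <= j)%nat -> (S j < b)%nat -> q1 j <= q1 (S j)).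
      { intros j g1 g2. unfold q1, flow. destruct (c2 j g1 g2) as [e|[e|[e1 e2]]].
        - apply (proj2 (gap j t e ltac:(lra))). lra.
        - pose proof (bdt j t g1 ltac:(lia) ltac:(lra)). pose proof (bdt (S j) t ltac:(lia) g2 ltac:(lra)). lra.
        - nra. }
      intros j g1 g2. change (q1 j < q1 (S (S j))).
      pose proof (w j g1 ltac:(lia)). pose proof (w (S j) ltac:(lia) g2).
      assert (0 <= M * (h - t)) by nra.
      destruct (c3 j g1 g2) as [e|e]; apply far1 in e; try lia; lra.
    + intros j g1 g2. specialize (hq j g1 g2). lra.
    + apply (ss_coll a b m B q1 v i); auto.
      * unfold q1, flow. lra.
      * intros j g1 g2. pose proof (far1 j g1 ltac:(lia)) as f. rewrite g2 in f.
        specialize (f (farL j g1 g2)). assert (0 <= M * (h - t)) by nra. lra.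
      * intros g2. pose proof (far1 (S i) ltac:(lia) g2 (farR g2)). assert (0 <= M * (h - t)) by nra. lra.
      * intros j g1 g2. specialize (hq j g1 g2). pose proof (bdt j t g1 g2 ltac:(lra)).
        pose proof (Rabs_triang (q j) (t * v j)).
        assert (Rabs (t * v j) <= M * h) by (apply Rabs_le; lra).
        unfold q1, flow. lra.
Qed.

(** * Persistence of a motion along a converging family *)

Lemma lim_flow_0 (q v : nat -> R) (i : nat) :
  tends (at_right 0) (fun h => flow q v h i) (q i).
Proof.
  apply (lim_eq _ _ (q i + 0 * v i)); [ring|]. unfold flow.
  apply lim_plus; [apply filter_filter|apply lim_const; apply filter_filter|].
  apply lim_mult; [apply filter_filter|apply lim_id_right|apply lim_const; apply filter_filter].
Qed.

Section Stability.
Context {U : Type} (F : (U -> Prop) -> Prop) {FF : Filter F}.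

Definition lim_on (a b : nat) (f : U -> nat -> R) (l : nat -> R) : Prop :=
  forall i, (a <= i)%nat -> (i < b)%nat -> tends F (fun u => f u i) (l i).

Lemma lim_on_flow (a b : nat) (qu vu : U -> nat -> R) (q v : nat -> R) (t : R) :
  lim_on a b qu q -> lim_on a b vu v ->
  lim_on a b (fun u => flow (qu u) (vu u) t) (flow q v t).
Proof.
  intros hq hv i h1 h2. unfold flow.
  apply lim_plus; auto. apply lim_mult; auto. apply lim_const; auto.
Qed.

Lemma lim_cA (a b : nat) (mu vu : U -> nat -> R) (m v : nat -> R) (i : nat) :
  pos_on a b m -> lim_on a b mu m -> lim_on a b vu v -> (a <= i)%nat -> (S i < b)%nat ->
  tends F (fun u => cA (mu u) (vu u) i) (cA m v i).
Proof.
  intros hm hmu hvu h1 h2. pose proof (hm i h1 ltac:(lia)). pose proof (hm (S i) ltac:(lia) h2).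
  unfold cA.
  apply lim_div; auto; [lra| |apply lim_plus; auto; apply hmu; lia].
  apply lim_plus; auto; apply lim_mult; auto; try (apply hvu; lia).
  - apply lim_minus; auto; apply hmu; lia.
  - apply lim_mult; auto; try (apply lim_const; auto); apply hmu; lia.
Qed.

Lemma lim_cB (a b : nat) (mu vu : U -> nat -> R) (m v : nat -> R) (i : nat) :
  pos_on a b m -> lim_on a b mu m -> lim_on a b vu v -> (a <= i)%nat -> (S i < b)%nat ->
  tends F (fun u => cB (mu u) (vu u) i) (cB m v i).
Proof.
  intros hm hmu hvu h1 h2. pose proof (hm i h1 ltac:(lia)). pose proof (hm (S i) ltac:(lia) h2).
  unfold cB.
  apply lim_div; auto; [lra| |apply lim_plus; auto; apply hmu; lia].
  apply lim_plus; auto; apply lim_mult; auto; try (apply hvu; lia).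
  - apply lim_minus; auto; apply hmu; lia.
  - apply lim_mult; auto; try (apply lim_const; auto); apply hmu; lia.
Qed.

Lemma lim_on_mcoll (a b : nat) (s : nat -> bool) (mu vu : U -> nat -> R) (m v : nat -> R) :
  pos_on a b m -> (forall i, s i = true -> (a <= i)%nat /\ (S i < b)%nat) ->
  lim_on a b mu m -> lim_on a b vu v ->
  lim_on a b (fun u => mcoll s (mu u) (vu u)) (mcoll s m v).
Proof.
  intros hm hs hmu hvu j h1 h2. unfold mcoll.
  destruct (s j) eqn:e.
  - destruct (hs j e). apply (lim_cA a b); auto.
  - destruct j as [|j]; [apply hvu; auto|].
    destruct (s j) eqn:e'.
    + destruct (hs j e'). apply (lim_cB a b); auto.
    + apply hvu; auto.
Qed.

(** The hitting times of all selected pairs tend to [h], the time at which the unperturbed pairs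
    meet in [Q]. So a perturbed layer started [h] before this encounter and lasting [2 * h] ends
    near the unperturbed state [h] after it. *)
Lemma lim_on_layer (a b : nat) (s : nat -> bool) (mu qu vu : U -> nat -> R) (m Q v : nat -> R) (h : R) :
  pos_on a b m ->
  (forall i, s i = true -> (a <= i)%nat /\ (S i < b)%nat /\ Q i = Q (S i) /\ v (S i) < v i) ->
  lim_on a b mu m -> lim_on a b qu (flow Q v (- h)) -> lim_on a b vu v ->
  lim_on a b (fun u => layer_pos s (mu u) (qu u) (vu u) (2 * h)) (flow Q (mcoll s m v) h).
Proof.
  intros hm hs hmu hqu hvu j h1 h2.
  assert (hc : tends F (fun u => mcoll s (mu u) (vu u) j) (mcoll s m v j)).
  { apply (lim_on_mcoll a b); auto. intros i e. destruct (hs i e) as (g1 & g2 & _). auto. }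
  assert (hh : forall i, s i = true -> tends F (fun u => hit (qu u) (vu u) i) h).
  { intros i e. destruct (hs i e) as (g1 & g2 & g3 & g4). unfold hit.
    apply (lim_eq F _ ((flow Q v (- h) (S i) - flow Q v (- h) i) / (v i - v (S i)))).
    - unfold flow. rewrite g3. field. lra.
    - apply lim_div; auto; [lra| |]; apply lim_minus; auto;
        try (apply hqu; lia); try (apply hvu; lia). }
  assert (gen : forall f : U -> R, tends F f h ->
     tends F (fun u => qu u j + f u * vu u j + (2 * h - f u) * mcoll s (mu u) (vu u) j)
       (flow Q (mcoll s m v) h j)).
  { intros f hf.
    apply (lim_eq F _ (flow Q v (- h) j + h * v j + (2 * h - h) * mcoll s m v j)).
    - unfold flow. ring.
    - apply lim_plus; auto; [apply lim_plus; auto|apply lim_mult; auto].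
      + apply lim_mult; auto.
      + apply lim_minus; auto. apply lim_const; auto. }
  assert (gen0 : mcoll s m v j = v j ->
     tends F (fun u => qu u j + 0 * vu u j + (2 * h - 0) * mcoll s (mu u) (vu u) j)
       (flow Q (mcoll s m v) h j)).
  { intros e.
    apply (lim_eq F _ (flow Q v (- h) j + 0 * v j + (2 * h - 0) * mcoll s m v j)).
    - unfold flow. rewrite e. ring.
    - apply lim_plus; auto; [apply lim_plus; auto|apply lim_mult; auto].
      + apply lim_mult; auto. apply lim_const; auto.
      + apply lim_const; auto. }
  unfold layer_pos, tau. destruct (s j) eqn:e; [apply gen; auto|].
  destruct j as [|j].
  - apply gen0. unfold mcoll. rewrite e. reflexivity.
  - destruct (s j) eqn:e'; [apply gen; auto|].
    apply gen0. unfold mcoll. rewrite e, e'. reflexivity.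
Qed.

(* The perturbed motion is picked up a short time h after the instant at which
   the unperturbed one is in the state (q, v), when all touching pairs have
   collided and separated. *)
Lemma ss_stable_pending (a b : nat) (m : nat -> R) (B : R) q v T k q' v' :
  pos_on a b m -> ss a b m B q v T k q' v' -> weak_on a b q -> strict_on a b v' ->
  exists k', k = (cnt (pendb a b q v) a b + k')%nat /\
  forall eta, 0 < eta -> at_right 0 (fun h => forall mu qu vu,
    lim_on a b mu m -> lim_on a b qu (flow q (mcoll (pendb a b q v) m v) h) ->
    lim_on a b vu (mcoll (pendb a b q v) m v) ->
    F (fun u => exists T1 q1 v1, ss a b (mu u) B (qu u) (vu u) T1 k' q1 v1 /\
       Rabs (T1 - T) < eta /\
       forall i, (a <= i)%nat -> (i < b)%nat ->
         Rabs (q1 i - q' i) < eta /\ Rabs (v1 i - v' i) < eta)).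
Proof.
  intros hm H. induction H; intros hq hv.
  - pose proof (increasing_not_pending a b q v hv) as hp. exists 0%nat. split.
    { rewrite cnt_false; auto. }
    intros eta he. rewrite mcoll_false by exact hp.
    assert (hh : at_right 0 (fun h => forall i, (a <= i)%nat -> (i < b)%nat ->
       Rabs (flow q v h i - q i) < eta /\ Rabs (flow q v h i) < B)).
    { apply filter_forall_range; [apply filter_filter|]. intros i h1 h2.
      pose proof (lim_flow_0 q v i) as hl.
      apply filter_and.
      - apply (proj1 (lim_eps _ _ _) hl); auto.
      - apply (lim_abs_lt _ _ (q i)); auto. }
    revert hh. apply filter_imp. intros h hh mu qu vu hmu hqu hvu.
    assert (hF : F (fun u => forall i, (a <= i)%nat -> (i < b)%nat ->
        Rabs (qu u i - q i) < eta /\ Rabs (vu u i - v i) < eta /\ Rabs (qu u i) < B)).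
    { apply filter_forall_range; auto. intros i h1 h2. destruct (hh i h1 h2) as [g1 g2].
      apply filter_and; [|apply filter_and].
      - apply (lim_abs_lt F (fun u => qu u i - q i) (flow q v h i - q i)); auto.
        apply lim_minus; auto. apply lim_const; auto.
      - apply (proj1 (lim_eps F _ _) (hvu i h1 h2)); auto.
      - apply (lim_abs_lt F _ (flow q v h i)); auto. }
    revert hF. apply filter_imp. intros u hu. exists 0, (qu u), (vu u). split.
    + apply ss_nil. intros i h1 h2. apply hu; auto.
    + split; [rewrite Rminus_0_r, Rabs_R0; exact he|].
      intros i h1 h2. destruct (hu i h1 h2) as (g1 & g2 & _). auto.
  - destruct (Req_EM_T T 0) as [->|hT].
    { rewrite flow_0 in *. destruct (IHss hq hv) as (k' & ek & hr). exists k'.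
      split; [exact ek|]. rewrite Rplus_0_l. exact hr. }
    assert (hT0 : 0 < T) by lra.
    pose proof (flow_start_not_pending a b q v T hT0 H0) as hp.
    pose proof (flow_end_pending a b q v T hT0 H0) as hpe.
    pose proof (flow_weak a b q v T hT0 H0) as hw.
    destruct (IHss hw hv) as (k' & ek & hr). rewrite hpe in ek, hr.
    rewrite (mcoll_false (pendb a b q v)) by exact hp.
    rewrite (cnt_false (pendb a b q v)) by auto. simpl.
    exists k. split; [reflexivity|]. intros eta he.
    set (Q := flow q v T) in *. set (s := touchb a b Q) in *.
    assert (hs : forall i, s i = true -> (a <= i)%nat /\ (S i < b)%nat /\ Q i = Q (S i) /\ v (S i) < v i).
    { intros i e. rewrite <- hpe in e. apply pendb_spec in e. exact e. }
    assert (hQ : forall i, (a <= i)%nat -> (S i < b)%nat -> s i = false -> Q i < Q (S i)).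
    { intros i h1 h2 e. destruct (Req_EM_T (Q i) (Q (S i))) as [e'|e'].
      - assert (s i = true) by (apply touchb_spec; auto). congruence.
      - specialize (hw i h1 h2). lra. }
    destruct (bounded_range v b) as (M1 & hM1 & bM1).
    destruct (bounded_range (cA m v) b) as (M2 & hM2 & bM2).
    destruct (bounded_range (cB m v) b) as (M3 & hM3 & bM3).
    set (M := M1 + M2 + M3).
    assert (hbQ : bounded_on a b B Q) by (apply (ss_bounded_start a b m B _ _ _ _ _ _ H3)).
    (* [h'] is half the width of a window around the end of the flow. It is so small that only the
       pairs touching in [Q] can meet inside the window, and that the induction hypothesis applies
       [h'] after the encounter. *)
    assert (ha : at_right 0 (fun h' =>
      (0 < h' < Rmin (T / 2) (eta / 4)) /\
      (forall i, (a <= i)%nat -> (i < b)%nat -> Rabs (flow Q v (- h') i) + M * (2 * h') < B) /\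
      (forall i, (a <= i)%nat -> (i < b)%nat -> (S i < b)%nat -> s i = false ->
          flow Q v (- h') i + 2 * (M * (2 * h')) < flow Q v (- h') (S i)) /\
      (forall mu qu vu, lim_on a b mu m -> lim_on a b qu (flow Q (mcoll s m v) h') ->
        lim_on a b vu (mcoll s m v) ->
        F (fun u => exists T1 q1 v1, ss a b (mu u) B (qu u) (vu u) T1 k' q1 v1 /\
         Rabs (T1 - T') < eta / 4 /\
         forall i, (a <= i)%nat -> (i < b)%nat ->
         Rabs (q1 i - q' i) < eta / 4 /\ Rabs (v1 i - v' i) < eta / 4)))).
    { assert (hfl : forall i, tends (at_right 0) (fun h' => flow Q v (- h') i) (Q i)).
      { intros i. apply (lim_eq _ _ (Q i + - 0 * v i)); [ring|]. unfold flow.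
        apply lim_plus; [apply filter_filter|apply lim_const; apply filter_filter|].
        apply lim_mult; [apply filter_filter| |apply lim_const; apply filter_filter].
        apply lim_opp. apply lim_id_right. }
      assert (hM2h : forall c, tends (at_right 0) (fun h' => c * (M * (2 * h'))) 0).
      { intros c. apply (lim_eq _ _ (c * (M * (2 * 0)))); [ring|].
        apply lim_mult; [apply filter_filter|apply lim_const; apply filter_filter|].
        apply lim_mult; [apply filter_filter|apply lim_const; apply filter_filter|].
        apply lim_mult; [apply filter_filter|apply lim_const; apply filter_filter|].
        apply lim_id_right. }
      apply filter_and; [|apply filter_and; [|apply filter_and]].
      - apply at_right_lt. apply Rmin_pos; lra.
      - apply filter_forall_range; [apply filter_filter|]. intros i h1 h2.
        specialize (hbQ i h1 h2).
        assert (hb2 : Rabs (Q i) < (Rabs (Q i) + B) / 2) by lra.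
        pose proof (lim_abs_lt (at_right 0) _ _ _ hb2 (hfl i)) as A1.
        assert (A2 : at_right 0 (fun h' => 1 * (M * (2 * h')) < (B - Rabs (Q i)) / 2)).
        { apply (lim_lt _ _ _ 0 ((B - Rabs (Q i)) / 2)); [lra|apply hM2h|apply lim_const; apply filter_filter]. }
        generalize (filter_and _ _ A1 A2). apply filter_imp. intros x [x1 x2]. lra.
      - apply filter_forall_range; [apply filter_filter|]. intros i h1 h2.
        destruct (Compare_dec.lt_dec (S i) b) as [h3|h3].
        2:{ apply filter_forall. intros x h. contradiction. }
        destruct (s i) eqn:e.
        { apply filter_forall. intros x _ h. discriminate. }
        specialize (hQ i h1 h3 e).
        assert (A : at_right 0 (fun h' => flow Q v (- h') i + 2 * (M * (2 * h')) < flow Q v (- h') (S i))).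
        { apply (lim_lt _ _ _ (Q i + 0) (Q (S i))); [lra| |apply hfl].
          apply lim_plus; [apply filter_filter|apply hfl|apply hM2h]. }
        revert A. apply filter_imp. auto.
      - apply hr. lra. }
    apply at_right_ex in ha. destruct ha as (e & he0 & ha).
    destruct (ha (e / 2) ltac:(lra)) as (hh & hB2 & hfar & hcont). set (h' := e / 2) in *.
    pose proof (Rmin_l (T / 2) (eta / 4)). pose proof (Rmin_r (T / 2) (eta / 4)).
    assert (hb' : at_right 0 (fun h => (0 < h < Rmin (T / 2) (eta / 4)) /\
       bounded_on a b B (flow q v h))).
    { apply filter_and; [apply at_right_lt; apply Rmin_pos; lra|].
      unfold bounded_on. apply filter_forall_range; [apply filter_filter|]. intros i h1 h2.
      apply (lim_abs_lt _ _ (q i)); [apply H2; auto|].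
      apply lim_flow_0. }
    revert hb'. apply filter_imp. intros h [hh1 hbd] mu qu vu hmu hqu hvu.
    (* The perturbed motion flies freely from [h] after the start to [h'] before the encounter, then
       passes a layer of duration [2 * h']. *)
    set (t1 := T - h' - h).
    set (q2 := fun u => flow (qu u) (vu u) t1).
    assert (hq2 : lim_on a b q2 (flow Q v (- h'))).
    { replace (flow Q v (- h')) with (flow (flow q v h) v t1).
      - apply lim_on_flow; auto.
      - unfold Q. rewrite !flow_add. f_equal. unfold t1. ring. }
    assert (hq3 := lim_on_layer a b s mu q2 vu m Q v h' hm hs hmu hq2 hvu).
    assert (hv3 := lim_on_mcoll a b s mu vu m v hm
              (fun i e => conj (proj1 (hs i e)) (proj1 (proj2 (hs i e)))) hmu hvu).
    (* The states after the layer again form a family converging along [F]. This is why the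
       statement speaks of families: the induction needs no explicit radii. *)
    specialize (hcont mu _ _ hmu hq3 hv3).
    assert (E1 : F (fun u => bounded_on a b B (qu u))).
    { unfold bounded_on. apply filter_forall_range; auto. intros i h1 h2.
      apply (lim_abs_lt F _ (flow q v h i)); auto. }
    assert (E2 : F (fun u => forall i, (a <= i)%nat -> (i < b)%nat ->
       (S i < b)%nat -> qu u i < qu u (S i) /\ q2 u i < q2 u (S i))).
    { apply filter_forall_range; auto. intros i h1 h2.
      destruct (Compare_dec.lt_dec (S i) b) as [h3|h3].
      2:{ apply filter_forall. intros x g. contradiction. }
      assert (A1 : F (fun u => qu u i < qu u (S i))).
      { apply (lim_lt F _ _ (flow q v h i) (flow q v h (S i))); [|apply hqu; lia|apply hqu; lia].
        apply H0; auto; lra. }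
      assert (A2 : F (fun u => q2 u i < q2 u (S i))).
      { apply (lim_lt F _ _ (flow Q v (- h') i) (flow Q v (- h') (S i))); [|apply hq2; lia|apply hq2; lia].
        unfold Q. rewrite flow_add. apply H0; auto; lra. }
      generalize (filter_and _ _ A1 A2). apply filter_imp. auto. }
    assert (E3 : F (fun u => forall i, (a <= i)%nat -> (i < b)%nat ->
       0 < mu u i /\ Rabs (vu u i) < M /\ Rabs (q2 u i) + M * (2 * h') < B)).
    { apply filter_forall_range; auto. intros i h1 h2.
      apply filter_and; [|apply filter_and].
      - apply (lim_lt F _ _ 0 (m i)); [apply hm; auto|apply lim_const; auto|apply hmu; auto].
      - apply (lim_abs_lt F _ (v i)); [|apply hvu; auto]. specialize (bM1 i h2). unfold M. lra.
      - specialize (hB2 i h1 h2).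
        assert (A : F (fun u => Rabs (q2 u i) < B - M * (2 * h'))).
        { apply (lim_abs_lt F _ (flow Q v (- h') i)); [lra|apply hq2; auto]. }
        revert A. apply filter_imp. intros; lra. }
    assert (E4 : F (fun u => forall i, (a <= i)%nat -> (i < b)%nat -> (S i < b)%nat ->
       (s i = true -> vu u (S i) < vu u i /\ q2 u (S i) - q2 u i < 2 * h' * (vu u i - vu u (S i)) /\
          Rabs (cA (mu u) (vu u) i) < M /\ Rabs (cB (mu u) (vu u) i) < M) /\
       (s i = false -> q2 u i + 2 * (M * (2 * h')) < q2 u (S i)))).
    { apply filter_forall_range; auto. intros i h1 h2.
      destruct (Compare_dec.lt_dec (S i) b) as [h3|h3].
      2:{ apply filter_forall. intros x g. contradiction. }
      destruct (s i) eqn:es.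
      - destruct (hs i es) as (_ & _ & g3 & g4).
        assert (A : F (fun u => vu u (S i) < vu u i /\ q2 u (S i) - q2 u i < 2 * h' * (vu u i - vu u (S i)) /\
          Rabs (cA (mu u) (vu u) i) < M /\ Rabs (cB (mu u) (vu u) i) < M)).
        { apply filter_and; [|apply filter_and; [|apply filter_and]].
          - apply (lim_lt F _ _ (v (S i)) (v i)); auto; apply hvu; lia.
          - apply (lim_lt F _ _ (flow Q v (- h') (S i) - flow Q v (- h') i) (2 * h' * (v i - v (S i)))).
            + unfold flow. rewrite g3. nra.
            + apply lim_minus; auto; apply hq2; lia.
            + apply lim_mult; auto; [apply lim_const; auto|apply lim_minus; auto; apply hvu; lia].
          - apply (lim_abs_lt F _ (cA m v i)); [|apply (lim_cA a b); auto].
            specialize (bM2 i h2). unfold M. lra.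
          - apply (lim_abs_lt F _ (cB m v i)); [|apply (lim_cB a b); auto].
            specialize (bM3 i h2). unfold M. lra. }
        revert A. apply filter_imp. intros u hu _. split; [auto|discriminate].
      - assert (A : F (fun u => q2 u i + 2 * (M * (2 * h')) < q2 u (S i))).
        { apply (lim_lt F _ _ (flow Q v (- h') i + 2 * (M * (2 * h'))) (flow Q v (- h') (S i))).
          - apply hfar; auto.
          - apply lim_plus; auto; try (apply lim_const; auto); apply hq2; lia.
          - apply hq2; lia. }
        revert A. apply filter_imp. intros u hu _. split; [discriminate|auto]. }
    generalize (filter_and _ _ hcont (filter_and _ _ E1 (filter_and _ _ E2 (filter_and _ _ E3 E4)))).
    apply filter_imp. intros u ((T1 & q1 & v1 & r1 & r2 & r3) & u1 & u2 & u3 & u4).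
    exists (t1 + (2 * h' + T1)), q1, v1. split; [|split].
    + assert (st : forall r, 0 <= r <= t1 -> strict_on a b (flow (qu u) (vu u) r)).
      { intros r hr0 i h1 h2. destruct (u2 i h1 ltac:(lia) h2) as [x1 x2].
        apply (flow_lt_between _ _ t1); auto. }
      apply ss_flow.
      * unfold t1. lra.
      * intros r hr0. apply st. lra.
      * intros i h1 h2. assert (ht1 : 0 <= t1 <= t1) by (unfold t1; lra).
        pose proof (st t1 ht1 i h1 ltac:(lia)). pose proof (st t1 ht1 (S i) ltac:(lia) h2). lra.
      * exact u1.
      * rewrite ek. change (flow (qu u) (vu u) t1) with (q2 u).
        apply (ss_app a b (mu u) B _ _ _ _ (layer_pos s (mu u) (q2 u) (vu u) (2 * h')) (mcoll s (mu u) (vu u)));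
          [|exact r1].
        apply (ss_layer a b (mu u) B M).
        -- intros i h1 h2. apply u3; auto.
        -- reflexivity.
        -- lra.
        -- intros i es. destruct (hs i es) as (g1 & g2 & _).
           destruct (proj1 (u4 i g1 ltac:(lia) g2) es) as (x1 & x2 & x3 & x4).
           destruct (u2 i g1 ltac:(lia) g2). repeat split; auto; lra.
        -- intros i g1 g2. destruct (s i) eqn:es; [left; reflexivity|].
           right. left. apply (u4 i); auto; lia.
        -- intros i g1 g2. destruct (s i) eqn:es.
           ++ right. apply (u4 (S i)); try lia.
              destruct (s (S i)) eqn:es'; [|reflexivity].
              destruct (hs i es) as (_ & _ & z1 & _). destruct (hs (S i) es') as (_ & _ & z2 & _).
              specialize (H1 i g1 g2). fold Q in H1. lra.
           ++ left. apply (u4 i); auto; lia.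
        -- intros i g1 g2. left. apply u3; auto.
        -- intros i g1 g2. apply u3; auto.
    + unfold t1. replace (T - h' - h + (2 * h' + T1) - (T + T')) with ((T1 - T') + (h' - h)) by ring.
      apply Rabs_def2 in r2. apply Rabs_def1; lra.
    + intros i h1 h2. destruct (r3 i h1 h2). split; lra.
  - pose proof (pendb_coll a b m q v i hm H H0 H2 H3 H4) as hpc.
    destruct (IHss hq hv) as (k' & ek & hr). rewrite hpc in ek, hr.
    assert (hpi : pendb a b q v i = true) by (apply pendb_spec; auto).
    rewrite mcoll_remove in hr.
    + exists k'. split; [|exact hr]. rewrite (cnt_remove _ a b i hpi H H0), ek. reflexivity.
    + exact hpi.
    + intros j e. destruct (pendb a b q v j) eqn:ej; [|reflexivity].
      apply pendb_spec in ej. specialize (H3 j ltac:(lia) e). rewrite <- e in H3. lra.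
    + destruct (pendb a b q v (S i)) eqn:ej; [|reflexivity].
      apply pendb_spec in ej. specialize (H4 (proj1 (proj2 ej))). lra.
Qed.

End Stability.

Definition close_on (a b : nat) (r : R) (f g : nat -> R) : Prop :=
  forall i, (a <= i)%nat -> (i < b)%nat -> Rabs (f i - g i) < r.

Definition state_nbhd (a b : nat) (m q v : nat -> R)
  (P : (nat -> R) * (nat -> R) * (nat -> R) -> Prop) : Prop :=
  exists r, 0 < r /\ forall m1 q1 v1, close_on a b r m1 m -> close_on a b r q1 q ->
    close_on a b r v1 v -> P (m1, q1, v1).

#[global] Instance state_nbhd_filter (a b : nat) (m q v : nat -> R) : Filter (state_nbhd a b m q v).
Proof.
  split.
  - exists 1. split; [lra|auto].
  - intros P Q (r1 & h1 & H1) (r2 & h2 & H2). exists (Rmin r1 r2).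
    split; [apply Rmin_pos; auto|]. pose proof (Rmin_l r1 r2). pose proof (Rmin_r r1 r2).
    intros m1 q1 v1 g1 g2 g3. split.
    + apply H1; intros i i1 i2; [specialize (g1 i i1 i2)|specialize (g2 i i1 i2)|specialize (g3 i i1 i2)]; lra.
    + apply H2; intros i i1 i2; [specialize (g1 i i1 i2)|specialize (g2 i i1 i2)|specialize (g3 i i1 i2)]; lra.
  - intros P Q hPQ (r & hr & H). exists r. split; [exact hr|]. intros. apply hPQ. auto.
Qed.

(** From a strictly ordered start nothing is pending, and for a short time [h] all perturbed motions
    are free; after it [ss_stable_pending] takes over, along the filter of neighbourhoods of the
    initial state. The increasing final velocities ensure that no pair is left to collide at the
    end. *)
Theorem ss_stable (a b : nat) (m : nat -> R) (B : R) q v T k q' v' (eta : R) :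
  pos_on a b m -> ss a b m B q v T k q' v' -> strict_on a b q -> strict_on a b v' ->
  0 < eta ->
  exists r, 0 < r /\ forall m1 q1 v1,
    close_on a b r m1 m -> close_on a b r q1 q -> close_on a b r v1 v ->
    exists T1 q2 v2, ss a b m1 B q1 v1 T1 k q2 v2 /\ Rabs (T1 - T) < eta /\
      close_on a b eta q2 q' /\ close_on a b eta v2 v'.
Proof.
  intros hm H hq hv he.
  set (N := state_nbhd a b m q v).
  destruct (ss_stable_pending N a b m B q v T k q' v' hm H) as (k' & ek & hr).
  { intros i h1 h2. left. apply hq; auto. }
  { exact hv. }
  pose proof (strict_not_pending a b q v hq) as hp.
  rewrite mcoll_false in hr by exact hp. rewrite cnt_false in ek by auto.
  simpl in ek. subst k'.
  pose proof (ss_bounded_start _ _ _ _ _ _ _ _ _ _ H) as hb.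
  assert (L1 : lim_on N a b (fun u => fst (fst u)) m).
  { intros i h1 h2. apply lim_eps; [apply state_nbhd_filter|]. intros e' he'.
    exists e'. split; [exact he'|]. intros m1 q1 v1 g1 _ _. apply g1; auto. }
  assert (L2 : lim_on N a b (fun u => snd (fst u)) q).
  { intros i h1 h2. apply lim_eps; [apply state_nbhd_filter|]. intros e' he'.
    exists e'. split; [exact he'|]. intros m1 q1 v1 _ g1 _. apply g1; auto. }
  assert (L3 : lim_on N a b (fun u => snd u) v).
  { intros i h1 h2. apply lim_eps; [apply state_nbhd_filter|]. intros e' he'.
    exists e'. split; [exact he'|]. intros m1 q1 v1 _ _ g1. apply g1; auto. }
  assert (A : at_right 0 (fun h => 0 < h < eta / 2 /\
      (forall i, (a <= i)%nat -> (i < b)%nat -> (S i < b)%nat -> flow q v h i < flow q v h (S i)))).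
  { apply filter_and; [apply at_right_lt; lra|].
    apply filter_forall_range; [apply filter_filter|]. intros i h1 h2.
    destruct (Compare_dec.lt_dec (S i) b) as [h3|h3].
    2:{ apply filter_forall. intros x g. contradiction. }
    pose proof (lim_flow_0 q v) as hfl.
    assert (A : at_right 0 (fun h => flow q v h i < flow q v h (S i))).
    { apply (lim_lt _ _ _ (q i) (q (S i))); auto. }
    revert A. apply filter_imp. auto. }
  specialize (hr (eta / 2) ltac:(lra)).
  destruct (at_right_ex _ (filter_and _ _ hr A)) as (e & he0 & hh).
  destruct (hh (e / 2) ltac:(lra)) as (hr1 & hA & hst). clear hh. set (h := e / 2) in *.
  specialize (hr1 _ _ _ L1 (lim_on_flow N a b _ _ _ _ h L2 L3) L3).
  assert (E : N (fun u => (forall i, (a <= i)%nat -> (i < b)%nat ->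
      Rabs (snd (fst u) i) < B /\ ((S i < b)%nat -> snd (fst u) i < snd (fst u) (S i) /\
      flow (snd (fst u)) (snd u) h i < flow (snd (fst u)) (snd u) h (S i))))).
  { apply filter_forall_range; [apply state_nbhd_filter|]. intros i h1 h2.
    apply filter_and.
    - apply (lim_abs_lt N _ (q i)); auto.
    - destruct (Compare_dec.lt_dec (S i) b) as [h3|h3].
      2:{ apply filter_forall. intros x g. contradiction. }
      assert (A1 : N (fun u => snd (fst u) i < snd (fst u) (S i))).
      { apply (lim_lt N _ _ (q i) (q (S i))); auto; apply L2; lia. }
      assert (A2 : N (fun u => flow (snd (fst u)) (snd u) h i < flow (snd (fst u)) (snd u) h (S i))).
      { apply (lim_lt N _ _ (flow q v h i) (flow q v h (S i))); auto;
          apply (lim_on_flow N a b _ _ _ _ h L2 L3); lia. }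
      generalize (filter_and _ _ A1 A2). apply filter_imp. auto. }
  destruct (filter_and _ _ hr1 E) as (r & hr0 & hfin).
  exists r. split; [exact hr0|]. intros m1 q1 v1 g1 g2 g3.
  destruct (hfin m1 q1 v1 g1 g2 g3) as ((T1 & q2 & v2 & x1 & x2 & x3) & y). simpl in *.
  exists (h + T1), q2, v2. split; [|split; [|split]].
  - apply ss_flow; auto.
    + lra.
    + intros s hs i h1 h2. destruct (y i h1 ltac:(lia)) as [_ y1]. destruct (y1 h2) as [z1 z2].
      apply (flow_lt_between _ _ h); auto; lra.
    + intros i h1 h2. destruct (y i h1 ltac:(lia)) as [_ y1]. destruct (y (S i) ltac:(lia) ltac:(lia)) as [_ y2].
      specialize (y1 ltac:(lia)). specialize (y2 h2). lra.
    + intros i h1 h2. apply y; auto.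
  - apply Rabs_def2 in x2. apply Rabs_def1; lra.
  - intros i h1 h2. destruct (x3 i h1 h2). lra.
  - intros i h1 h2. destruct (x3 i h1 h2). lra.
Qed.

(** * Equal masses *)

Fixpoint inversions (l : list R) : nat :=
  match l with
  | [] => 0
  | x :: l' => length (filter (fun y => if Rlt_dec y x then true else false) l') + inversions l'
  end%nat.

Definition vals (v : nat -> R) (a b : nat) : list R := map v (seq a (b - a)).

Lemma inversions_swap (l1 l2 : list R) (x y : R) :
  y < x -> inversions (l1 ++ x :: y :: l2) = S (inversions (l1 ++ y :: x :: l2)).
Proof.
  intros h. induction l1 as [|z l1 IH].
  - simpl. destruct (Rlt_dec y x); [|lra]. destruct (Rlt_dec x y); [lra|]. simpl. lia.
  - simpl. rewrite IH, !filter_app, !length_app. simpl.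
    destruct (Rlt_dec x z), (Rlt_dec y z); simpl; lia.
Qed.

Lemma strict_on_lt (a b : nat) (v : nat -> R) :
  strict_on a b v -> forall i j, (a <= i)%nat -> (i < j)%nat -> (j < b)%nat -> v i < v j.
Proof.
  intros h i j h1 h2 h3. induction j as [|j IH]; [lia|].
  pose proof (h j ltac:(lia) h3). destruct (Nat.eq_dec i j) as [->|hn]; [assumption|].
  specialize (IH ltac:(lia) ltac:(lia)). lra.
Qed.

Lemma filter_all (A : Type) (f : A -> bool) (l : list A) :
  (forall x, In x l -> f x = true) -> filter f l = l.
Proof.
  induction l as [|x l IH]; intros h; [reflexivity|]. simpl.
  rewrite (h x) by (left; reflexivity). f_equal. apply IH. intros. apply h. right. assumption.
Qed.

Lemma filter_none (A : Type) (f : A -> bool) (l : list A) :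
  (forall x, In x l -> f x = false) -> filter f l = [].
Proof.
  induction l as [|x l IH]; intros h; [reflexivity|]. simpl.
  rewrite (h x) by (left; reflexivity). apply IH. intros. apply h. right. assumption.
Qed.

Lemma inversions_increasing (v : nat -> R) (a b : nat) :
  strict_on a b v -> inversions (vals v a b) = 0%nat.
Proof.
  intros h. pose proof (strict_on_lt a b v h) as hl. clear h. unfold vals.
  remember (b - a)%nat as len eqn:e. revert a e hl.
  induction len as [|len IH]; intros a e hl; [reflexivity|]. simpl.
  rewrite filter_none.
  - simpl. apply IH; [lia|]. intros i j h1 h2 h3. apply hl; lia.
  - intros x hx. apply in_map_iff in hx. destruct hx as (j & <- & hj). apply in_seq in hj.
    pose proof (hl a j ltac:(lia) ltac:(lia) ltac:(lia)).
    destruct (Rlt_dec (v j) (v a)); [lra|reflexivity].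
Qed.

Lemma binom_0 (n : nat) : binom n 0 = 1%nat.
Proof. destruct n; reflexivity. Qed.

Lemma binom_1 (n : nat) : binom n 1 = n.
Proof. induction n as [|n IH]; [reflexivity|]. simpl. rewrite binom_0, IH. reflexivity. Qed.

Lemma inversions_decreasing (v : nat -> R) (a b : nat) :
  strict_on a b (fun i => - v i) -> inversions (vals v a b) = binom (b - a) 2.
Proof.
  intros h. pose proof (strict_on_lt a b _ h) as hl. clear h. unfold vals.
  remember (b - a)%nat as len eqn:e. revert a e hl.
  induction len as [|len IH]; intros a e hl; [reflexivity|]. simpl.
  rewrite filter_all.
  - rewrite length_map, length_seq, IH, binom_1; [reflexivity|lia|].
    intros i j h1 h2 h3. apply hl; lia.
  - intros x hx. apply in_map_iff in hx. destruct hx as (j & <- & hj). apply in_seq in hj.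
    pose proof (hl a j ltac:(lia) ltac:(lia) ltac:(lia)). simpl in *.
    destruct (Rlt_dec (v j) (v a)); [reflexivity|lra].
Qed.

Lemma inversions_snoc (l : list R) (z : R) :
  (forall x, In x l -> z < x) -> inversions (l ++ [z]) = (inversions l + length l)%nat.
Proof.
  induction l as [|x l IH]; intros h; [reflexivity|]. simpl.
  rewrite filter_app, length_app, IH by (intros; apply h; right; assumption). simpl.
  specialize (h x (or_introl eq_refl)). destruct (Rlt_dec z x); [simpl; lia|lra].
Qed.

Lemma vals_split (v : nat -> R) (a b i : nat) :
  (a <= i)%nat -> (S i < b)%nat ->
  vals v a b = map v (seq a (i - a)) ++ v i :: v (S i) :: map v (seq (S (S i)) (b - S (S i))).
Proof.
  intros h1 h2. unfold vals.
  replace (b - a)%nat with ((i - a) + S (S (b - S (S i))))%nat by lia.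
  rewrite seq_app, map_app. simpl. replace (a + (i - a))%nat with i by lia. reflexivity.
Qed.

Lemma vals_snoc (v : nat -> R) (a b : nat) :
  (a <= b)%nat -> vals v a (S b) = vals v a b ++ [v b].
Proof.
  intros h. unfold vals. replace (S b - a)%nat with (S (b - a)) by lia.
  rewrite seq_S, map_app. simpl. do 3 f_equal. lia.
Qed.

(** Equal masses only permute velocities, so the final velocities, once known to be increasing, are
    determined by the initial ones. *)
Lemma sorted_vals_unique (f g : nat -> R) (a b : nat) :
  strict_on a b f -> strict_on a b g -> Permutation (vals f a b) (vals g a b) ->
  forall i, (a <= i)%nat -> (i < b)%nat -> f i = g i.
Proof.
  intros hf hg. pose proof (strict_on_lt a b f hf) as lf. pose proof (strict_on_lt a b g hg) as lg.
  clear hf hg. unfold vals. remember (b - a)%nat as len eqn:e. revert a e lf lg.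
  induction len as [|len IH]; intros a e lf lg hp i h1 h2; [lia|]. simpl in hp.
  assert (e0 : f a = g a).
  { assert (i1 : In (f a) (g a :: map g (seq (S a) len))).
    { apply (Permutation_in _ hp). left. reflexivity. }
    assert (i2 : In (g a) (f a :: map f (seq (S a) len))).
    { apply (Permutation_in _ (Permutation_sym hp)). left. reflexivity. }
    destruct i1 as [i1|i1]; [auto|]. destruct i2 as [i2|i2]; [auto|].
    apply in_map_iff in i1. destruct i1 as (j & ej & hj). apply in_seq in hj.
    apply in_map_iff in i2. destruct i2 as (l & el & hl). apply in_seq in hl.
    pose proof (lg a j ltac:(lia) ltac:(lia) ltac:(lia)).
    pose proof (lf a l ltac:(lia) ltac:(lia) ltac:(lia)). lra. }
  destruct (Nat.eq_dec i a) as [->|hn]; [exact e0|].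
  rewrite e0 in hp. apply Permutation_cons_inv in hp.
  apply (IH (S a)); try lia; auto; intros; [apply lf|apply lg]; lia.
Qed.

Definition injective_on (a b : nat) (v : nat -> R) : Prop :=
  forall i j, (a <= i)%nat -> (i < b)%nat -> (a <= j)%nat -> (j < b)%nat -> i <> j -> v i <> v j.

(** Concerns free lines, not particles, and all triples of them: after some exchanges any lines may
    become neighbours. *)
Definition no_triple_point (a b : nat) (q v : nat -> R) : Prop :=
  forall s i j l, 0 <= s -> (a <= i)%nat -> (i < b)%nat -> (a <= j)%nat -> (j < b)%nat ->
    (a <= l)%nat -> (l < b)%nat -> i <> j -> j <> l -> i <> l ->
    flow q v s i = flow q v s j -> flow q v s j = flow q v s l -> False.

(** Strong induction on the inversions of the velocity sequence: the adjacent descending pair that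
    meets first exchanges velocities, which removes exactly one inversion. *)
Lemma ss_equal_masses (a b : nat) (m : nat -> R) (N : nat) :
  (forall i, (a <= i)%nat -> (i < b)%nat -> m i = 1) ->
  forall q v, inversions (vals v a b) = N -> weak_on a b q -> injective_on a b v ->
  no_triple_point a b q v ->
  exists B T q' v', ss a b m B q v T N q' v' /\ strict_on a b q' /\ strict_on a b v' /\
    Permutation (vals v' a b) (vals v a b).
Proof.
  intros hm. induction N as [N IH] using (well_founded_induction Nat.lt_wf_0). intros q v hN hq hinj h3.
  set (desc := fun i => if Rlt_dec (v (S i)) (v i) then true else false).
  destruct (filter desc (seq a (b - 1 - a))) as [|i0 l0] eqn:ef.
  - assert (hv : strict_on a b v).
    { intros i h1 h2. destruct (Rlt_dec (v (S i)) (v i)) as [h|h].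
      - assert (hin : In i (filter desc (seq a (b - 1 - a)))).
        { apply filter_In. split; [apply in_seq; lia|]. unfold desc.
          destruct (Rlt_dec (v (S i)) (v i)); [reflexivity|contradiction]. }
        rewrite ef in hin. destruct hin.
      - pose proof (hinj i (S i) h1 ltac:(lia) ltac:(lia) h2 ltac:(lia)). lra. }
    rewrite inversions_increasing in hN by exact hv. subst N.
    assert (st : forall s, 0 < s -> strict_on a b (flow q v s)).
    { intros s hs i h1 h2. specialize (hq i h1 h2). specialize (hv i h1 h2). unfold flow. nra. }
    destruct (bounded_range q b) as (B1 & hB1 & b1).
    destruct (bounded_range (flow q v 1) b) as (B2 & hB2 & b2).
    (* The last colliding pair may still touch; one more unit of free flight separates it. *)
    exists (B1 + B2), (1 + 0), (flow q v 1), v. split; [|split; [|split]].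
    + apply ss_flow; [lra| | | |].
      * intros s hs. apply st. lra.
      * intros i h1 h2. pose proof (st 1 ltac:(lra) i h1 ltac:(lia)).
        pose proof (st 1 ltac:(lra) (S i) ltac:(lia) ltac:(lia)). lra.
      * intros i h1 h2. specialize (b1 i h2). lra.
      * apply ss_nil. intros i h1 h2. specialize (b2 i h2). lra.
    + apply st. lra.
    + exact hv.
    + apply Permutation_refl.
  - destruct (argmin_list (hit q v) (filter desc (seq a (b - 1 - a)))) as (i & hin & hmin).
    { rewrite ef. discriminate. }
    assert (dI : forall j, In j (filter desc (seq a (b - 1 - a))) <->
                 (a <= j)%nat /\ (S j < b)%nat /\ v (S j) < v j).
    { intros j. rewrite filter_In, in_seq. unfold desc.
      destruct (Rlt_dec (v (S j)) (v j)); intuition (try lia; try discriminate). }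
    clear i0 l0 ef. apply dI in hin. destruct hin as (hi1 & hi2 & hi3).
    set (t := hit q v i) in *.
    assert (htd : t * (v i - v (S i)) = q (S i) - q i) by (unfold t, hit; field; lra).
    pose proof (hq i hi1 hi2) as hqi.
    assert (ht : 0 <= t).
    { unfold t, hit. apply Rmult_le_pos; [lra|]. left. apply Rinv_0_lt_compat. lra. }
    assert (gap : forall j r, (a <= j)%nat -> (S j < b)%nat -> 0 <= r ->
       (0 < r < t -> flow q v r j < flow q v r (S j)) /\ (r <= t -> flow q v r j <= flow q v r (S j))).
    { intros j r g1 g2 hr. pose proof (hq j g1 g2) as hqj. unfold flow.
      destruct (Rlt_dec (v (S j)) (v j)) as [hd|hd].
      - assert (e : hit q v j * (v j - v (S j)) = q (S j) - q j) by (unfold hit; field; lra).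
        specialize (hmin j (proj2 (dI j) (conj g1 (conj g2 hd)))). split; intros; nra.
      - pose proof (hinj j (S j) g1 ltac:(lia) ltac:(lia) g2 ltac:(lia)). split; intros; nra. }
    set (q1 := flow q v t). set (v1 := coll m v i).
    assert (w1 : weak_on a b q1).
    { intros j g1 g2. apply (gap j t g1 g2 ht). lra. }
    assert (touch : q1 i = q1 (S i)) by (unfold q1, flow; lra).
    assert (vi : v1 i = v (S i)).
    { unfold v1. rewrite coll_l. unfold cA. rewrite !hm by lia. field. }
    assert (vSi : v1 (S i) = v i).
    { unfold v1. rewrite coll_r. unfold cB. rewrite !hm by lia. field. }
    assert (vo : forall j, j <> i -> j <> S i -> v1 j = v j).
    { intros j g1 g2. apply coll_out; auto. }
    (* The collision lets particles [i] and [S i] exchange their lines. Relabelled by this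
       transposition, the lines are the original ones from time [t] on, so the hypotheses on lines
       are inherited. *)
    set (sg := fun j => if Nat.eqb j i then S i else if Nat.eqb j (S i) then i else j).
    assert (sgr : forall j, (a <= j)%nat -> (j < b)%nat -> (a <= sg j)%nat /\ (sg j < b)%nat).
    { intros j g1 g2. unfold sg. destruct (Nat.eqb_spec j i); [lia|]. destruct (Nat.eqb_spec j (S i)); lia. }
    assert (sgi : forall j l, j <> l -> sg j <> sg l).
    { intros j l hn. unfold sg.
      destruct (Nat.eqb_spec j i), (Nat.eqb_spec l i), (Nat.eqb_spec j (S i)), (Nat.eqb_spec l (S i)); lia. }
    assert (sgv : forall j, v1 j = v (sg j)).
    { intros j. unfold sg. destruct (Nat.eqb_spec j i) as [->|]; [exact vi|].
      destruct (Nat.eqb_spec j (S i)) as [->|]; [exact vSi|auto]. }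
    assert (sgf : forall s j, flow q1 v1 s j = flow q v (t + s) (sg j)).
    { intros s j. unfold flow at 1. rewrite sgv.
      replace (q1 j) with (q1 (sg j)).
      - unfold q1, flow. ring.
      - unfold sg. destruct (Nat.eqb_spec j i) as [->|]; [auto|].
        destruct (Nat.eqb_spec j (S i)) as [->|]; auto. }
    assert (nt : forall j, (a <= j)%nat -> (S (S j) < b)%nat -> q1 j < q1 (S (S j))).
    { intros j g1 g2. pose proof (w1 j g1 ltac:(lia)). pose proof (w1 (S j) ltac:(lia) g2).
      destruct (Rlt_dec (q1 j) (q1 (S (S j)))) as [h|h]; [exact h|]. exfalso.
      apply (h3 t j (S j) (S (S j))); try lia; try exact ht; fold q1; lra. }
    assert (hperm : Permutation (vals v1 a b) (vals v a b)).
    { rewrite !(vals_split _ a b i hi1 hi2), vi, vSi.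
      assert (m1 : map v1 (seq a (i - a)) = map v (seq a (i - a))).
      { apply map_ext_in. intros j hj. apply in_seq in hj. apply vo; lia. }
      assert (m2 : map v1 (seq (S (S i)) (b - S (S i))) = map v (seq (S (S i)) (b - S (S i)))).
      { apply map_ext_in. intros j hj. apply in_seq in hj. apply vo; lia. }
      rewrite m1, m2. apply Permutation_app_head. apply perm_swap. }
    assert (hN' : N = S (inversions (vals v1 a b))).
    { rewrite <- hN, !(vals_split _ a b i hi1 hi2), vi, vSi.
      assert (m1 : map v1 (seq a (i - a)) = map v (seq a (i - a))).
      { apply map_ext_in. intros j hj. apply in_seq in hj. apply vo; lia. }
      assert (m2 : map v1 (seq (S (S i)) (b - S (S i))) = map v (seq (S (S i)) (b - S (S i)))).
      { apply map_ext_in. intros j hj. apply in_seq in hj. apply vo; lia. }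
      rewrite m1, m2. apply inversions_swap. exact hi3. }
    destruct (IH (inversions (vals v1 a b)) ltac:(lia) q1 v1 eq_refl w1) as (B & T & q' & v' & x1 & x2 & x3 & x4).
    { intros j l g1 g2 g3 g4 hn. rewrite !sgv. destruct (sgr j g1 g2). destruct (sgr l g3 g4).
      apply hinj; auto. }
    { intros s j l p hs g1 g2 g3 g4 g5 g6 n1 n2 n3. rewrite !sgf.
      destruct (sgr j g1 g2). destruct (sgr l g3 g4). destruct (sgr p g5 g6).
      apply h3; auto. lra. }
    destruct (bounded_range q b) as (B1 & hB1 & b1).
    exists (Rmax B1 B), (t + T), q', v'. split; [|split; [|split]]; auto.
    + apply (ss_mono a b m B (Rmax B1 B)) in x1; [|apply Rmax_r].
      apply ss_flow; auto.
      * intros s hs j g1 g2. apply gap; auto; lra.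
      * intros j g1 g2. specialize (b1 j g2). pose proof (Rmax_l B1 B). lra.
      * rewrite hN'. fold q1. apply (ss_coll a b m _ q1 v i); auto.
        -- intros j g1 g2. pose proof (nt j g1 ltac:(lia)). rewrite g2, <- touch in H. exact H.
        -- intros g. pose proof (nt i hi1 g). lra.
        -- apply (ss_bounded_start _ _ _ _ _ _ _ _ _ _ x1).
    + eapply Permutation_trans; eauto.
Qed.

(* If q_i v_i = c for all i, the lines i and j meet at time c / (v_i v_j). *)
Lemma no_triple_hyperbola (a b : nat) (q v : nat -> R) (c : R) :
  0 < c -> (forall i, (a <= i)%nat -> (i < b)%nat -> q i * v i = c) -> injective_on a b v ->
  no_triple_point a b q v.
Proof.
  intros hc hqv hinj s i j l hs i1 i2 j1 j2 l1 l2 n1 n2 n3 e1 e2.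
  pose proof (hqv i i1 i2) as qi. pose proof (hqv j j1 j2) as qj. pose proof (hqv l l1 l2) as ql.
  pose proof (hinj i j i1 i2 j1 j2 n1) as dij. pose proof (hinj j l j1 j2 l1 l2 n2) as djl.
  pose proof (hinj i l i1 i2 l1 l2 n3) as dil.
  unfold flow in *.
  assert (f1 : (v i - v j) * (s * (v i * v j) - c) = 0).
  { replace ((v i - v j) * (s * (v i * v j) - c)) with
      (v i * v j * ((q i + s * v i) - (q j + s * v j)) - (q i * v i - c) * v j + (q j * v j - c) * v i) by ring.
    rewrite e1, qi, qj. ring. }
  assert (f2 : (v j - v l) * (s * (v j * v l) - c) = 0).
  { replace ((v j - v l) * (s * (v j * v l) - c)) with
      (v j * v l * ((q j + s * v j) - (q l + s * v l)) - (q j * v j - c) * v l + (q l * v l - c) * v j) by ring.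
    rewrite e2, qj, ql. ring. }
  apply Rmult_integral in f1. apply Rmult_integral in f2.
  destruct f1 as [f1|f1]; [lra|]. destruct f2 as [f2|f2]; [lra|].
  assert (f3 : (s * v j) * (v i - v l) = 0) by lra.
  apply Rmult_integral in f3. destruct f3 as [f3|f3]; [|lra].
  assert (s * (v i * v j) = 0) by (replace (s * (v i * v j)) with (s * v j * v i) by ring; rewrite f3; ring).
  lra.
Qed.

(** The lines [a] to [b - 1] diverge and never meet, while any three lines contain two of them. *)
Lemma no_triple_fan (a b : nat) (q v : nat -> R) :
  strict_on a b q -> strict_on a b v -> no_triple_point a (S b) q v.
Proof.
  intros hq hv s i j l hs i1 i2 j1 j2 l1 l2 n1 n2 n3 e1 e2.
  assert (G : forall x y, (a <= x)%nat -> (x < b)%nat -> (a <= y)%nat -> (y < b)%nat -> x <> y ->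
     flow q v s x <> flow q v s y).
  { assert (G' : forall x y, (a <= x)%nat -> (x < y)%nat -> (y < b)%nat -> flow q v s x < flow q v s y).
    { intros x y h1 h2 h3. pose proof (strict_on_lt a b q hq x y h1 h2 h3).
      pose proof (strict_on_lt a b v hv x y h1 h2 h3). unfold flow. nra. }
    intros x y h1 h2 h3 h4 hn. destruct (Compare_dec.lt_dec x y) as [h|h].
    - specialize (G' x y h1 h h4). lra.
    - specialize (G' y x h3 ltac:(lia) h2). lra. }
  destruct (Nat.eq_dec i b) as [->|hi].
  - apply (G j l); auto; lia.
  - destruct (Nat.eq_dec j b) as [->|hj].
    + apply (G i l); auto; try lia. congruence.
    + apply (G i j); auto; lia.
Qed.

Lemma injective_of_strict (a b : nat) (v : nat -> R) : strict_on a b v -> injective_on a b v.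
Proof.
  intros h i j i1 i2 j1 j2 hn. pose proof (strict_on_lt a b v h) as l.
  destruct (Compare_dec.lt_dec i j) as [hl|hl].
  - specialize (l i j i1 hl j2). lra.
  - specialize (l j i j1 ltac:(lia) i2). lra.
Qed.

Lemma injective_of_decreasing (a b : nat) (v : nat -> R) :
  strict_on a b (fun i => - v i) -> injective_on a b v.
Proof.
  intros h i j i1 i2 j1 j2 hn e. apply (injective_of_strict a b _ h i j); auto. rewrite e. reflexivity.
Qed.

Lemma injective_snoc (a b : nat) (v : nat -> R) :
  injective_on a b v -> (forall i, (a <= i)%nat -> (i < b)%nat -> v b < v i) -> injective_on a (S b) v.
Proof.
  intros h hb i j i1 i2 j1 j2 hn.
  destruct (Nat.eq_dec i b) as [->|hi].
  - specialize (hb j j1 ltac:(lia)). lra.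
  - destruct (Nat.eq_dec j b) as [->|hj].
    + specialize (hb i i1 ltac:(lia)). lra.
    + apply h; lia.
Qed.

Lemma inversions_fan (a b : nat) (v : nat -> R) :
  (a <= b)%nat -> strict_on a b v -> (forall i, (a <= i)%nat -> (i < b)%nat -> v b < v i) ->
  inversions (vals v a (S b)) = (b - a)%nat.
Proof.
  intros hab hv hb. rewrite vals_snoc, inversions_snoc, inversions_increasing; auto.
  - unfold vals. rewrite length_map, length_seq. reflexivity.
  - unfold vals. intros x hx. apply in_map_iff in hx. destruct hx as (j & <- & hj).
    apply in_seq in hj. apply hb; lia.
Qed.

Lemma ss_fan (a b : nat) (m q v : nat -> R) :
  (a <= b)%nat -> (forall i, (a <= i)%nat -> (i < S b)%nat -> m i = 1) ->
  strict_on a (S b) q -> strict_on a b v -> (forall i, (a <= i)%nat -> (i < b)%nat -> v b < v i) ->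
  exists B T q' v', ss a (S b) m B q v T (b - a) q' v' /\ strict_on a (S b) q' /\
    strict_on a (S b) v' /\ Permutation (vals v' a (S b)) (vals v a (S b)).
Proof.
  intros hab hm hq hv hb. apply ss_equal_masses; auto.
  - apply inversions_fan; auto.
  - intros i h1 h2. left. apply hq; auto.
  - apply injective_snoc; auto. apply injective_of_strict; auto.
  - apply no_triple_fan; auto. intros i h1 h2. apply hq; lia.
Qed.

(** The condition on [q i * v i] describes the lines at time 0, while the motion may start at a
    later time [h]. In the kicked array this delay gives the pulse particle time to escape. *)
Lemma ss_reversal (a b : nat) (m q v : nat -> R) (c h : R) :
  (forall i, (a <= i)%nat -> (i < b)%nat -> m i = 1) ->
  strict_on a b (flow q v h) -> strict_on a b (fun i => - v i) -> 0 <= h -> 0 < c ->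
  (forall i, (a <= i)%nat -> (i < b)%nat -> q i * v i = c) ->
  exists B T q' v', ss a b m B (flow q v h) v T (binom (b - a) 2) q' v' /\ strict_on a b q' /\
    strict_on a b v' /\ Permutation (vals v' a b) (vals v a b).
Proof.
  intros hm hq hv hh hc hqv.
  pose proof (injective_of_decreasing a b v hv) as hinj.
  apply ss_equal_masses; auto.
  - apply inversions_decreasing; auto.
  - intros i h1 h2. left. apply hq; auto.
  - intros s i j l hs. rewrite flow_add.
    apply (no_triple_hyperbola a b q v c hc hqv hinj). lra.
Qed.

(** * A fast particle crossing an array at rest *)

(* Particle j carries the pulse; the particles below it are still at rest and
   the ones above it have been kicked to the velocities ws. *)
Lemma ss_pulse (k : nat) (m x Vs ws : nat -> R) (M Vm : R) :
  pos_on 0 (S k) m -> 0 <= M < Vm ->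
  (forall j, (j < k)%nat -> Vs j = 2 * m (S j) * Vs (S j) / (m j + m (S j))) ->
  (forall j, (j < k)%nat -> ws (S j) = - ((m (S j) - m j) * Vs (S j) / (m j + m (S j)))) ->
  (forall j, (j <= k)%nat -> Vm <= Vs j) ->
  (forall j, (j < k)%nat -> Rabs (ws (S j)) <= M) ->
  strict_on 0 k x ->
  (forall i, (S i < k)%nat -> x i + 2 * (M * ((x (S i) - x O) / Vm)) < x (S i)) ->
  forall j q v, (j <= k)%nat ->
  (forall i, (i < j)%nat -> q i = x i /\ v i = 0) -> v j = - Vs j ->
  (j = O -> q O = x O) -> (forall i, S i = j -> x i < q j) ->
  (forall l, (j < l)%nat -> (S l <= k)%nat -> q l + 2 * (M * ((q j - x O) / Vm)) < q (S l)) ->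
  ((S j <= k)%nat -> q j <= q (S j) /\
     forall i, S i = j -> x i + 2 * (M * ((q j - x O) / Vm)) < q (S j)) ->
  (forall l, (j < l)%nat -> (l <= k)%nat -> Rabs (v l) <= M) ->
  exists B T q' v', ss 0 (S k) m B q v T j q' v' /\ v' O = - Vs O /\ q' O = x O /\
    (forall i, (i < j)%nat -> v' (S i) = ws (S i) /\ Rabs (q' (S i) - x i) <= M * ((x i - x O) / Vm)) /\
    (forall i, (j < i)%nat -> (i <= k)%nat -> v' i = v i /\ Rabs (q' i - q i) <= M * ((q j - x O) / Vm)).
Proof.
  intros hm hM hV hw hVm hwM hx hgap.
  induction j as [|j IH]; intros q v hjk hst hvj hq0 hxq hup hnext hvM.
  - destruct (bounded_range q (S k)) as (B & hB & bB).
    exists B, 0, q, v. split; [|split; [|split; [|split]]].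
    + apply ss_nil. intros i _ h. auto.
    + exact hvj.
    + auto.
    + intros i h. lia.
    + intros i h1 h2. split; [reflexivity|]. rewrite (hq0 eq_refl). unfold Rdiv, Rminus.
      rewrite !Rplus_opp_r, Rabs_R0. lra.
  - pose proof (hxq j eq_refl) as hxj.
    pose proof (hVm (S j) hjk) as hVj.
    set (V := Vs (S j)) in *. set (t := (q (S j) - x j) / V).
    assert (htV : t * V = q (S j) - x j) by (unfold t; field; lra).
    assert (ht : 0 < t) by (apply Rdiv_lt_0_compat; lra).
    assert (hx0 : forall i, (i < k)%nat -> x O <= x i).
    { intros i hi. destruct i as [|i]; [lra|]. left. apply (strict_on_lt 0 k x hx); lia. }
    (* [tau1] and [tau2] bound the time that the pulse needs to come down to [x O] from its present
       place and from [x j]. A kicked particle moves in this time by at most [M] times the bound,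
       two neighbours approach by at most twice that. *)
    set (tau1 := (q (S j) - x O) / Vm) in *. set (tau2 := (x j - x O) / Vm).
    assert (h12 : t + tau2 <= tau1).
    { assert (t <= (q (S j) - x j) / Vm).
      { unfold t, Rdiv. apply Rmult_le_compat_l; [lra|]. apply Rinv_le_contravar; lra. }
      assert (tau1 = (q (S j) - x j) / Vm + tau2) by (unfold tau1, tau2; field; lra). lra. }
    assert (h2 : 0 <= tau2).
    { unfold tau2. apply Rmult_le_pos; [pose proof (hx0 j ltac:(lia)); lra|].
      left. apply Rinv_0_lt_compat. lra. }
    assert (hMt : M * t + M * tau2 <= M * tau1) by nra.
    assert (hMt2 : 0 <= M * tau2) by nra. assert (hMt0 : 0 <= M * t) by nra.
    set (q1 := flow q v t). set (v1 := coll m v j).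
    destruct (hst j ltac:(lia)) as [qj vj].
    pose proof (hm j ltac:(lia) ltac:(lia)) as mj. pose proof (hm (S j) ltac:(lia) ltac:(lia)) as mSj.
    assert (v1j : v1 j = - Vs j).
    { unfold v1. rewrite coll_l. unfold cA. rewrite vj, hvj, (hV j) by lia. fold V. field. lra. }
    assert (v1Sj : v1 (S j) = ws (S j)).
    { unfold v1. rewrite coll_r. unfold cB. rewrite vj, hvj, (hw j) by lia. fold V. field. lra. }
    assert (v1o : forall i, i <> j -> i <> S j -> v1 i = v i) by (intros; apply coll_out; auto).
    assert (q1lo : forall i, (i <= j)%nat -> q1 i = x i).
    { intros i hi. destruct (hst i ltac:(lia)) as [e1 e2]. unfold q1, flow. rewrite e1, e2. ring. }
    (* The particle handing on the pulse is left at the place of the one it hits: the crossing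
       shifts the labels of the array by one. *)
    assert (q1S : q1 (S j) = x j) by (unfold q1, flow; rewrite hvj; lra).
    assert (bd : forall l s, (S j < l)%nat -> (l <= k)%nat -> 0 <= s -> - (M * s) <= s * v l <= M * s).
    { intros l s h1 h3 hs. pose proof (Rabs_mult_le s (v l) M hs (hvM l h1 h3)). lra. }
    assert (st : forall s i, 0 < s <= t -> (S i < S k)%nat -> (i <> j \/ s < t) ->
                   flow q v s i < flow q v s (S i)).
    { intros s i hs hi hd. unfold flow. destruct (Compare_dec.lt_eq_lt_dec i j) as [[h|h]|h].
      - destruct (hst i ltac:(lia)) as [e1 e2]. destruct (hst (S i) ltac:(lia)) as [e3 e4].
        rewrite e1, e2, e3, e4. pose proof (hx i ltac:(lia) ltac:(lia)). lra.
      - subst i. destruct hd as [hd|hd]; [congruence|].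
        rewrite qj, vj, hvj. assert (s * V < t * V) by (apply Rmult_lt_compat_r; lra). lra.
      - destruct (Nat.eq_dec i (S j)) as [->|hn].
        + destruct (hnext ltac:(lia)) as [n1 _]. pose proof (bd (S (S j)) s ltac:(lia) ltac:(lia) ltac:(lra)).
          rewrite hvj. assert (M * s < s * V) by nra. lra.
        + pose proof (hup i ltac:(lia) ltac:(lia)). pose proof (bd i s ltac:(lia) ltac:(lia) ltac:(lra)).
          pose proof (bd (S i) s ltac:(lia) ltac:(lia) ltac:(lra)).
          assert (M * s <= M * t) by nra. lra. }
    assert (hgj : forall i, S i = j -> x i + 2 * (M * tau2) < x j).
    { intros i <-. apply hgap. lia. }
    destruct (IH q1 v1 ltac:(lia)) as (B & T & q' & v' & r1 & r2 & r3 & r4 & r5).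
    { intros i hi. split; [apply q1lo; lia|]. rewrite v1o by lia. apply hst. lia. }
    { exact v1j. }
    { intros ->. apply q1lo. lia. }
    { intros i e. rewrite q1lo by lia. rewrite <- e. apply hx; lia. }
    { intros l h1 h3. rewrite (q1lo j) by lia. fold tau2.
      destruct (Nat.eq_dec l (S j)) as [->|hn].
      - rewrite q1S. destruct (hnext h3) as [_ n2]. specialize (n2 j eq_refl).
        pose proof (bd (S (S j)) t ltac:(lia) ltac:(lia) ltac:(lra)). unfold q1, flow. lra.
      - pose proof (hup l ltac:(lia) h3). pose proof (bd l t ltac:(lia) ltac:(lia) ltac:(lra)).
        pose proof (bd (S l) t ltac:(lia) ltac:(lia) ltac:(lra)). unfold q1, flow. lra. }
    { intros _. rewrite (q1lo j), q1S by lia. split; [lra|]. fold tau2. exact hgj. }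
    { intros l h1 h3. destruct (Nat.eq_dec l (S j)) as [->|hn].
      - rewrite v1Sj. apply hwM. lia.
      - rewrite v1o by lia. apply hvM; lia. }
    rewrite (q1lo j) in r5 by lia. fold tau2 in r5.
    destruct (bounded_range q (S k)) as (B1 & hB1 & b1).
    exists (Rmax B1 B), (t + T), q', v'. split; [|split; [|split; [|split]]]; auto.
    + apply (ss_mono _ _ _ _ (Rmax B1 B)) in r1; [|apply Rmax_r].
      pose proof (ss_bounded_start _ _ _ _ _ _ _ _ _ _ r1) as bs.
      apply ss_flow.
      * lra.
      * intros s hs i _ hi. apply st; [lra|lia|right; lra].
      * intros i _ hi. fold q1.
        assert (w : forall l, (S l < S k)%nat -> l <> j -> q1 l < q1 (S l)).
        { intros l hl hn. apply st; [lra|exact hl|left; exact hn]. }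
        destruct (Nat.eq_dec i j) as [->|hn].
        -- pose proof (w (S j) ltac:(lia) ltac:(lia)). rewrite q1S in H. rewrite (q1lo j) by lia. exact H.
        -- pose proof (w i ltac:(lia) hn). destruct (Nat.eq_dec (S i) j) as [e|hn2].
           ++ rewrite e in *. rewrite q1S. rewrite (q1lo j) in H by lia. exact H.
           ++ pose proof (w (S i) ltac:(lia) hn2). lra.
      * intros i _ hi. specialize (b1 i hi). pose proof (Rmax_l B1 B). lra.
      * apply (ss_coll 0 (S k) m _ q1 v j); auto; try lia.
        -- rewrite q1S. apply q1lo. lia.
        -- rewrite hvj, vj. lra.
        -- intros i _ e. rewrite !q1lo by lia. rewrite <- e. apply hx; lia.
        -- intros hl. apply st; [lra|lia|left; lia].
    + intros i hi. destruct (Nat.eq_dec i j) as [->|hn].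
      * destruct (r5 (S j) ltac:(lia) hjk) as [e1 e2]. rewrite q1S in e2. rewrite e1, v1Sj. auto.
      * apply r4. lia.
    + intros i h1 h3. destruct (r5 i ltac:(lia) h3) as [e1 e2]. rewrite v1o in e1 by lia.
      split; [exact e1|].
      replace (q' i - q i) with ((q' i - q1 i) + t * v i) by (unfold q1, flow; ring).
      pose proof (Rabs_triang (q' i - q1 i) (t * v i)).
      pose proof (bd i t h1 h3 ltac:(lra)).
      assert (Rabs (t * v i) <= M * t) by (apply Rabs_le; lra). lra.
Qed.

(** * Adding one particle *)

Definition mass (d rho : R) (i : nat) : R := 1 + d * rho ^ i.
(* Limits for d -> 0, up to scale, of the positions of the array before the pulse
   and of the opposites of the velocities to which it is kicked. *)
Definition pp (rho : R) (i : nat) : R := (1 - rho) * (/ rho) ^ i.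
Definition gam (rho : R) (i : nat) : R := (rho - 1) * rho ^ i / 2.

(** The increment contains the factor (1 - rho)^2, so the sign is right on both sides of [rho] = 1;
    both are needed, since [rho] and [/ rho] alternate. *)
Lemma pp_increasing (rho : R) (i : nat) : 0 < rho -> rho <> 1 -> pp rho i < pp rho (S i).
Proof.
  intros h0 h1. unfold pp. simpl.
  assert (hp : 0 < (/ rho) ^ i) by (apply pow_lt; apply Rinv_0_lt_compat; exact h0).
  assert (e : (1 - rho) * (/ rho * (/ rho) ^ i) - (1 - rho) * (/ rho) ^ i =
     (1 - rho) * (1 - rho) * (/ rho) * (/ rho) ^ i) by (field; lra).
  assert (0 < (1 - rho) * (1 - rho)) by nra.
  assert (0 < (1 - rho) * (1 - rho) * (/ rho) * (/ rho) ^ i).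
  { apply Rmult_lt_0_compat; [|exact hp]. apply Rmult_lt_0_compat; [assumption|].
    apply Rinv_0_lt_compat. exact h0. }
  lra.
Qed.

Lemma gam_increasing (rho : R) (i j : nat) :
  0 < rho -> rho <> 1 -> (i < j)%nat -> gam rho i < gam rho j.
Proof.
  intros h0 h1 h. apply (strict_on_lt 0 (S j) (gam rho)); try lia.
  intros l _ _. unfold gam. simpl.
  assert (0 < rho ^ l) by (apply pow_lt; exact h0).
  assert (0 < (rho - 1) * (rho - 1) * rho ^ l).
  { apply Rmult_lt_0_compat; [|assumption]. nra. }
  lra.
Qed.

Lemma strict_on_open (a b : nat) (f : nat -> R) :
  strict_on a b f -> exists e, 0 < e /\ forall g, close_on a b e g f -> strict_on a b g.
Proof.
  intros hf.
  assert (A : at_right 0 (fun e => forall i, (a <= i)%nat -> (i < b)%nat -> (S i < b)%nat ->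
      0 < e < (f (S i) - f i) / 2)).
  { apply filter_forall_range; [apply filter_filter|]. intros i h1 h2.
    destruct (Compare_dec.lt_dec (S i) b) as [h3|h3].
    - generalize (at_right_lt ((f (S i) - f i) / 2)). intros G. specialize (hf i h1 h3).
      specialize (G ltac:(lra)). revert G. apply filter_imp. auto.
    - apply filter_forall. intros x g. contradiction. }
  apply at_right_ex in A. destruct A as (e & he & H).
  exists (e / 2). split; [lra|]. intros g hg i h1 h2.
  specialize (H (e / 2) ltac:(lra) i h1 ltac:(lia) h2).
  pose proof (hg i h1 ltac:(lia)) as g1. pose proof (hg (S i) ltac:(lia) h2) as g2.
  apply Rabs_def2 in g1. apply Rabs_def2 in g2. lra.
Qed.

Lemma Permutation_vals_rev (f g : nat -> R) (a b : nat) :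
  (forall i, (a <= i)%nat -> (i < b)%nat -> g i = f (a + b - 1 - i)%nat) ->
  Permutation (vals g a b) (vals f a b).
Proof.
  intros h. unfold vals.
  remember (b - a)%nat as len eqn:e. revert g b e h.
  induction len as [|len IH]; intros g b e h.
  { apply Permutation_refl. }
  rewrite seq_S at 2. rewrite map_app. simpl.
  assert (e1 : g a = f (a + len)%nat) by (rewrite h by lia; f_equal; lia).
  rewrite e1. eapply Permutation_trans; [|apply Permutation_cons_append].
  apply perm_skip. rewrite <- seq_shift, map_map. apply (IH (fun x => g (S x)) (b - 1)%nat); [lia|].
  intros i h1 h2. rewrite h by lia. f_equal. lia.
Qed.

(** The equal-mass limit of the kicked group, particles 1 to K; particle [i] stands at the place of
    index [pred i] because the pulse shifts labels. The products [P i * G i] all equal (1 - rho)^2 /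
    2, hence no triple points. The delay [h] is any positive time for which the order still
    holds. *)
Lemma group_limit (K : nat) (rho : R) :
  0 < rho -> rho <> 1 ->
  let P := fun i => pp rho (pred i) in
  let G := fun i => - gam rho (pred i) in
  exists h B T qs vs, 0 < h /\ 0 < B /\ strict_on 1 (S K) P /\ strict_on 1 (S K) (flow P G h) /\
    ss 1 (S K) (fun _ => 1) B (flow P G h) G T (binom K 2) qs vs /\
    strict_on 1 (S K) qs /\ strict_on 1 (S K) vs /\
    forall i, (1 <= i)%nat -> (i < S K)%nat -> vs i = - gam rho (K - i).
Proof.
  intros h0 h1 P G.
  assert (hP : strict_on 1 (S K) P).
  { intros i i1 i2. destruct i as [|i]; [lia|]. unfold P. simpl. apply pp_increasing; auto. }
  assert (hG : strict_on 1 (S K) (fun i => - G i)).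
  { intros i i1 i2. unfold G. destruct i as [|i]; [lia|]. simpl.
    pose proof (gam_increasing rho i (S i) h0 h1 ltac:(lia)). lra. }
  assert (A : at_right 0 (fun h => forall i, (1 <= i)%nat -> (i < S K)%nat -> (S i < S K)%nat ->
      flow P G h i < flow P G h (S i))).
  { apply filter_forall_range; [apply filter_filter|]. intros i i1 i2.
    destruct (Compare_dec.lt_dec (S i) (S K)) as [h3|h3].
    2:{ apply filter_forall. intros x g. contradiction. }
    assert (A : at_right 0 (fun h => flow P G h i < flow P G h (S i))).
    { apply (lim_lt _ _ _ (P i) (P (S i))); [apply hP; auto| |]; apply lim_flow_0. }
    revert A. apply filter_imp. auto. }
  apply at_right_ex in A. destruct A as (e & he & A). specialize (A (e / 2) ltac:(lra)).
  assert (hs : strict_on 1 (S K) (flow P G (e / 2))).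
  { intros i i1 i2. apply A; auto; lia. }
  destruct (ss_reversal 1 (S K) (fun _ => 1) P G ((1 - rho) * (1 - rho) / 2) (e / 2))
    as (B & T & qs & vs & r1 & r2 & r3 & r4); auto; try lra.
  { assert (0 < (1 - rho) * (1 - rho)) by nra. lra. }
  { intros i i1 i2. unfold P, G, pp, gam. rewrite pow_inv. field. apply pow_nonzero. lra. }
  replace (S K - 1)%nat with K in r1 by lia.
  exists (e / 2), (Rmax 1 B), T, qs, vs. repeat split; auto; try lra.
  - pose proof (Rmax_l 1 B). lra.
  - apply (ss_mono 1 (S K) _ B); [apply Rmax_r|exact r1].
  - intros i i1 i2. apply (sorted_vals_unique vs (fun i => - gam rho (K - i)) 1 (S K)); auto.
    + intros j j1 j2. pose proof (gam_increasing rho (K - S j) (K - j) h0 h1 ltac:(lia)). lra.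
    + eapply Permutation_trans; [exact r4|]. apply Permutation_sym.
      apply Permutation_vals_rev. intros j j1 j2. unfold G. do 2 f_equal. lia.
Qed.

(** The equal-mass limit at scale 1/d, in coordinates multiplied by d: the reversed group has shrunk
    to the origin, and particle K+1 starts at [C]. The K+1 kick velocities come out sorted. *)
Lemma fan_limit (K : nat) (rho C : R) :
  (1 <= K)%nat -> 0 < rho -> rho <> 1 -> 0 < C ->
  let V := fun i => if Nat.leb i K then - gam rho (K - i) else - gam rho K in
  exists s0 B T qs vs, let Q := fun i => if Nat.leb i K then s0 * V i else C + s0 * V i in
    0 < s0 /\ 0 < B /\ strict_on 1 (S (S K)) Q /\
    ss 1 (S (S K)) (fun _ => 1) B Q V T K qs vs /\
    strict_on 1 (S (S K)) qs /\ strict_on 1 (S (S K)) vs /\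
    forall i, (1 <= i)%nat -> (i < S (S K))%nat -> vs i = - gam rho (S K - i).
Proof.
  intros hK h0 h1 hC V.
  pose proof (gam_increasing rho 0 K h0 h1 ltac:(lia)) as hg.
  (* Half the time at which particle K+1 meets particle K, the first of its encounters. At time 0
     the lines of the fan still coincide, so the comparison has to start later. *)
  set (s0 := C / (2 * (gam rho K - gam rho 0))).
  assert (hs0 : 0 < s0) by (apply Rdiv_lt_0_compat; lra).
  assert (es0 : s0 * (gam rho K - gam rho 0) = C / 2) by (unfold s0; field; lra).
  set (Q := fun i => if Nat.leb i K then s0 * V i else C + s0 * V i).
  assert (hV : strict_on 1 (S K) V).
  { intros i i1 i2. unfold V. destruct (Nat.leb_spec i K); [|lia]. destruct (Nat.leb_spec (S i) K); [|lia].
    pose proof (gam_increasing rho (K - S i) (K - i) h0 h1 ltac:(lia)). lra. }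
  assert (VS : V (S K) = - gam rho K).
  { unfold V. destruct (Nat.leb_spec (S K) K); [lia|reflexivity]. }
  assert (Vlo : forall i, (i <= K)%nat -> V i = - gam rho (K - i)).
  { intros i hi. unfold V. destruct (Nat.leb_spec i K); [reflexivity|lia]. }
  assert (hQ : strict_on 1 (S (S K)) Q).
  { intros i i1 i2. unfold Q. destruct (Nat.leb_spec i K); [|lia].
    destruct (Nat.leb_spec (S i) K) as [h|h].
    - apply Rmult_lt_compat_l; [exact hs0|]. apply hV; lia.
    - assert (i = K) by lia. subst i. rewrite VS, Vlo, Nat.sub_diag by lia. nra. }
  destruct (ss_fan 1 (S K) (fun _ => 1) Q V) as (B & T & qs & vs & r1 & r2 & r3 & r4); auto; try lia.
  { intros i i1 i2. rewrite VS, Vlo by lia.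
    pose proof (gam_increasing rho (K - i) K h0 h1 ltac:(lia)). lra. }
  replace (S K - 1)%nat with K in r1 by lia.
  exists s0, (Rmax 1 B), T, qs, vs. fold Q. repeat split; auto.
  - pose proof (Rmax_l 1 B). lra.
  - apply (ss_mono 1 (S (S K)) _ B); [apply Rmax_r|exact r1].
  - intros i i1 i2. apply (sorted_vals_unique vs (fun i => - gam rho (S K - i)) 1 (S (S K))); auto.
    + intros j j1 j2. pose proof (gam_increasing rho (S K - S j) (S K - j) h0 h1 ltac:(lia)). lra.
    + eapply Permutation_trans; [exact r4|]. rewrite vals_snoc, VS by lia.
      apply Permutation_sym. eapply Permutation_trans; [|apply Permutation_cons_append].
      unfold vals. replace (S (S K) - 1)%nat with (S (S K - 1)) by lia. cbn [seq map].
      replace (S K - 1)%nat with K by lia. apply perm_skip.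
      rewrite <- seq_shift, map_map.
      replace (map (fun x => - gam rho (S K - S x)) (seq 1 K)) with (map V (seq 1 K)).
      * apply Permutation_refl.
      * apply map_ext_in. intros j hj. apply in_seq in hj. rewrite Vlo by lia. reflexivity.
Qed.

(** * Asymptotics of the pulse and of the kicks for small d *)

Fixpoint pulse_factor (d rho : R) (k r : nat) : R :=
  match r with
  | O => 1
  | S r' => pulse_factor d rho k r' *
      (2 * mass d rho (k - r') / (mass d rho (k - S r') + mass d rho (k - r')))
  end.

(* The pulse carried by particle j, started at particle k with velocity -1/d, has
   velocity - pa/d; it leaves particle j with velocity pw. *)
Definition pa (d rho : R) (k j : nat) : R := pulse_factor d rho k (k - j).
Definition pw (d rho : R) (k j : nat) : R :=
  - ((rho ^ j - rho ^ pred j) * pa d rho k j / (mass d rho (pred j) + mass d rho j)).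

Lemma pa_step (d rho : R) (k j : nat) : (j < k)%nat ->
  pa d rho k j = pa d rho k (S j) * (2 * mass d rho (S j) / (mass d rho j + mass d rho (S j))).
Proof.
  intros h. unfold pa. replace (k - j)%nat with (S (k - S j)) by lia.
  cbn [pulse_factor]. replace (k - (k - S j))%nat with (S j) by lia.
  replace (k - S (k - S j))%nat with j by lia. reflexivity.
Qed.

Section Adding.
Context (K : nat) (rho C : R).

(** The filter for d tending to 0 from the right while the array tends to its prescribed places. The
    last particle runs off to infinity, so it is controlled through the product [d * x K]. *)
Definition stage_nbhd (P : R * (nat -> R) -> Prop) : Prop :=
  exists r, 0 < r /\ forall d x, 0 < d < r ->
    (forall i, (i < K)%nat -> Rabs (x i - pp rho i) < r) -> Rabs (d * x K - C) < r -> P (d, x).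

#[global] Instance stage_nbhd_filter : Filter stage_nbhd.
Proof.
  split.
  - exists 1. split; [lra|auto].
  - intros P Q (r1 & h1 & H1) (r2 & h2 & H2). exists (Rmin r1 r2).
    split; [apply Rmin_pos; auto|]. pose proof (Rmin_l r1 r2). pose proof (Rmin_r r1 r2).
    intros d x g1 g2 g3. split.
    + apply H1; [lra| |lra]. intros i hi. specialize (g2 i hi). lra.
    + apply H2; [lra| |lra]. intros i hi. specialize (g2 i hi). lra.
  - intros P Q hPQ (r & hr & H). exists r. split; [exact hr|]. intros. apply hPQ. auto.
Qed.

Notation N := stage_nbhd.

Lemma stage_pos : N (fun u => 0 < fst u).
Proof. exists 1. split; [lra|]. intros d x hd _ _. simpl. lra. Qed.

Lemma tends_d : tends N (fun u => fst u) 0.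
Proof.
  apply lim_eps; [apply stage_nbhd_filter|]. intros e he. exists e. split; [exact he|].
  intros d x hd _ _. simpl. apply Rabs_def1; lra.
Qed.

Lemma tends_x (i : nat) : (i < K)%nat -> tends N (fun u => snd u i) (pp rho i).
Proof.
  intros hi. apply lim_eps; [apply stage_nbhd_filter|]. intros e he. exists e. split; [exact he|].
  intros d x hd hx _. apply hx. exact hi.
Qed.

Lemma tends_dxK : tends N (fun u => fst u * snd u K) C.
Proof.
  apply lim_eps; [apply stage_nbhd_filter|]. intros e he. exists e. split; [exact he|].
  intros d x hd _ hx. exact hx.
Qed.

Lemma tends_mass (i : nat) : tends N (fun u => mass (fst u) rho i) 1.
Proof.
  apply (lim_eq _ _ (1 + 0 * rho ^ i)); [ring|]. unfold mass.
  apply lim_plus; [apply stage_nbhd_filter|apply lim_const; apply stage_nbhd_filter|].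
  apply lim_mult; [apply stage_nbhd_filter|apply tends_d|apply lim_const; apply stage_nbhd_filter].
Qed.

Lemma tends_pa (k j : nat) : tends N (fun u => pa (fst u) rho k j) 1.
Proof.
  unfold pa. induction (k - j)%nat as [|r IH]; simpl.
  - apply lim_const. apply stage_nbhd_filter.
  - apply (lim_eq _ _ (1 * (2 * 1 / (1 + 1)))); [field|].
    apply lim_mult; [apply stage_nbhd_filter|exact IH|].
    apply lim_div; [apply stage_nbhd_filter|lra| |].
    + apply lim_mult; [apply stage_nbhd_filter|apply lim_const; apply stage_nbhd_filter|apply tends_mass].
    + apply lim_plus; [apply stage_nbhd_filter| |]; apply tends_mass.
Qed.

Lemma tends_pw (k j : nat) : tends N (fun u => pw (fst u) rho k (S j)) (- gam rho j).
Proof.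
  apply (lim_eq _ _ (- ((rho ^ S j - rho ^ j) * 1 / (1 + 1)))).
  { unfold gam. simpl. field. }
  unfold pw. simpl pred. apply lim_opp.
  apply lim_div; [apply stage_nbhd_filter|lra| |].
  - apply lim_mult; [apply stage_nbhd_filter|apply lim_const; apply stage_nbhd_filter|apply tends_pa].
  - apply lim_plus; [apply stage_nbhd_filter| |]; apply tends_mass.
Qed.

End Adding.

(** * The three phases after a new particle is sent in *)

Lemma ss_free (a b : nat) (m q v : nat -> R) (T : R) :
  0 < T -> (forall s, 0 < s <= T -> strict_on a b (flow q v s)) ->
  exists B, ss a b m B q v T 0 (flow q v T) v.
Proof.
  intros hT hs.
  destruct (bounded_range q b) as (B1 & h1 & b1).
  destruct (bounded_range (flow q v T) b) as (B2 & h2 & b2).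
  exists (B1 + B2). replace T with (T + 0) at 1 by ring. apply ss_flow.
  - lra.
  - intros s hst. apply hs. lra.
  - intros i i1 i2. pose proof (hs T ltac:(lra) i i1 ltac:(lia)).
    pose proof (hs T ltac:(lra) (S i) ltac:(lia) i2). lra.
  - intros i i1 i2. specialize (b1 i i2). lra.
  - apply ss_nil. intros i i1 i2. specialize (b2 i i2). lra.
Qed.

Lemma ss_extend_ex (a a' b b' : nat) (m : nat -> R) (B : R) q v T k q' v' :
  (a' <= a <= S a')%nat -> (b <= b' <= S b)%nat -> (a <= b)%nat -> 0 < B ->
  ss a b m B q v T k q' v' ->
  ((a' < a)%nat -> q a' <= - B /\ q a' + T * v a' <= - B) ->
  ((b < b')%nat -> B <= q b /\ B <= q b + T * v b) ->
  exists B', ss a' b' m B' q v T k q' v'.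
Proof.
  intros ha hb hab hB H hl hr.
  exists (B + 1 + Rabs (q a') + Rabs (q a' + T * v a') + Rabs (q b) + Rabs (q b + T * v b)).
  pose proof (Rabs_pos (q a')). pose proof (Rabs_pos (q a' + T * v a')).
  pose proof (Rabs_pos (q b)). pose proof (Rabs_pos (q b + T * v b)).
  pose proof (Rle_abs (- q a')) as e1. pose proof (Rle_abs (- (q a' + T * v a'))) as e2.
  rewrite Rabs_Ropp in e1, e2.
  pose proof (Rle_abs (q b)). pose proof (Rle_abs (q b + T * v b)).
  apply (ss_extend a a' b b' m B); auto; try lra.
  - intros h. destruct (hl h). lra.
  - intros h. destruct (hr h). lra.
Qed.

Definition ext (n : nat) (x : nat -> R) (y : R) (i : nat) : R := if Nat.ltb i n then x i else y.

Lemma ext_lt (n : nat) (x : nat -> R) (y : R) (i : nat) : (i < n)%nat -> ext n x y i = x i.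
Proof. intros h. unfold ext. destruct (Nat.ltb_spec i n); [reflexivity|lia]. Qed.

Lemma ext_n (n : nat) (x : nat -> R) (y : R) : ext n x y n = y.
Proof. unfold ext. destruct (Nat.ltb_spec n n); [lia|reflexivity]. Qed.

(** The factor [2 * d] stands for division by the least pulse speed 1 / (2d). It makes the
    displacements negligible for the near particles, while that of the last particle is only
    bounded. *)
Definition pulse_done (K : nat) (rho d M : R) (x q v : nat -> R) : Prop :=
  v O = - (pa d rho (S K) 0 / d) /\ q O = x O /\
  forall i, (i < S K)%nat -> v (S i) = pw d rho (S K) (S i) /\
    Rabs (q (S i) - x i) <= M * ((x i - x O) * (2 * d)).

(** Multiplied by d, the left side tends to 0 and the right side to [C]: the last particle is at
    distance of order 1/d, whereas the left side stays bounded. *)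
Lemma tends_gap_far (K : nat) (rho C D M1 : R) :
  (1 <= K)%nat -> 0 < rho -> 0 < C ->
  stage_nbhd K rho C (fun u => D + M1 * ((snd u K - snd u O) * (2 * fst u)) < snd u K).
Proof.
  intros hK hr hC.
  assert (A : stage_nbhd K rho C (fun u => fst u * D + M1 * ((fst u * snd u K - fst u * snd u O) * (2 * fst u))
        < fst u * snd u K)).
  { apply (lim_lt _ _ _ (0 * D + M1 * ((C - 0 * pp rho 0) * (2 * 0))) C); [lra| |apply tends_dxK].
    apply lim_plus; [apply stage_nbhd_filter| |].
    - apply lim_mult; [apply stage_nbhd_filter|apply tends_d|apply lim_const; apply stage_nbhd_filter].
    - apply lim_mult; [apply stage_nbhd_filter|apply lim_const; apply stage_nbhd_filter|].
      apply lim_mult; [apply stage_nbhd_filter| |].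
      + apply lim_minus; [apply stage_nbhd_filter|apply tends_dxK|].
        apply lim_mult; [apply stage_nbhd_filter|apply tends_d|apply tends_x; lia].
      + apply lim_mult; [apply stage_nbhd_filter|apply lim_const; apply stage_nbhd_filter|apply tends_d]. }
  generalize (filter_and _ _ A (stage_pos K rho C)). apply filter_imp.
  intros [d x] [h1 h2]. simpl in *.
  apply Rmult_lt_reg_l with d; [exact h2|].
  replace (d * (D + M1 * ((x K - x O) * (2 * d)))) with
    (d * D + M1 * ((d * x K - d * x O) * (2 * d))) by ring. exact h1.
Qed.

Lemma tends_small_kick (K : nat) (rho C M1 : R) (i : nat) :
  (i < K)%nat -> tends (stage_nbhd K rho C) (fun u => M1 * ((snd u i - snd u O) * (2 * fst u))) 0.
Proof.
  intros hi. apply (lim_eq _ _ (M1 * ((pp rho i - pp rho 0) * (2 * 0)))); [ring|].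
  apply lim_mult; [apply stage_nbhd_filter|apply lim_const; apply stage_nbhd_filter|].
  apply lim_mult; [apply stage_nbhd_filter| |].
  - apply lim_minus; [apply stage_nbhd_filter| |]; apply tends_x; lia.
  - apply lim_mult; [apply stage_nbhd_filter|apply lim_const; apply stage_nbhd_filter|apply tends_d].
Qed.

Lemma pulse_phase (K : nat) (rho C M : R) :
  (1 <= K)%nat -> 0 < rho -> rho <> 1 -> 0 < C ->
  (forall i, (i <= K)%nat -> Rabs (gam rho i) < M) ->
  stage_nbhd K rho C (fun u => let d := fst u in let x := snd u in
    strict_on 0 (S K) x /\ pos_on 0 (S (S K)) (mass d rho) /\
    forall y, x K < y -> exists B T q v,
      ss 0 (S (S K)) (mass d rho) B (ext (S K) x y) (ext (S K) (fun _ => 0) (- / d)) T (S K) q v /\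
      pulse_done K rho d M x q v).
Proof.
  intros hK hr hr1 hC hM.
  assert (hM0 : 0 < M) by (pose proof (hM O ltac:(lia)); pose proof (Rabs_pos (gam rho 0)); lra).
  set (N := stage_nbhd K rho C).
  assert (E1 : N (fun u => forall i, (i < S (S K))%nat -> 0 < mass (fst u) rho i /\
      1 / 2 < pa (fst u) rho (S K) i)).
  { apply filter_forall_nat; [apply stage_nbhd_filter|]. intros i hi. apply filter_and.
    - apply (lim_lt _ _ _ 0 1); [lra|apply lim_const; apply stage_nbhd_filter|apply tends_mass].
    - apply (lim_lt _ _ _ (1 / 2) 1); [lra|apply lim_const; apply stage_nbhd_filter|apply tends_pa]. }
  assert (E2 : N (fun u => forall i, (i < S K)%nat -> Rabs (pw (fst u) rho (S K) (S i)) < M)).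
  { apply filter_forall_nat; [apply stage_nbhd_filter|]. intros i hi.
    apply (lim_abs_lt _ _ (- gam rho i)); [rewrite Rabs_Ropp; apply hM; lia|apply tends_pw]. }
  assert (E3 : N (fun u => M * 2 * fst u < 1)).
  { apply (lim_lt _ _ _ (M * 2 * 0) 1); [lra| |apply lim_const; apply stage_nbhd_filter].
    apply lim_mult; [apply stage_nbhd_filter|apply lim_const; apply stage_nbhd_filter|apply tends_d]. }
  assert (E4 : N (fun u => forall i, (i < K)%nat -> snd u i < snd u (S i) /\
      snd u i + 2 * (M * ((snd u (S i) - snd u O) * (2 * fst u))) < snd u (S i))).
  { apply filter_forall_nat; [apply stage_nbhd_filter|]. intros i hi.
    (* The gap below particle K has no limit and is handled by its size; the other gaps tend to
       those of [pp]. *)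
    destruct (Nat.eq_dec (S i) K) as [e|hn].
    - assert (A1 : N (fun u => snd u i < pp rho i + 1)).
      { apply (lim_lt _ _ _ (pp rho i) (pp rho i + 1)); [lra|apply tends_x; lia|apply lim_const; apply stage_nbhd_filter]. }
      pose proof (tends_gap_far K rho C (pp rho i + 1) 0 hK hr hC) as A2.
      pose proof (tends_gap_far K rho C (pp rho i + 1) (2 * M) hK hr hC) as A3.
      generalize (filter_and _ _ A1 (filter_and _ _ A2 A3)). apply filter_imp.
      intros u (a1 & a2 & a3). rewrite e. split; lra.
    - apply filter_and.
      + apply (lim_lt _ _ _ (pp rho i) (pp rho (S i))); [apply pp_increasing; auto| |]; apply tends_x; lia.
      + assert (A : N (fun u => snd u i + 2 * M * ((snd u (S i) - snd u O) * (2 * fst u)) < snd u (S i))).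
        { apply (lim_lt _ _ _ (pp rho i + 0) (pp rho (S i))).
          - pose proof (pp_increasing rho i hr hr1). lra.
          - apply lim_plus; [apply stage_nbhd_filter|apply tends_x; lia|apply tends_small_kick; lia].
          - apply tends_x; lia. }
        revert A. apply filter_imp. intros u hu. lra. }
  generalize (filter_and _ _ (stage_pos K rho C)
    (filter_and _ _ E1 (filter_and _ _ E2 (filter_and _ _ E3 E4)))).
  apply filter_imp. intros [d x] (hd & e1 & e2 & e3 & e4). simpl in *.
  assert (hx : strict_on 0 (S K) x) by (intros i _ hi; apply e4; lia).
  assert (hm : pos_on 0 (S (S K)) (mass d rho)) by (intros i _ hi; apply e1; lia).
  split; [exact hx|]. split; [exact hm|]. intros y hy.
  (* A lower bound for the pulse speed, since the factors [pa] exceed 1/2. *)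
  set (Vm := / (2 * d)).
  assert (hVm : 0 < Vm) by (apply Rinv_0_lt_compat; lra).
  assert (dVm : forall z, z / Vm = z * (2 * d)) by (intros z; unfold Vm; field; lra).
  destruct (ss_pulse (S K) (mass d rho) x (fun j => pa d rho (S K) j / d) (pw d rho (S K)) M Vm)
    with (j := S K) (q := ext (S K) x y) (v := ext (S K) (fun _ => 0) (- / d))
    as (B & T & q & v & r1 & r2 & r3 & r4 & _); auto.
  - split; [lra|]. apply Rmult_lt_reg_r with (2 * d); [lra|].
    unfold Vm. rewrite Rinv_l by lra. lra.
  - intros j hj. pose proof (hm j ltac:(lia) ltac:(lia)). pose proof (hm (S j) ltac:(lia) ltac:(lia)).
    rewrite (pa_step d rho (S K) j hj). field. lra.
  - intros j hj. pose proof (hm j ltac:(lia) ltac:(lia)). pose proof (hm (S j) ltac:(lia) ltac:(lia)).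
    unfold pw. simpl pred. unfold mass in *. simpl in *. field. lra.
  - intros j hj. pose proof (e1 j ltac:(lia)) as [_ a]. unfold Vm.
    apply Rmult_le_reg_r with (2 * d); [lra|]. rewrite Rinv_l by lra.
    replace (pa d rho (S K) j / d * (2 * d)) with (2 * pa d rho (S K) j) by (field; lra). lra.
  - intros j hj. left. apply e2. exact hj.
  - intros i hi. rewrite dVm. apply e4. lia.
  - intros i hi. rewrite !ext_lt by assumption. auto.
  - rewrite ext_n. replace (pa d rho (S K) (S K)) with 1.
    + unfold Rdiv. ring.
    + unfold pa. rewrite Nat.sub_diag. reflexivity.
  - intros i hi. injection hi as ->. rewrite ext_n. exact hy.
  - intros l h1 h2. lia.
  - intros h. lia.
  - intros l h1 h2. lia.
  - exists B, T, q, v. split; [exact r1|]. split; [exact r2|]. split; [exact r3|].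
    intros i hi. destruct (r4 i hi) as [a1 a2]. rewrite dVm in a2. auto.
Qed.

Lemma Rabs_between (x l e : R) : Rabs (x - l) < e -> l - e < x < l + e.
Proof. intros h. apply Rabs_def2 in h. lra. Qed.

Lemma ex_small (l : list R) : (forall x, In x l -> 0 < x) ->
  exists e, 0 < e /\ forall x, In x l -> e <= x.
Proof.
  induction l as [|x l IH]; intros h.
  - exists 1. split; [lra|]. intros y [].
  - destruct IH as (e & he & H); [intros y hy; apply h; right; exact hy|].
    exists (Rmin x e). split; [apply Rmin_pos; [apply h; left; reflexivity|exact he]|].
    intros y [<-|hy]; [apply Rmin_l|]. specialize (H y hy). pose proof (Rmin_r x e). lra.
Qed.

(** The interface between the last two phases. [r] and [e0] are tolerances dictated by the fan
    phase, while [H] and [Bg] bound duration and extent of the group phase uniformly in d. *)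
Definition group_done (K : nat) (rho C r e0 H Bg d : R) (x : nat -> R) (T : R) (q v : nat -> R) : Prop :=
  0 <= T < H /\ strict_on 0 (S (S K)) q /\
  (forall i, (1 <= i)%nat -> (i < S K)%nat -> Rabs (q i) < Bg /\
     Rabs (v i - - gam rho (K - i)) < r) /\
  v O = - (pa d rho (S K) 0 / d) /\ q O = x O - T * (pa d rho (S K) 0 / d) /\
  Rabs (v (S K) - - gam rho K) < r /\ Rabs (d * q (S K) - C) < e0.

(* After the pulse the particles 1 .. K reverse their order while particle 0
   escapes to the left and particle K+1 is still far to the right. *)
Lemma group_phase (K : nat) (rho C M r e0 : R) :
  (1 <= K)%nat -> 0 < rho -> rho <> 1 -> 0 < C -> 0 < r -> 0 < e0 ->
  (forall i, (i <= K)%nat -> Rabs (gam rho i) < M) ->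
  exists H Bg, 0 < H /\ 0 < Bg /\
  stage_nbhd K rho C (fun u => let d := fst u in let x := snd u in
    forall q v, pulse_done K rho d M x q v -> exists B T q1 v1,
      ss 0 (S (S K)) (mass d rho) B q v T (binom K 2) q1 v1 /\
      group_done K rho C r e0 H Bg d x T q1 v1).
Proof.
  intros hK hr hr1 hC hrp he0 hM.
  assert (hM0 : 0 < M) by (pose proof (hM O ltac:(lia)); pose proof (Rabs_pos (gam rho 0)); lra).
  destruct (group_limit K rho hr hr1) as (h & Bg & T & qs & vs & hh & hBg & hP & hPh & hss & hqs & hvs & evs).
  set (P := fun i => pp rho (pred i)) in *. set (G := fun i => - gam rho (pred i)) in *.
  destruct (strict_on_open _ _ _ hP) as (eP & heP & oP).
  destruct (strict_on_open _ _ _ hPh) as (eh & heh & oh).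
  destruct (strict_on_open _ _ _ hqs) as (eq & heq & oq).
  destruct (ex_small [1; r; eq]) as (eta & heta & heta').
  { intros z [<-|[<-|[<-|[]]]]; lra. }
  pose proof (heta' 1 ltac:(simpl; auto)) as heta1.
  pose proof (heta' r ltac:(simpl; auto)) as heta2.
  pose proof (heta' eq ltac:(simpl; auto)) as heta3.
  destruct (ss_stable 1 (S K) (fun _ => 1) Bg (flow P G h) G T (binom K 2) qs vs eta) as (r1 & hr1' & hst); auto.
  { intros i _ _. lra. }
  pose proof (ss_time_nonneg _ _ _ _ _ _ _ _ _ _ hss) as hT.
  set (H := h + T + 1).
  exists H, Bg. split; [unfold H; lra|]. split; [exact hBg|].
  (* Beyond the range of the group, with a margin [M * H] for the drift of particle K+1 during the
     whole phase. *)
  set (D := Bg + Rabs (pp rho (pred K)) + eP + M * H).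
  set (N := stage_nbhd K rho C).
  assert (hFN : Filter N) by apply stage_nbhd_filter.
  destruct (ex_small [r1 / 3; eP / 2; eh / 3]) as (ex & hex & hex').
  { intros z [<-|[<-|[<-|[]]]]; lra. }
  pose proof (hex' (r1 / 3) ltac:(simpl; auto)) as hex1.
  pose proof (hex' (eP / 2) ltac:(simpl; auto)) as hex2.
  pose proof (hex' (eh / 3) ltac:(simpl; auto)) as hex3.
  destruct (ex_small [r; r1; ex / h; 1]) as (ew & hew & hew').
  { intros z [<-|[<-|[<-|[<-|[]]]]]; try lra. apply Rdiv_lt_0_compat; lra. }
  pose proof (hew' r ltac:(simpl; auto)) as hew1.
  pose proof (hew' r1 ltac:(simpl; auto)) as hew2.
  pose proof (hew' (ex / h) ltac:(simpl; auto)) as hew3.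
  pose proof (hew' 1 ltac:(simpl; auto)) as hew4.
  assert (hew3' : h * ew <= ex).
  { apply Rmult_le_compat_l with (r := h) in hew3; [|lra].
    replace (h * (ex / h)) with ex in hew3 by (field; lra). exact hew3. }
  assert (E1 : N (fun u => forall i, (i < S (S K))%nat -> Rabs (mass (fst u) rho i - 1) < r1)).
  { apply filter_forall_nat; auto. intros i hi. apply (proj1 (lim_eps N _ _) (tends_mass K rho C i)). lra. }
  assert (E2 : N (fun u => forall i, (i < S K)%nat ->
      Rabs (pw (fst u) rho (S K) (S i) - - gam rho i) < ew /\ Rabs (pw (fst u) rho (S K) (S i)) < M)).
  { apply filter_forall_nat; auto. intros i hi. apply filter_and.
    - apply (proj1 (lim_eps N _ _) (tends_pw K rho C (S K) i)). lra.
    - apply (lim_abs_lt _ _ (- gam rho i)); [rewrite Rabs_Ropp; apply hM; lia|apply tends_pw]. }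
  assert (E3 : N (fun u => forall i, (i < K)%nat -> Rabs (snd u i - pp rho i) < ex /\
      M * ((snd u i - snd u O) * (2 * fst u)) < ex)).
  { apply filter_forall_nat; auto. intros i hi. apply filter_and.
    - apply (proj1 (lim_eps N _ _) (tends_x K rho C i hi)). lra.
    - apply (lim_lt _ _ _ 0 ex); [lra|apply tends_small_kick; lia|apply lim_const; auto]. }
  assert (E4 : N (fun u => D + M * ((snd u K - snd u O) * (2 * fst u)) < snd u K)).
  { apply tends_gap_far; auto. }
  (* Within the fixed time [h] particle 0, at a speed of order 1/d, gets past [- Bg]; from then on
     it can be left out of the interaction. *)
  assert (E5 : N (fun u => fst u * snd u O - h * pa (fst u) rho (S K) 0 < - (fst u * Bg))).
  { apply (lim_lt _ _ _ (0 * pp rho 0 - h * 1) (- (0 * Bg))); [lra| |].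
    - apply lim_minus; auto.
      + apply lim_mult; auto; [apply tends_d|apply tends_x; lia].
      + apply lim_mult; auto; [apply lim_const; auto|apply tends_pa].
    - apply lim_opp. apply lim_mult; auto; [apply tends_d|apply lim_const; auto]. }
  assert (E6 : N (fun u => 1 / 2 < pa (fst u) rho (S K) 0 /\ M * 2 * fst u < 1)).
  { apply filter_and.
    - apply (lim_lt _ _ _ (1 / 2) 1); [lra|apply lim_const; auto|apply tends_pa].
    - apply (lim_lt _ _ _ (M * 2 * 0) 1); [lra| |apply lim_const; auto].
      apply lim_mult; auto; [apply lim_const; auto|apply tends_d]. }
  assert (E7 : N (fun u => Rabs (fst u * snd u K - C) < e0 / 3 /\
      fst u * (M * ((snd u K - snd u O) * (2 * fst u))) < e0 / 3 /\ fst u * (M * H) < e0 / 3)).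
  { apply filter_and; [|apply filter_and].
    - apply (proj1 (lim_eps N _ _) (tends_dxK K rho C)). lra.
    - assert (A : N (fun u => M * ((fst u * snd u K - fst u * snd u O) * (2 * fst u)) < e0 / 3)).
      { apply (lim_lt _ _ _ (M * ((C - 0 * pp rho 0) * (2 * 0))) (e0 / 3)); [lra| |apply lim_const; auto].
        apply lim_mult; auto; [apply lim_const; auto|].
        apply lim_mult; auto.
        - apply lim_minus; auto; [apply tends_dxK|]. apply lim_mult; auto; [apply tends_d|apply tends_x; lia].
        - apply lim_mult; auto; [apply lim_const; auto|apply tends_d]. }
      revert A. apply filter_imp. intros u hu.
      replace (fst u * (M * ((snd u K - snd u O) * (2 * fst u)))) with
        (M * ((fst u * snd u K - fst u * snd u O) * (2 * fst u))) by ring. exact hu.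
    - apply (lim_lt _ _ _ (0 * (M * H)) (e0 / 3)); [lra| |apply lim_const; auto].
      apply lim_mult; auto; [apply tends_d|apply lim_const; auto]. }
  generalize (filter_and _ _ (stage_pos K rho C)
    (filter_and _ _ E1 (filter_and _ _ E2 (filter_and _ _ E3 (filter_and _ _ E4
    (filter_and _ _ E5 (filter_and _ _ E6 E7))))))).
  apply filter_imp. intros [d x] (hd & e1 & e2 & e3 & e4 & e5 & (e6 & e6') & e7 & e7' & e7'').
  simpl fst in *; simpl snd in *. cbv zeta. intros q v (pv0 & pq0 & pd).
  set (V0 := pa d rho (S K) 0 / d) in *.
  assert (hV0 : M < V0).
  { unfold V0. apply Rmult_lt_reg_r with d; [exact hd|].
    replace (pa d rho (S K) 0 / d * d) with (pa d rho (S K) 0) by (field; lra). lra. }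
  assert (hV0d : d * V0 = pa d rho (S K) 0) by (unfold V0; field; lra).
  assert (hMH : M * h <= M * H) by (apply Rmult_le_compat_l; unfold H; lra).
  assert (gq : forall i, (1 <= i)%nat -> (i < S K)%nat -> Rabs (q i - P i) < 2 * ex /\
     v i = pw d rho (S K) i /\ Rabs (v i - G i) < ew /\ Rabs (v i) < M).
  { intros i i1 i2. destruct i as [|i]; [lia|].
    destruct (pd i ltac:(lia)) as [a1 a2]. destruct (e3 i ltac:(lia)) as [a3 a4].
    destruct (e2 i ltac:(lia)) as [a5 a6]. rewrite a1. repeat split; auto.
    unfold P. simpl pred.
    replace (q (S i) - pp rho i) with ((q (S i) - x i) + (x i - pp rho i)) by ring.
    pose proof (Rabs_triang (q (S i) - x i) (x i - pp rho i)). lra. }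
  (* Particles 0 and 1 still touch, as the pulse has just passed between them; strict order holds
     only after a positive time. *)
  assert (q1 : q 1%nat = x O).
  { destruct (pd O ltac:(lia)) as [_ a]. replace (x O - x O) with 0 in a by ring.
    rewrite Rmult_0_l, Rmult_0_r in a. pose proof (Rabs_pos (q 1%nat - x O)).
    assert (z : Rabs (q 1%nat - x O) = 0) by lra. apply Rabs_eq_0 in z. lra. }
  assert (gqh : close_on 1 (S K) (3 * ex) (flow q v h) (flow P G h)).
  { intros i i1 i2. destruct (gq i i1 i2) as (a1 & a2 & a3 & _). unfold flow.
    replace (q i + h * v i - (P i + h * G i)) with ((q i - P i) + h * (v i - G i)) by ring.
    pose proof (Rabs_triang (q i - P i) (h * (v i - G i))).
    assert (Rabs (h * (v i - G i)) < ex).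
    { rewrite Rabs_mult, (Rabs_right h) by lra.
      apply Rlt_le_trans with (h * ew); [apply Rmult_lt_compat_l; lra|exact hew3']. }
    lra. }
  destruct (pd K ltac:(lia)) as [vSK qSK]. destruct (e2 K ltac:(lia)) as [wSK wSKM].
  assert (far : forall s, 0 <= s <= H -> Bg + Rabs (pp rho (pred K)) + eP <= q (S K) + s * v (S K)).
  { intros s hs. rewrite vSK.
    pose proof (Rabs_mult_le s (pw d rho (S K) (S K)) M ltac:(lra) ltac:(lra)).
    assert (s * M <= M * H) by nra.
    assert (a : - (M * ((x K - x O) * (2 * d))) <= q (S K) - x K).
    { pose proof (Rle_abs (- (q (S K) - x K))) as z. rewrite Rabs_Ropp in z. lra. }
    unfold D in e4. lra. }
  assert (sq : strict_on 1 (S K) q).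
  { apply oP. intros i i1 i2. destruct (gq i i1 i2) as [a _]. lra. }
  assert (sqh : strict_on 1 (S K) (flow q v h)).
  { apply oh. intros i i1 i2. specialize (gqh i i1 i2). lra. }
  assert (v01 : v O < v 1%nat).
  { destruct (gq 1%nat ltac:(lia) ltac:(lia)) as (_ & _ & _ & a). apply Rabs_def2 in a. rewrite pv0. lra. }
  assert (stf : forall s, 0 < s <= h -> strict_on 0 (S (S K)) (flow q v s)).
  { intros s hs i _ i2. destruct i as [|i].
    - unfold flow. rewrite pq0, q1. assert (s * v O < s * v 1%nat) by (apply Rmult_lt_compat_l; lra). lra.
    - destruct (Nat.eq_dec (S i) K) as [e|hn].
      + rewrite e.
        assert (b1 : q K < Rabs (pp rho (pred K)) + eP).
        { destruct (gq K ltac:(lia) ltac:(lia)) as [a _]. apply Rabs_between in a. unfold P in a.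
          pose proof (Rle_abs (pp rho (pred K))). lra. }
        assert (b2 : flow q v h K < Bg).
        { assert (close_on 1 (S K) r1 (flow q v h) (flow P G h)).
          { intros l l1 l2. specialize (gqh l l1 l2). lra. }
          destruct (hst (mass d rho) (flow q v h) v) as (T1 & q2 & v2 & s1 & _); auto.
          - intros l l1 l2. apply e1. lia.
          - intros l l1 l2. destruct (gq l l1 l2) as (_ & _ & a & _). lra.
          - pose proof (ss_bounded_start _ _ _ _ _ _ _ _ _ _ s1 K ltac:(lia) ltac:(lia)) as z.
            apply Rabs_def2 in z. lra. }
        apply (flow_lt_between q v h); [| |lra].
        * pose proof (far 0 ltac:(unfold H; lra)). lra.
        * pose proof (far h ltac:(unfold H; lra)). unfold flow at 2.
          pose proof (Rabs_pos (pp rho (pred K))). lra.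
      + apply (flow_lt_between q v h); [apply sq; lia|apply sqh; lia|lra]. }
  destruct (ss_free 0 (S (S K)) (mass d rho) q v h hh stf) as (Ba & ssa).
  destruct (hst (mass d rho) (flow q v h) v) as (T1 & q2 & v2 & s1 & s2 & s3 & s4).
  { intros l l1 l2. apply e1. lia. }
  { intros l l1 l2. specialize (gqh l l1 l2). lra. }
  { intros l l1 l2. destruct (gq l l1 l2) as (_ & _ & a & _). lra. }
  apply Rabs_between in s2. pose proof (ss_time_nonneg _ _ _ _ _ _ _ _ _ _ s1) as hT1.
  destruct (ss_out _ _ _ _ _ _ _ _ _ _ s1 O ltac:(lia)) as [o1 o2].
  destruct (ss_out _ _ _ _ _ _ _ _ _ _ s1 (S K) ltac:(lia)) as [o3 o4].
  pose proof (ss_bounded_end _ _ _ _ _ _ _ _ _ _ s1) as be.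
  assert (l0 : flow q v h O <= - Bg).
  { unfold flow. rewrite pq0, pv0. left. apply Rmult_lt_reg_l with d; [exact hd|].
    replace (d * (x O + h * - V0)) with (d * x O - h * (d * V0)) by ring. rewrite hV0d. lra. }
  assert (l1 : flow q v h O + T1 * v O <= - Bg).
  { rewrite pv0. assert (0 <= T1 * V0) by (apply Rmult_le_pos; lra). lra. }
  pose proof (Rabs_pos (pp rho (pred K))) as ppos.
  assert (f1 : Bg <= flow q v h (S K)).
  { pose proof (far h ltac:(unfold H; lra)). unfold flow. lra. }
  assert (f2 : Bg <= flow q v h (S K) + T1 * v (S K)).
  { pose proof (far (h + T1) ltac:(unfold H; lra)). unfold flow. lra. }
  destruct (ss_extend_ex 1 0 (S K) (S (S K)) (mass d rho) Bg (flow q v h) v T1 (binom K 2) q2 v2)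
    as (Bb & ssb); auto; try lia.
  pose proof (ss_app_ex _ _ _ _ _ _ _ _ _ _ _ _ _ _ _ ssa ssb) as sst. simpl in sst.
  exists (Rmax Ba Bb), (h + T1), q2, v2.
  assert (g2 : forall i, (1 <= i)%nat -> (i < S K)%nat -> Rabs (q2 i) < Bg) by (intros; apply be; auto).
  assert (sq2 : strict_on 1 (S K) q2).
  { apply oq. intros i i1 i2. specialize (s3 i i1 i2). lra. }
  assert (eqK : q2 (S K) = q (S K) + (h + T1) * v (S K)) by (rewrite o3; unfold flow; ring).
  assert (eq0 : q2 O = x O - (h + T1) * V0) by (rewrite o1; unfold flow; rewrite pq0, pv0; ring).
  split; [exact sst|]. split; [unfold H; lra|]. split; [|split; [|split; [|split; [|split]]]].
  - intros i _ i2. destruct i as [|i].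
    + rewrite o1. pose proof (g2 1%nat ltac:(lia) ltac:(lia)) as z. apply Rabs_def2 in z. lra.
    + destruct (Nat.eq_dec (S i) K) as [e|hn].
      * rewrite e, o3. pose proof (g2 K ltac:(lia) ltac:(lia)) as z. apply Rabs_def2 in z. lra.
      * apply sq2; lia.
  - intros i i1 i2. split; [auto|]. rewrite <- evs by auto. specialize (s4 i i1 i2). lra.
  - rewrite o2. exact pv0.
  - exact eq0.
  - rewrite o4, vSK. lra.
  - rewrite eqK, vSK.
    pose proof (Rabs_mult_le (h + T1) (pw d rho (S K) (S K)) M ltac:(lra) ltac:(lra)) as z1.
    assert (z2 : (h + T1) * M <= M * H) by (unfold H; nra).
    apply Rabs_def2 in e7.
    assert (z3 : - (M * ((x K - x O) * (2 * d))) <= q (S K) - x K <= M * ((x K - x O) * (2 * d))).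
    { apply Rabs_le_between. exact qSK. }
    set (X := q (S K) - x K) in *. set (Y := (h + T1) * pw d rho (S K) (S K)) in *.
    replace (d * (q (S K) + Y) - C) with (d * x K - C + d * X + d * Y) by (unfold X; ring).
    assert (d * Y <= d * (M * H)) by (apply Rmult_le_compat_l; lra).
    assert (d * - Y <= d * (M * H)) by (apply Rmult_le_compat_l; lra).
    assert (d * X <= d * (M * ((x K - x O) * (2 * d)))) by (apply Rmult_le_compat_l; lra).
    assert (d * - X <= d * (M * ((x K - x O) * (2 * d)))) by (apply Rmult_le_compat_l; lra).
    apply Rabs_def1; lra.
Qed.

(* Seen from a distance of order 1/d the reversed group is a fan of lines through
   one point, which particle K+1 now crosses. *)
Lemma fan_phase (K : nat) (rho C eta : R) :
  (1 <= K)%nat -> 0 < rho -> rho <> 1 -> 0 < C -> 0 < eta ->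
  exists r e0, 0 < r /\ 0 < e0 /\ forall H Bg, 0 < H -> 0 < Bg ->
  stage_nbhd K rho C (fun u => let d := fst u in let x := snd u in
    forall T q1 v1, group_done K rho C r e0 H Bg d x T q1 v1 -> exists B T' q' v' mu,
      ss 0 (S (S K)) (mass d rho) B q1 v1 T' K q' v' /\
      strict_on 0 (S (S K)) q' /\ strict_on 0 (S (S K)) v' /\ 0 < mu /\
      (forall i, (i < S K)%nat -> Rabs (mu * - q' (S K - i)%nat - pp (/ rho) i) < eta) /\
      Rabs (d * rho ^ S K * (mu * - q' O) - 2 * rho ^ K) < eta).
Proof.
  intros hK hr hr1 hC heta.
  destruct (bounded_range (gam rho) (S K)) as (M & hM0 & hM).
  destruct (fan_limit K rho C hK hr hr1 hC) as (s0 & B2 & T2 & qs & vs & hs0 & hB2 & hQ & hss & hqs & hvs & evs).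
  set (V := fun i => if Nat.leb i K then - gam rho (K - i) else - gam rho K) in *.
  set (Q := fun i => if Nat.leb i K then s0 * V i else C + s0 * V i) in *.
  assert (VS : V (S K) = - gam rho K).
  { unfold V. destruct (Nat.leb_spec (S K) K); [lia|reflexivity]. }
  assert (Vlo : forall i, (i <= K)%nat -> V i = - gam rho (K - i)).
  { intros i hi. unfold V. destruct (Nat.leb_spec i K); [reflexivity|lia]. }
  assert (QS : Q (S K) = C + s0 * V (S K)).
  { unfold Q. destruct (Nat.leb_spec (S K) K); [lia|reflexivity]. }
  assert (Qlo : forall i, (i <= K)%nat -> Q i = s0 * V i).
  { intros i hi. unfold Q. destruct (Nat.leb_spec i K); [reflexivity|lia]. }
  assert (hV : strict_on 1 (S K) V).
  { intros i i1 i2. rewrite !Vlo by lia.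
    pose proof (gam_increasing rho (K - S i) (K - i) hr hr1 ltac:(lia)). lra. }
  pose proof (ss_time_nonneg _ _ _ _ _ _ _ _ _ _ hss) as hT2.
  destruct (strict_on_open _ _ _ hQ) as (eQ & heQ & oQ).
  destruct (strict_on_open _ _ _ hqs) as (eq & heq & oq).
  destruct (strict_on_open _ _ _ hvs) as (ev & hev & ov).
  destruct (strict_on_open _ _ _ hV) as (eV & heV & oV).
  set (KK := 2 * rho ^ K).
  assert (hKK : 0 < KK) by (unfold KK; pose proof (pow_lt rho K hr); lra).
  (* The final free flight lasts [R / d]. [R1] makes the positions of the fan before this flight
     negligible against what the flight adds, [R2] does the same for the way of particle 0. *)
  set (R1 := 4 * B2 / (rho * eta)). set (R2 := 8 * KK * (s0 + T2 + 2) / eta).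
  assert (hre : 0 < rho * eta) by (apply Rmult_lt_0_compat; assumption).
  assert (hR1 : 0 < R1) by (apply Rdiv_lt_0_compat; lra).
  assert (hR2 : 0 < R2).
  { apply Rdiv_lt_0_compat; [|lra]. apply Rmult_lt_0_compat; lra. }
  set (R := 1 + R1 + R2).
  assert (hR : 1 < R) by (unfold R; lra).
  assert (R1e : R1 * (rho * eta) = 4 * B2) by (unfold R1; field; lra).
  assert (R2e : R2 * eta = 8 * KK * (s0 + T2 + 2)) by (unfold R2; field; lra).
  destruct (ex_small [1; rho * eta / 8; eq; ev]) as (eta2 & heta2 & hsm).
  { intros z [<-|[<-|[<-|[<-|[]]]]]; lra. }
  pose proof (hsm 1 ltac:(simpl; auto)) as hs1.
  pose proof (hsm (rho * eta / 8) ltac:(simpl; auto)) as hs2.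
  pose proof (hsm eq ltac:(simpl; auto)) as hs3.
  pose proof (hsm ev ltac:(simpl; auto)) as hs4.
  destruct (ss_stable 1 (S (S K)) (fun _ => 1) B2 Q V T2 K qs vs eta2) as (r2' & hr2' & hst); auto.
  { intros i _ _. lra. }
  set (r2 := Rmin r2' eQ).
  assert (hr2 : 0 < r2) by (apply Rmin_pos; lra).
  assert (hr2a : r2 <= r2') by apply Rmin_l. assert (hr2b : r2 <= eQ) by apply Rmin_r.
  destruct (ex_small [1; r2; r2 / (4 * s0); eV]) as (r & hrp & hrs).
  { intros z [<-|[<-|[<-|[<-|[]]]]]; try lra. apply Rdiv_lt_0_compat; lra. }
  pose proof (hrs 1 ltac:(simpl; auto)) as hrs1.
  pose proof (hrs r2 ltac:(simpl; auto)) as hrs2.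
  pose proof (hrs (r2 / (4 * s0)) ltac:(simpl; auto)) as hrs3.
  pose proof (hrs eV ltac:(simpl; auto)) as hrs4.
  assert (hrs3' : s0 * r <= r2 / 4).
  { apply Rmult_le_compat_l with (r := s0) in hrs3; [|lra].
    replace (s0 * (r2 / (4 * s0))) with (r2 / 4) in hrs3 by (field; lra). exact hrs3. }
  destruct (ex_small [1; eta / (8 * KK)]) as (e7 & he7 & he7s).
  { intros z [<-|[<-|[]]]; try lra. apply Rdiv_lt_0_compat; lra. }
  pose proof (he7s 1 ltac:(simpl; auto)) as he71.
  pose proof (he7s (eta / (8 * KK)) ltac:(simpl; auto)) as he72.
  assert (he72' : KK * e7 <= eta / 8).
  { apply Rmult_le_compat_l with (r := KK) in he72; [|lra].
    replace (KK * (eta / (8 * KK))) with (eta / 8) in he72 by (field; lra). exact he72. }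
  exists r, (r2 / 4). split; [exact hrp|]. split; [lra|].
  intros H Bg hH hBg.
  set (N := stage_nbhd K rho C).
  assert (hFN : Filter N) by apply stage_nbhd_filter.
  assert (E1 : N (fun u => forall i, (i < S (S K))%nat -> Rabs (mass (fst u) rho i - 1) < r2)).
  { apply filter_forall_nat; auto. intros i hi. apply (proj1 (lim_eps N _ _) (tends_mass K rho C i)). lra. }
  assert (E2 : N (fun u => fst u * Bg < r2 / 2 /\ fst u * H < e7 /\ fst u * (M + 1) < 1 / 2)).
  { apply filter_and; [|apply filter_and].
    - apply (lim_lt _ _ _ (0 * Bg) (r2 / 2)); [lra| |apply lim_const; auto].
      apply lim_mult; auto; [apply tends_d|apply lim_const; auto].
    - apply (lim_lt _ _ _ (0 * H) e7); [lra| |apply lim_const; auto].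
      apply lim_mult; auto; [apply tends_d|apply lim_const; auto].
    - apply (lim_lt _ _ _ (0 * (M + 1)) (1 / 2)); [lra| |apply lim_const; auto].
      apply lim_mult; auto; [apply tends_d|apply lim_const; auto]. }
  assert (L3 : tends N (fun u => fst u * (fst u * snd u O)) (0 * (0 * pp rho 0))).
  { apply lim_mult; auto; [apply tends_d|]. apply lim_mult; auto; [apply tends_d|apply tends_x; lia]. }
  assert (E3 : N (fun u => Rabs (fst u * (fst u * snd u O)) < e7)).
  { apply (lim_abs_lt _ _ (0 * (0 * pp rho 0))); auto. rewrite Rmult_0_l, Rabs_R0. exact he7. }
  assert (E4 : N (fun u => fst u * (fst u * snd u O) - s0 * pa (fst u) rho (S K) 0 < - (fst u * B2))).
  { apply (lim_lt _ _ _ (0 * (0 * pp rho 0) - s0 * 1) (- (0 * B2))); [lra| |].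
    - apply lim_minus; auto. apply lim_mult; auto; [apply lim_const; auto|apply tends_pa].
    - apply lim_opp. apply lim_mult; auto; [apply tends_d|apply lim_const; auto]. }
  assert (E5 : N (fun u => Rabs (pa (fst u) rho (S K) 0 - 1) < e7 /\ 1 / 2 < pa (fst u) rho (S K) 0)).
  { apply filter_and.
    - apply (proj1 (lim_eps N _ _) (tends_pa K rho C (S K) 0)). lra.
    - apply (lim_lt _ _ _ (1 / 2) 1); [lra|apply lim_const; auto|apply tends_pa]. }
  generalize (filter_and _ _ (stage_pos K rho C)
    (filter_and _ _ E1 (filter_and _ _ E2 (filter_and _ _ E3 (filter_and _ _ E4 E5))))).
  apply filter_imp. intros [d x] (hd & e1 & (e2 & e2' & e2'') & e3 & e4 & e5 & e5').
  simpl fst in *; simpl snd in *. cbv zeta.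
  intros T q1 v1 (hT & sq1 & g1 & v10 & q10 & vSK & qSK).
  set (a0 := pa d rho (S K) 0) in *. set (V0 := a0 / d) in *.
  assert (hV0d : d * V0 = a0) by (unfold V0; field; lra).
  assert (hV0 : M + 1 < V0).
  { apply Rmult_lt_reg_l with d; [exact hd|]. lra. }
  (* Time [s0] of the limit fan, in the original scale. *)
  set (t2 := s0 / d).
  assert (ht2 : 0 < t2) by (apply Rdiv_lt_0_compat; lra).
  assert (hdt2 : d * t2 = s0) by (unfold t2; field; lra).
  assert (cv : forall i, (1 <= i)%nat -> (i < S (S K))%nat -> Rabs (v1 i - V i) < r).
  { intros i i1 i2. destruct (Nat.eq_dec i (S K)) as [->|hn].
    - rewrite VS. exact vSK.
    - rewrite Vlo by lia. apply g1; lia. }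
  set (q3 := flow q1 v1 t2).
  assert (cq : close_on 1 (S (S K)) r2 (fun i => d * q3 i) Q).
  { intros i i1 i2. specialize (cv i i1 i2).
    assert (z : Rabs (s0 * (v1 i - V i)) <= r2 / 4).
    { rewrite Rabs_mult, (Rabs_right s0) by lra.
      apply Rle_trans with (s0 * r); [apply Rmult_le_compat_l; lra|exact hrs3']. }
    apply Rabs_le_between in z. unfold q3, flow. destruct (Nat.eq_dec i (S K)) as [->|hn].
    - rewrite QS. apply Rabs_def2 in qSK.
      replace (d * (q1 (S K) + t2 * v1 (S K)) - (C + s0 * V (S K))) with
        (d * q1 (S K) - C + s0 * (v1 (S K) - V (S K))) by (rewrite <- hdt2; ring).
      apply Rabs_def1; lra.
    - rewrite Qlo by lia. destruct (g1 i i1 ltac:(lia)) as [b _]. apply Rabs_def2 in b.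
      replace (d * (q1 i + t2 * v1 i) - s0 * V i) with
        (d * q1 i + s0 * (v1 i - V i)) by (rewrite <- hdt2; ring).
      assert (d * q1 i < d * Bg) by (apply Rmult_lt_compat_l; lra).
      assert (d * - q1 i < d * Bg) by (apply Rmult_lt_compat_l; lra).
      apply Rabs_def1; lra. }
  assert (vM : forall i, (1 <= i)%nat -> (i <= K)%nat -> - V0 < V i - 1).
  { intros i i1 i2. rewrite Vlo by lia. pose proof (hM (K - i)%nat ltac:(lia)) as z.
    apply Rabs_def2 in z. lra. }
  assert (v01 : v1 O < v1 1%nat).
  { rewrite v10. specialize (cv 1%nat ltac:(lia) ltac:(lia)). apply Rabs_between in cv.
    specialize (vM 1%nat ltac:(lia) ltac:(lia)). lra. }
  assert (sv1 : strict_on 1 (S K) v1).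
  { apply oV. intros i i1 i2. specialize (cv i i1 ltac:(lia)). lra. }
  assert (sq3 : strict_on 1 (S (S K)) q3).
  { assert (z : strict_on 1 (S (S K)) (fun i => d * q3 i)).
    { apply oQ. intros i i1 i2. eapply Rlt_le_trans; [exact (cq i i1 i2)|lra]. }
    intros i i1 i2. specialize (z i i1 i2). apply Rmult_lt_reg_l with d; assumption. }
  destruct (ss_free 0 (S (S K)) (mass d rho) q1 v1 t2 ht2) as (Ba & ssa).
  { intros s hs i _ i2. pose proof (sq1 i ltac:(lia) i2) as z.
    destruct (Nat.eq_dec i K) as [->|hn].
    - apply (flow_lt_between q1 v1 t2); [exact z|apply sq3; lia|lra].
    - assert (z2 : v1 i < v1 (S i)) by (destruct i as [|i]; [exact v01|apply sv1; lia]).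
      assert (s * v1 i < s * v1 (S i)) by (apply Rmult_lt_compat_l; lra). unfold flow. lra. }
  destruct (hst (mass d rho) (fun i => d * q3 i) v1) as (T2' & qb & vb & s1 & s2 & s3 & s4).
  { intros i i1 i2. specialize (e1 i i2). lra. }
  { intros i i1 i2. eapply Rlt_le_trans; [exact (cq i i1 i2)|lra]. }
  { intros i i1 i2. specialize (cv i i1 i2). lra. }
  apply Rabs_between in s2. pose proof (ss_time_nonneg _ _ _ _ _ _ _ _ _ _ s1) as hT2'.
  pose proof (ss_bounded_end _ _ _ _ _ _ _ _ _ _ s1) as bqb.
  assert (hid : 0 < / d) by (apply Rinv_0_lt_compat; exact hd).
  (* Back from the coordinates multiplied by d: lengths and times are divided by d, velocities
     kept. *)
  apply (ss_scale _ _ _ _ _ _ _ _ _ _ (/ d) 1 hid ltac:(lra)) in s1.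
  cbv beta in s1.
  assert (f1 : (fun i => / d * (d * q3 i)) = q3)
    by (apply functional_extensionality; intros i; field; lra).
  assert (f2 : forall f : nat -> Rdefinitions.R, (fun i => 1 * f i) = f)
    by (intros f; apply functional_extensionality; intros i; ring).
  rewrite f1, !f2 in s1.
  replace (/ d / 1 * T2') with (T2' / d) in s1 by (field; lra).
  set (qc := fun i => / d * qb i) in *.
  destruct (ss_out _ _ _ _ _ _ _ _ _ _ s1 O ltac:(lia)) as [o1 o2].
  assert (hV0p : 0 < V0) by lra.
  assert (l0 : q3 O <= - (/ d * B2)).
  { unfold q3, flow. rewrite v10, q10.
    assert (0 <= T * V0) by (apply Rmult_le_pos; lra).
    assert (z : x O - t2 * V0 <= - (/ d * B2)); [|lra].
    left. apply Rmult_lt_reg_l with (d * d); [apply Rmult_lt_0_compat; exact hd|].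
    replace (d * d * (x O - t2 * V0)) with (d * (d * x O) - (d * t2) * (d * V0)) by ring.
    rewrite hdt2, hV0d. replace (d * d * - (/ d * B2)) with (- (d * B2)) by (field; lra). exact e4. }
  assert (htd : 0 <= T2' / d) by (apply Rmult_le_pos; lra).
  assert (l1 : q3 O + T2' / d * v1 O <= - (/ d * B2)).
  { rewrite v10. assert (0 <= T2' / d * V0) by (apply Rmult_le_pos; lra). lra. }
  destruct (ss_extend_ex 1 0 (S (S K)) (S (S K)) (mass d rho) (/ d * B2) q3 v1 (T2' / d) K qc vb)
    as (Bb & ssb); auto; try lia.
  { apply Rmult_lt_0_compat; lra. }
  assert (vb0 : vb O = - V0) by (rewrite o2; exact v10).
  assert (svb : strict_on 0 (S (S K)) vb).
  { assert (z : strict_on 1 (S (S K)) vb) by (apply ov; intros i i1 i2; specialize (s4 i i1 i2); lra).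
    intros i _ i2. destruct i as [|i]; [|apply z; lia]. rewrite vb0.
    specialize (s4 1%nat ltac:(lia) ltac:(lia)). rewrite evs in s4 by lia. apply Rabs_between in s4.
    replace (S K - 1)%nat with K in s4 by lia. pose proof (hM K ltac:(lia)) as y. apply Rabs_def2 in y. lra. }
  assert (sqc : strict_on 0 (S (S K)) qc).
  { assert (z : strict_on 1 (S (S K)) qb) by (apply oq; intros i i1 i2; specialize (s3 i i1 i2); lra).
    intros i _ i2. destruct i as [|i].
    - rewrite o1. apply Rle_lt_trans with (1 := l1). unfold qc.
      specialize (bqb 1%nat ltac:(lia) ltac:(lia)). apply Rabs_def2 in bqb.
      rewrite <- Ropp_mult_distr_r_reverse. apply Rmult_lt_compat_l; lra.
    - unfold qc. apply Rmult_lt_compat_l; [exact hid|]. apply z; lia. }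
  assert (hRd : 0 < R / d) by (apply Rdiv_lt_0_compat; lra).
  assert (stc : forall s, 0 < s -> strict_on 0 (S (S K)) (flow qc vb s)).
  { intros s hs i i1 i2. specialize (sqc i i1 i2). specialize (svb i i1 i2). unfold flow.
    assert (s * vb i < s * vb (S i)) by (apply Rmult_lt_compat_l; lra). lra. }
  destruct (ss_free 0 (S (S K)) (mass d rho) qc vb (R / d) hRd) as (Bc & ssc).
  { intros s hs. apply stc. lra. }
  pose proof (ss_app_ex _ _ _ _ _ _ _ _ _ _ _ _ _ _ _ ssa
     (ss_app_ex _ _ _ _ _ _ _ _ _ _ _ _ _ _ _ ssb ssc)) as sst.
  rewrite Nat.add_0_r in sst. simpl plus in sst.
  (* After time [R / d] positions are about [R / d] times velocities, which are the opposites of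
     [gam rho]. As [pp (/ rho) i] is 2 / rho times [gam rho i], this fixes [mu]. *)
  eexists _, _, (flow qc vb (R / d)), vb, (2 * d / (rho * R)).
  assert (hrR : 0 < rho * R) by (apply Rmult_lt_0_compat; lra).
  split; [exact sst|]. split; [apply stc; exact hRd|]. split; [exact svb|].
  split; [apply Rdiv_lt_0_compat; lra|]. split.
  - intros i hi.
    specialize (s4 (S K - i)%nat ltac:(lia) ltac:(lia)). rewrite evs in s4 by lia.
    replace (S K - (S K - i))%nat with i in s4 by lia.
    specialize (bqb (S K - i)%nat ltac:(lia) ltac:(lia)).
    unfold flow, qc.
    set (X := qb (S K - i)%nat) in *. set (Y := vb (S K - i)%nat) in *.
    assert (e : 2 * d / (rho * R) * - (/ d * X + R / d * Y) - pp (/ rho) i =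
       - (2 / (rho * R)) * X - 2 / rho * (Y - - gam rho i)).
    { unfold pp, gam. rewrite Rinv_inv. field. lra. }
    rewrite e. clear e.
    assert (z1 : 2 / (rho * R) * B2 <= eta / 2).
    { apply Rmult_le_reg_r with (rho * R); [exact hrR|].
      replace (2 / (rho * R) * B2 * (rho * R)) with (2 * B2) by (field; lra).
      assert (R1 * (rho * eta) <= R * (rho * eta)) by (apply Rmult_le_compat_r; unfold R; lra). lra. }
    assert (z2 : 2 / rho * eta2 <= eta / 4).
    { apply Rmult_le_reg_r with rho; [exact hr|].
      replace (2 / rho * eta2 * rho) with (2 * eta2) by (field; lra). lra. }
    assert (p1 : 0 < 2 / (rho * R)) by (apply Rdiv_lt_0_compat; lra).
    assert (p2 : 0 < 2 / rho) by (apply Rdiv_lt_0_compat; lra).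
    apply Rabs_def2 in bqb. apply Rabs_def2 in s4.
    set (Z := Y - - gam rho i) in *.
    assert (2 / (rho * R) * X < 2 / (rho * R) * B2) by (apply Rmult_lt_compat_l; lra).
    assert (2 / (rho * R) * - X < 2 / (rho * R) * B2) by (apply Rmult_lt_compat_l; lra).
    assert (2 / rho * Z < 2 / rho * eta2) by (apply Rmult_lt_compat_l; lra).
    assert (2 / rho * - Z < 2 / rho * eta2) by (apply Rmult_lt_compat_l; lra).
    apply Rabs_def1; lra.
  - unfold flow. rewrite o1, vb0. unfold q3, flow. rewrite v10, q10.
    assert (e : d * rho ^ S K * (2 * d / (rho * R) *
        - (x O - T * V0 + t2 * - V0 + T2' / d * - V0 + R / d * - V0)) - KK =
        KK * (- (d * (d * x O)) / R + (d * T + s0 + T2') * a0 / R + (a0 - 1))).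
    { rewrite <- hV0d, <- hdt2. unfold KK. simpl. field. lra. }
    rewrite e. clear e.
    set (X := d * (d * x O)) in *.
    assert (hRi : 0 < / R < 1).
    { split; [apply Rinv_0_lt_compat; lra|]. rewrite <- Rinv_1. apply Rinv_lt_contravar; lra. }
    apply Rabs_def2 in e3. apply Rabs_def2 in e5.
    assert (b1 : - e7 < - X / R < e7).
    { unfold Rdiv. split; nra. }
    assert (dT : 0 <= d * T <= e7).
    { split; [apply Rmult_le_pos; lra|]. assert (d * T <= d * H) by (apply Rmult_le_compat_l; lra). lra. }
    assert (b2 : 0 <= (d * T + s0 + T2') * a0 <= (s0 + T2 + 2) * 2).
    { split; [apply Rmult_le_pos; lra|]. apply Rmult_le_compat; lra. }
    assert (b3 : 0 <= KK * ((d * T + s0 + T2') * a0 / R) <= eta / 4).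
    { split.
      - apply Rmult_le_pos; [lra|]. unfold Rdiv. apply Rmult_le_pos; lra.
      - apply Rmult_le_reg_r with R; [lra|].
        replace (KK * ((d * T + s0 + T2') * a0 / R) * R) with (KK * ((d * T + s0 + T2') * a0)) by (field; lra).
        assert (KK * ((d * T + s0 + T2') * a0) <= KK * ((s0 + T2 + 2) * 2)) by (apply Rmult_le_compat_l; lra).
        assert (R2 * eta <= R * eta) by (apply Rmult_le_compat_r; unfold R; lra). lra. }
    assert (KK * (- X / R) < KK * e7) by (apply Rmult_lt_compat_l; lra).
    assert (KK * - (- X / R) < KK * e7) by (apply Rmult_lt_compat_l; lra).
    assert (KK * (a0 - 1) < KK * e7) by (apply Rmult_lt_compat_l; lra).
    assert (KK * - (a0 - 1) < KK * e7) by (apply Rmult_lt_compat_l; lra).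
    apply Rabs_def1; lra.
Qed.

(** Tolerances are chosen backwards: the fan phase fixes [r] and [e0], the group phase then provides
    [H] and [Bg], and only with these does the fan phase give its neighbourhood. The place [y] of
    the new particle is free because the array is at rest. *)
Lemma stage_forward (K : nat) (rho C eta : R) :
  (1 <= K)%nat -> 0 < rho -> rho <> 1 -> 0 < C -> 0 < eta ->
  stage_nbhd K rho C (fun u => let d := fst u in let x := snd u in
    pos_on 0 (S (S K)) (mass d rho) /\
    forall y, x K < y -> exists B T q' v' mu,
      ss 0 (S (S K)) (mass d rho) B (ext (S K) x y) (ext (S K) (fun _ => 0) (- / d)) T
         (S K + (binom K 2 + K)) q' v' /\
      strict_on 0 (S (S K)) q' /\ strict_on 0 (S (S K)) v' /\ 0 < mu /\
      (forall i, (i < S K)%nat -> Rabs (mu * - q' (S K - i)%nat - pp (/ rho) i) < eta) /\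
      Rabs (d * rho ^ S K * (mu * - q' O) - 2 * rho ^ K) < eta).
Proof.
  intros hK hr hr1 hC heta.
  destruct (bounded_range (gam rho) (S K)) as (M & hM0 & hM).
  assert (hM' : forall i, (i <= K)%nat -> Rabs (gam rho i) < M) by (intros; apply hM; lia).
  destruct (fan_phase K rho C eta hK hr hr1 hC heta) as (r & e0 & hrp & he0 & F).
  destruct (group_phase K rho C M r e0 hK hr hr1 hC hrp he0 hM') as (H & Bg & hH & hBg & G).
  specialize (F H Bg hH hBg).
  pose proof (pulse_phase K rho C M hK hr hr1 hC hM') as P.
  generalize (filter_and _ _ P (filter_and _ _ G F)). apply filter_imp.
  intros [d x] (p & g & f). simpl fst in *; simpl snd in *. cbv zeta in *.
  destruct p as (_ & pm & p). split; [exact pm|]. intros y hy.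
  destruct (p y hy) as (B1 & T1 & q1 & v1 & s1 & d1).
  destruct (g q1 v1 d1) as (B2 & T2 & q2 & v2 & s2 & d2).
  destruct (f T2 q2 v2 d2) as (B3 & T3 & q3 & v3 & mu & s3 & rest).
  eexists _, _, q3, v3, mu. split; [|exact rest].
  exact (ss_app_ex _ _ _ _ _ _ _ _ _ _ _ _ _ _ _ s1
     (ss_app_ex _ _ _ _ _ _ _ _ _ _ _ _ _ _ _ s2 s3)).
Qed.

(** * Induction on the number of particles *)

Lemma ss_congr (a b : nat) (m m1 : nat -> R) (B : R) q v T k q' v' :
  (forall i, (a <= i)%nat -> (i < b)%nat -> m1 i = m i) ->
  ss a b m B q v T k q' v' ->
  forall q1 v1, (forall i, (a <= i)%nat -> (i < b)%nat -> q1 i = q i /\ v1 i = v i) ->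
  exists q1' v1', ss a b m1 B q1 v1 T k q1' v1' /\
    forall i, (a <= i)%nat -> (i < b)%nat -> q1' i = q' i /\ v1' i = v' i.
Proof.
  intros hm H.
  assert (hb : forall x y, (forall i, (a <= i)%nat -> (i < b)%nat -> y i = x i) ->
            bounded_on a b B x -> bounded_on a b B y).
  { intros x y e h i h1 h2. rewrite e by assumption. auto. }
  induction H; intros q1 v1 e.
  - exists q1, v1. split; [|exact e]. apply ss_nil. apply (hb q); auto. intros; apply e; auto.
  - assert (ef : forall s i, (a <= i)%nat -> (i < b)%nat -> flow q1 v1 s i = flow q v s i).
    { intros s i h1 h2. destruct (e i h1 h2) as [e1 e2]. unfold flow. rewrite e1, e2. reflexivity. }
    destruct (IHss (flow q1 v1 T) v1) as (q1' & v1' & x1 & x2).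
    { intros i h1 h2. split; [apply ef; auto|apply e; auto]. }
    exists q1', v1'. split; [|exact x2]. apply ss_flow; auto.
    + intros s hs i h1 h2. rewrite !ef by lia. apply H0; auto.
    + intros i h1 h2. rewrite !ef by lia. apply H1; auto.
    + apply (hb q); auto. intros; apply e; auto.
  - destruct (IHss q1 (coll m1 v1 i)) as (q1' & v1' & x1 & x2).
    { intros j h1 h2. split; [apply e; auto|].
      destruct (e i ltac:(lia) ltac:(lia)) as [_ e1]. destruct (e (S i) ltac:(lia) ltac:(lia)) as [_ e2].
      destruct (Nat.eq_dec j i) as [->|n1].
      - rewrite !coll_l. unfold cA. rewrite e1, e2, !hm by lia. reflexivity.
      - destruct (Nat.eq_dec j (S i)) as [->|n2].
        + rewrite !coll_r. unfold cB. rewrite e1, e2, !hm by lia. reflexivity.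
        + rewrite !coll_out by assumption. apply e; auto. }
    assert (eq : forall j, (a <= j)%nat -> (j < b)%nat -> q1 j = q j) by (intros; apply e; auto).
    assert (ev : forall j, (a <= j)%nat -> (j < b)%nat -> v1 j = v j) by (intros; apply e; auto).
    exists q1', v1'. split; [|exact x2]. apply (ss_coll a b m1 B q1 v1 i); auto.
    + rewrite !eq by lia. exact H1.
    + rewrite !ev by lia. exact H2.
    + intros j h1 h2. rewrite !eq by lia. auto.
    + intros h. rewrite !eq by lia. auto.
    + apply (hb q); auto.
Qed.

Lemma mirror_strict (n : nat) (q : nat -> R) : strict_on 0 n q -> strict_on 0 n (mirror n q).
Proof.
  intros h i _ hi. destruct (mirror_pair n i q hi) as [-> ->].
  apply Ropp_lt_contravar. apply h; lia.
Qed.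

Lemma scale_strict (a b : nat) (q : nat -> R) (c : R) :
  0 < c -> strict_on a b q -> strict_on a b (fun i => c * q i).
Proof. intros hc h i h1 h2. apply Rmult_lt_compat_l; auto. Qed.

(* S K particles of masses 1 + d rho^i; particle K ends far away, at distance C/d. *)
Definition reachable (K : nat) (rho C : R) : Prop :=
  forall eta, 0 < eta -> exists d0, 0 < d0 /\ forall d, 0 < d < d0 ->
  exists B q0 v0 T x v, ss 0 (S K) (mass d rho) B q0 v0 T (binom (S (S K)) 3) x v /\
    strict_on 0 (S K) q0 /\ strict_on 0 (S K) x /\ strict_on 0 (S K) v /\
    pos_on 0 (S K) (mass d rho) /\
    (forall i, (i < K)%nat -> Rabs (x i - pp rho i) < eta) /\ Rabs (d * x K - C) < eta.

Lemma ext_strict (n : nat) (x : nat -> R) (y : R) :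
  strict_on 0 (S n) x -> x n < y -> strict_on 0 (S (S n)) (ext (S n) x y).
Proof.
  intros hx hy i _ hi. rewrite (ext_lt (S n) x y i) by lia.
  destruct (Nat.eq_dec i n) as [->|hn].
  - rewrite ext_n. exact hy.
  - rewrite ext_lt by lia. apply hx; lia.
Qed.

(** Reflection turns the escaping particle 0 into the far one. In units of [mu] it is at distance
    about 2 / (rho d), and with d' = d rho^(K+1) this is 2 rho^K / d', the new constant. The masses
    1 + d rho^(K+1-i) become 1 + d' rho^(-i). *)
Lemma reachable_step (K : nat) (rho C : R) :
  (1 <= K)%nat -> 0 < rho -> rho <> 1 -> 0 < C ->
  reachable K rho C -> reachable (S K) (/ rho) (2 * rho ^ K).
Proof.
  intros hK hr hr1 hC hreach eta heta.
  destruct (stage_forward K rho C (eta / 2) hK hr hr1 hC ltac:(lra)) as (r & hrp & F).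
  destruct (hreach r hrp) as (d0 & hd0 & D).
  pose proof (pow_lt rho (S K) hr) as hpw.
  exists (rho ^ S K * Rmin r d0). split; [apply Rmult_lt_0_compat; [exact hpw|apply Rmin_pos; lra]|].
  intros d' hd'. set (d := d' / rho ^ S K).
  assert (edd : d' = d * rho ^ S K) by (unfold d; field; lra).
  assert (hd : 0 < d) by (apply Rdiv_lt_0_compat; lra).
  assert (hdm : d < Rmin r d0).
  { apply Rmult_lt_reg_l with (rho ^ S K); [exact hpw|]. lra. }
  pose proof (Rmin_l r d0). pose proof (Rmin_r r d0).
  destruct (D d ltac:(lra)) as (B0 & q0 & v0 & T0 & x & v & s0 & sq0 & sx & sv & pm0 & cx & cK).
  destruct (F d x ltac:(lra) cx cK) as [pm f]. simpl fst in *; simpl snd in *.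
  pose proof (ss_bounded_end _ _ _ _ _ _ _ _ _ _ s0 K ltac:(lia) ltac:(lia)) as bK.
  assert (hB0 : 0 < B0) by (pose proof (Rabs_pos (x K)); lra).
  (* Outside the range of the earlier motion, so the incoming particle cannot disturb it. *)
  set (y := B0 + 1).
  assert (hy : x K < y) by (apply Rabs_def2 in bK; unfold y; lra).
  destruct (f y hy) as (B1 & T1 & q' & v' & mu & s1 & sq' & sv' & hmu & cl1 & cl2).
  destruct (strict_on_open _ _ _ sq') as (eq & heq & oq).
  destruct (strict_on_open _ _ _ sv') as (ev & hev & ov).
  destruct (ex_small [eq; ev; eta / (4 * mu); eta / (4 * (d' * mu))]) as (e & he & hes).
  { intros z [<-|[<-|[<-|[<-|[]]]]]; try lra; apply Rdiv_lt_0_compat; try lra.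
    apply Rmult_lt_0_compat; [lra|]. apply Rmult_lt_0_compat; lra. }
  pose proof (hes eq ltac:(simpl; auto)) as he1.
  pose proof (hes ev ltac:(simpl; auto)) as he2.
  pose proof (hes (eta / (4 * mu)) ltac:(simpl; auto)) as he3.
  pose proof (hes (eta / (4 * (d' * mu))) ltac:(simpl; auto)) as he4.
  assert (hdmu : 0 < d' * mu) by (apply Rmult_lt_0_compat; lra).
  assert (he3' : mu * e <= eta / 4).
  { apply Rmult_le_compat_l with (r := mu) in he3; [|lra].
    replace (mu * (eta / (4 * mu))) with (eta / 4) in he3 by (field; lra). exact he3. }
  assert (he4' : d' * mu * e <= eta / 4).
  { apply Rmult_le_compat_l with (r := d' * mu) in he4; [|lra].
    replace (d' * mu * (eta / (4 * (d' * mu)))) with (eta / 4) in he4 by (field; lra). exact he4. }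
  destruct (ss_stable 0 (S (S K)) (mass d rho) B1 _ _ T1 _ q' v' e pm s1) as (r3 & hr3 & st); auto.
  { apply ext_strict; auto. }
  destruct (bounded_range v (S K)) as (Bv & hBv & bv).
  (* Slowed by this factor, the array is within the stability radius of an array at rest. *)
  set (la := r3 / Bv). assert (hla : 0 < la) by (apply Rdiv_lt_0_compat; lra).
  destruct (st (mass d rho) (ext (S K) x y) (ext (S K) (fun i => la * v i) (- / d)))
    as (T2 & q2 & v2 & s2 & _ & cq & cv).
  { intros i _ _. rewrite Rminus_diag, Rabs_R0. exact hr3. }
  { intros i _ _. rewrite Rminus_diag, Rabs_R0. exact hr3. }
  { intros i _ i2. destruct (Nat.eq_dec i (S K)) as [->|hn].
    - rewrite !ext_n, Rminus_diag, Rabs_R0. exact hr3.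
    - rewrite !ext_lt by lia. rewrite Rminus_0_r, Rabs_mult, (Rabs_right la) by lra.
      apply Rlt_le_trans with (la * Bv).
      + apply Rmult_lt_compat_l; [exact hla|]. apply bv. lia.
      + unfold la. right. field. lra. }
  (* the earlier history of the first S K particles, run at speed la, with the
     new particle coming in from the right *)
  apply (ss_scale _ _ _ _ _ _ _ _ _ _ 1 la ltac:(lra) hla) in s0.
  rewrite Rmult_1_l in s0. set (T3 := 1 / la * T0) in *.
  pose proof (ss_time_nonneg _ _ _ _ _ _ _ _ _ _ s0) as hT3.
  (* The new particle is placed so far out that it reaches [y] exactly when the slowed history
     ends. *)
  set (qi := ext (S K) q0 (y + T3 * / d)). set (vi := ext (S K) (fun i => la * v0 i) (- / d)).
  destruct (ss_congr _ _ _ (mass d rho) _ _ _ _ _ _ _ (fun _ _ _ => eq_refl) s0 qi vi) as (qe & ve & s3 & ee).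
  { intros i _ i2. unfold qi, vi. rewrite !ext_lt by lia. split; ring. }
  assert (eqe : qe = ext (S K) x y).
  { apply functional_extensionality. intros i. destruct (Compare_dec.lt_dec i (S K)) as [h|h].
    - rewrite ext_lt by assumption. destruct (ee i ltac:(lia) h) as [-> _]. ring.
    - destruct (ss_out _ _ _ _ _ _ _ _ _ _ s3 i ltac:(lia)) as [-> _].
      unfold qi, vi, ext. destruct (Nat.ltb_spec i (S K)); [lia|]. field. lra. }
  assert (eve : ve = ext (S K) (fun i => la * v i) (- / d)).
  { apply functional_extensionality. intros i. destruct (Compare_dec.lt_dec i (S K)) as [h|h].
    - rewrite ext_lt by assumption. apply ee; lia.
    - destruct (ss_out _ _ _ _ _ _ _ _ _ _ s3 i ltac:(lia)) as [_ ->].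
      unfold vi, ext. destruct (Nat.ltb_spec i (S K)); [lia|]. reflexivity. }
  rewrite eqe, eve in s3.
  assert (hid : 0 < / d) by (apply Rinv_0_lt_compat; exact hd).
  assert (hTd : 0 <= T3 * / d) by (apply Rmult_le_pos; lra).
  destruct (ss_extend_ex 0 0 (S K) (S (S K)) (mass d rho) B0 qi vi T3 (binom (S (S K)) 3) _ _
    ltac:(lia) ltac:(lia) ltac:(lia) hB0 s3) as (B3 & s4).
  { intros h. lia. }
  { intros _. unfold qi, vi. rewrite !ext_n. unfold y. lra. }
  pose proof (ss_app_ex _ _ _ _ _ _ _ _ _ _ _ _ _ _ _ s4 s2) as sst.
  apply (ss_scale _ _ _ _ _ _ _ _ _ _ mu 1 hmu ltac:(lra)) in sst.
  apply ss_mirror in sst.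
  (* The reflected masses have the required form only on the particles present, hence the passage
     through [ss_congr]. *)
  assert (em : forall i, (0 <= i)%nat -> (i < S (S K))%nat ->
     mass d' (/ rho) i = mass d rho (rv (S (S K)) i)).
  { intros i _ hi. rewrite rv_lt by lia. unfold mass. rewrite edd, pow_inv.
    replace (S K) with ((S (S K) - 1 - i) + i)%nat at 1 by lia. rewrite pow_add. field.
    apply pow_nonzero. lra. }
  destruct (ss_congr _ _ _ _ _ _ _ _ _ _ _ em sst _ _ (fun i _ _ => conj eq_refl eq_refl))
    as (qf & vf & sf & ef).
  assert (gq : strict_on 0 (S (S K)) q2) by (apply oq; intros i i1 i2; specialize (cq i i1 i2); lra).
  assert (gv : strict_on 0 (S (S K)) v2) by (apply ov; intros i i1 i2; specialize (cv i i1 i2); lra).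
  eexists _, _, _, _, qf, vf. split; [|split; [|split; [|split; [|split; [|split]]]]].
  - replace (binom (S (S (S K))) 3) with (binom (S (S K)) 3 + (S K + (binom K 2 + K)))%nat; [exact sf|].
    change (binom (S (S (S K))) 3) with (binom (S (S K)) 2 + binom (S (S K)) 3)%nat.
    change (binom (S (S K)) 2) with (binom (S K) 1 + (binom K 1 + binom K 2))%nat.
    rewrite !binom_1. lia.
  - apply mirror_strict. apply scale_strict; [exact hmu|]. unfold qi. apply ext_strict; [exact sq0|].
    pose proof (ss_bounded_start _ _ _ _ _ _ _ _ _ _ s0 K ltac:(lia) ltac:(lia)) as z.
    cbv beta in z. rewrite Rmult_1_l in z. apply Rabs_def2 in z. unfold y. lra.
  - intros i i1 i2. rewrite (proj1 (ef i i1 ltac:(lia))), (proj1 (ef (S i) ltac:(lia) i2)).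
    revert i i1 i2. apply mirror_strict. apply scale_strict; auto.
  - intros i i1 i2. rewrite (proj2 (ef i i1 ltac:(lia))), (proj2 (ef (S i) ltac:(lia) i2)).
    revert i i1 i2. apply mirror_strict. apply scale_strict; [lra|auto].
  - intros i i1 i2. rewrite em by assumption. apply pm; [lia|]. rewrite rv_lt; lia.
  - intros i hi. rewrite (proj1 (ef i ltac:(lia) ltac:(lia))). unfold mirror. rewrite rv_lt by lia.
    replace (S (S K) - 1 - i)%nat with (S K - i)%nat by lia.
    specialize (cl1 i hi). specialize (cq (S K - i)%nat ltac:(lia) ltac:(lia)).
    set (X := q2 (S K - i)%nat) in *. set (Y := q' (S K - i)%nat) in *.
    replace (- (mu * X) - pp (/ rho) i) with ((mu * - Y - pp (/ rho) i) - mu * (X - Y)) by ring.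
    apply Rabs_def2 in cl1. apply Rabs_def2 in cq.
    assert (mu * (X - Y) < mu * e) by (apply Rmult_lt_compat_l; lra).
    assert (mu * - (X - Y) < mu * e) by (apply Rmult_lt_compat_l; lra).
    apply Rabs_def1; lra.
  - rewrite (proj1 (ef (S K) ltac:(lia) ltac:(lia))). unfold mirror. rewrite rv_lt by lia.
    replace (S (S K) - 1 - S K)%nat with O by lia.
    specialize (cq O ltac:(lia) ltac:(lia)). rewrite <- edd in cl2.
    set (X := q2 O) in *. set (Y := q' O) in *.
    replace (d' * - (mu * X) - 2 * rho ^ K) with
      ((d' * (mu * - Y) - 2 * rho ^ K) - d' * mu * (X - Y)) by ring.
    apply Rabs_def2 in cl2. apply Rabs_def2 in cq.
    assert (d' * mu * (X - Y) < d' * mu * e) by (apply Rmult_lt_compat_l; lra).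
    assert (d' * mu * - (X - Y) < d' * mu * e) by (apply Rmult_lt_compat_l; lra).
    apply Rabs_def1; lra.
Qed.

Lemma reachable_1 (rho : R) : 0 < rho -> reachable 1 rho 1.
Proof.
  intros hr eta heta. exists 1. split; [lra|]. intros d hd.
  set (m := mass d rho).
  assert (hm0 : 0 < m 0%nat) by (unfold m, mass; simpl; lra).
  assert (hm1 : 0 < m 1%nat).
  { unfold m, mass. simpl. assert (0 < d * (rho * 1)) by (apply Rmult_lt_0_compat; lra). lra. }
  assert (hid : 1 < / d) by (rewrite <- Rinv_1; apply Rinv_lt_contravar; lra).
  set (v0 := fun i : nat => match i with O => 1 | _ => 0 end).
  (* Two particles collide at relative speed 1 and separate at relative speed 1. After time [t]
     their gap is [t], so if particle 0 is then at [x0], particle 1 is at [/ d], which is the case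
     [C] = 1. *)
  set (x0 := 1 - rho). set (t := / d - x0). assert (ht : 0 < t) by (unfold t, x0; lra).
  set (v1 := coll m v0 0).
  pose proof (cB_minus_cA m v0 0 hm0 hm1) as dv. simpl in dv.
  assert (e0 : v1 0%nat = cA m v0 0) by apply coll_l.
  assert (e1 : v1 1%nat = cB m v0 0) by apply coll_r.
  (* The place of the collision, chosen so that particle 0 ends at [x0]. *)
  set (z := x0 - t * v1 0%nat).
  set (q0 := fun i : nat => match i with O => z - 1 | _ => z end).
  assert (f0 : flow q0 v0 1 0%nat = z) by (unfold flow, q0, v0; ring).
  assert (f1 : flow q0 v0 1 1%nat = z) by (unfold flow, q0, v0; ring).
  assert (st : forall s, 0 < s -> strict_on 0 2 (flow (flow q0 v0 1) v1 s)).
  { intros s hs i _ i2. assert (i = O) by lia. subst i. unfold flow at 1 3. rewrite f0, f1.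
    assert (s * v1 0%nat < s * v1 1%nat) by (apply Rmult_lt_compat_l; lra). lra. }
  destruct (ss_free 0 2 m (flow q0 v0 1) v1 t ht) as (B & sB).
  { intros s hs. apply st. lra. }
  destruct (bounded_range q0 2) as (B1 & hB1 & b1).
  apply (ss_mono _ _ _ _ (Rmax B1 B)) in sB; [|apply Rmax_r].
  set (x := flow (flow q0 v0 1) v1 t) in *.
  assert (ex0 : x 0%nat = x0) by (unfold x; unfold flow at 1; rewrite f0; unfold z; ring).
  assert (ex1 : x 1%nat = / d).
  { unfold x. unfold flow at 1. rewrite f1. unfold z.
    replace (x0 - t * v1 0%nat + t * v1 1%nat) with (x0 + t * (v1 1%nat - v1 0%nat)) by ring.
    rewrite e0, e1, dv. unfold t. ring. }
  exists (Rmax B1 B), q0, v0, (1 + t), x, v1. split; [|split; [|split; [|split; [|split; [|split]]]]].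
  - apply ss_flow.
    + lra.
    + intros s hs i _ i2. assert (i = O) by lia. subst i. unfold flow, q0, v0. lra.
    + intros i _ i2. lia.
    + intros i _ i2. specialize (b1 i i2). pose proof (Rmax_l B1 B). lra.
    + apply (ss_coll 0 2 m _ _ v0 0); try lia; auto.
      * rewrite f0, f1. reflexivity.
      * unfold v0. lra.
      * apply (ss_bounded_start _ _ _ _ _ _ _ _ _ _ sB).
  - intros i _ i2. assert (i = O) by lia. subst i. unfold q0. lra.
  - apply st. exact ht.
  - intros i _ i2. assert (i = O) by lia. subst i. lra.
  - intros i _ i2. assert (h : i = 0%nat \/ i = 1%nat) by lia. destruct h as [-> | ->]; assumption.
  - intros i hi. assert (i = O) by lia. subst i. rewrite ex0. unfold x0, pp. simpl.
    replace (1 - rho - (1 - rho) * 1) with 0 by ring. rewrite Rabs_R0. exact heta.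
  - rewrite ex1, Rinv_r, Rminus_diag, Rabs_R0 by lra. exact heta.
Qed.

Lemma reachable_all (K : nat) : (1 <= K)%nat ->
  forall rho, 0 < rho -> rho <> 1 -> exists C, 0 < C /\ reachable K rho C.
Proof.
  induction K as [|K IH]; intros hK rho hr hr1; [lia|].
  destruct K as [|K].
  - exists 1. split; [lra|]. apply reachable_1. exact hr.
  - assert (hi : 0 < / rho) by (apply Rinv_0_lt_compat; exact hr).
    assert (hi1 : / rho <> 1).
    { intros e. apply hr1. rewrite <- (Rinv_inv rho), e. apply Rinv_1. }
    (* The step inverts [rho], so the induction hypothesis is taken at [/ rho]. *)
    destruct (IH ltac:(lia) (/ rho) hi hi1) as (C & hC & H).
    exists (2 * (/ rho) ^ S K). split.
    + pose proof (pow_lt (/ rho) (S K) hi). lra.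
    + rewrite <- (Rinv_inv rho) at 1. apply (reachable_step (S K) (/ rho) C); auto. lia.
Qed.

(** * Open sets of masses and initial data *)

(** Stability with tolerance [r3] keeps the final velocities increasing, so perturbed motions have
    no collision after the last one counted. The mass bounds and the order of positions are open
    conditions and are built into [W] and [U]. *)
Lemma open_sets_of_ss (n : nat) (eps : R) (m0 q0 v0 : nat -> R) (B T : R) (k : nat) (q' v' : nat -> R) :
  (forall i, (i < n)%nat -> 0 < m0 i /\ Rabs (m0 i - 1) < eps) ->
  ss 0 n m0 B q0 v0 T k q' v' -> strict_on 0 n q0 -> strict_on 0 n v' ->
  exists W U, ((exists m, W m) /\ openRn n W /\
     (forall m, W m -> forall i, (i < n)%nat -> 0 < m i /\ 1 - eps < m i < 1 + eps)) /\
    ((exists q v, U q v) /\ openRn2 n U /\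
     (forall q v, U q v -> forall i, (S i < n)%nat -> q i < q (S i))) /\
    forall m q v, W m -> U q v -> run n m q v k.
Proof.
  intros hm H hq hv.
  destruct (strict_on_open _ _ _ hv) as (r3 & hr3 & ov).
  destruct (ss_stable 0 n m0 B q0 v0 T k q' v' r3) as (r & hr & st); auto.
  { intros i _ hi. apply hm. exact hi. }
  exists (fun m => forall i, (i < n)%nat -> Rabs (m i - m0 i) < r /\ 0 < m i /\ 1 - eps < m i < 1 + eps).
  exists (fun q v => (forall i, (i < n)%nat -> Rabs (q i - q0 i) < r /\ Rabs (v i - v0 i) < r) /\
            forall i, (i < n)%nat -> (S i < n)%nat -> q i < q (S i)).
  assert (zero : forall x, Rabs (x - x) < r) by (intros x; rewrite Rminus_diag, Rabs_R0; exact hr).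
  assert (ball : forall x c e, Rabs (x - c) < e ->
            at_right 0 (fun h => forall y, Rabs (y - x) < h -> Rabs (y - c) < e)).
  { intros x c e h. generalize (at_right_lt (e - Rabs (x - c)) ltac:(lra)). apply filter_imp.
    intros h' hh y hy. replace (y - c) with ((y - x) + (x - c)) by ring.
    pose proof (Rabs_triang (y - x) (x - c)). lra. }
  assert (lt : forall x c, c < x -> at_right 0 (fun h => forall y, Rabs (y - x) < h -> c < y)).
  { intros x c h. generalize (at_right_lt (x - c) ltac:(lra)). apply filter_imp.
    intros h' hh y hy. apply Rabs_def2 in hy. lra. }
  assert (gt : forall x c, x < c -> at_right 0 (fun h => forall y, Rabs (y - x) < h -> y < c)).
  { intros x c h. generalize (at_right_lt (c - x) ltac:(lra)). apply filter_imp.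
    intros h' hh y hy. apply Rabs_def2 in hy. lra. }
  split; [|split]; [split; [|split]|split; [|split]|].
  - exists m0. intros i hi. destruct (hm i hi) as [h1 h2]. apply Rabs_def2 in h2.
    split; [apply zero|]. split; [exact h1|lra].
  - intros x hx.
    assert (A : at_right 0 (fun h => forall i, (i < n)%nat -> forall y, Rabs (y - x i) < h ->
        Rabs (y - m0 i) < r /\ 0 < y /\ 1 - eps < y < 1 + eps)).
    { apply filter_forall_nat; [apply filter_filter|]. intros i hi.
      destruct (hx i hi) as (h1 & h2 & h3 & h4).
      generalize (filter_and _ _ (ball _ _ _ h1) (filter_and _ _ (lt _ _ h2)
         (filter_and _ _ (lt _ _ h3) (gt _ _ h4)))).
      apply filter_imp. intros h (a1 & a2 & a3 & a4) y hy. auto. }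
    apply at_right_ex in A. destruct A as (e & he & A). exists (e / 2). split; [lra|].
    intros y hy i hi. apply (A (e / 2)); auto. lra.
  - intros m hW i hi. apply hW. exact hi.
  - exists q0, v0. split; [auto|]. intros i _ hi. apply hq; [lia|exact hi].
  - intros q v [hqv ho].
    assert (A : at_right 0 (fun h => forall i, (i < n)%nat ->
        (forall y, Rabs (y - q i) < h -> Rabs (y - q0 i) < r) /\
        (forall y, Rabs (y - v i) < h -> Rabs (y - v0 i) < r) /\
        ((S i < n)%nat -> forall y z, Rabs (y - q i) < h -> Rabs (z - q (S i)) < h -> y < z))).
    { apply filter_forall_nat; [apply filter_filter|]. intros i hi. destruct (hqv i hi) as [h1 h2].
      apply filter_and; [apply ball; exact h1|]. apply filter_and; [apply ball; exact h2|].
      destruct (Compare_dec.lt_dec (S i) n) as [h|h].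
      - specialize (ho i hi h).
        generalize (at_right_lt ((q (S i) - q i) / 2) ltac:(lra)). apply filter_imp.
        intros h' hh _ y z hy hz. apply Rabs_def2 in hy. apply Rabs_def2 in hz. lra.
      - apply filter_forall. intros h' g. contradiction. }
    apply at_right_ex in A. destruct A as (e & he & A). exists (e / 2). split; [lra|].
    intros q1 v1 h1. specialize (A (e / 2) ltac:(lra)). split.
    + intros i hi. destruct (A i hi) as (a1 & a2 & _). destruct (h1 i hi). auto.
    + intros i hi hi'. destruct (A i hi) as (_ & _ & a3). apply (a3 hi'); apply h1; assumption.
  - intros q v [_ ho] i hi. apply ho; [lia|exact hi].
  - intros m q v hW [hqv ho].
    destruct (st m q v) as (T1 & q2 & v2 & s1 & _ & _ & c).
    { intros i _ hi. apply hW. exact hi. }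
    { intros i _ hi. apply hqv. exact hi. }
    { intros i _ hi. apply hqv. exact hi. }
    apply (ss_run n m B q v T1 k q2 v2); auto.
    + intros i _ hi. apply hW. exact hi.
    + intros i _ hi. apply ho; [lia|exact hi].
Qed.

Lemma few_particles (n : nat) : exists B, ss 0 n (fun _ => 1) B INR INR 0 0 INR INR.
Proof.
  destruct (bounded_range INR n) as (B & _ & b). exists B. apply ss_nil. intros i _ hi. auto.
Qed.

Lemma INR_strict (a b : nat) : strict_on a b INR.
Proof. intros i _ _. apply lt_INR. lia. Qed.

Theorem theorem1 (n : nat) (eps : R) (Heps : 0 < eps) :
  exists (W1 W2 W3 : (nat -> R) -> Prop)
         (U1 U2 U3 : (nat -> R) -> (nat -> R) -> Prop),
    (* the W_i are non-empty open subsets of (1-eps,1+eps)^n *)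
    (forall W, (W = W1 \/ W = W2 \/ W = W3) ->
       (exists m, W m) /\ openRn n W /\
       (forall m, W m -> forall i, (i < n)%nat -> 0 < m i /\ 1 - eps < m i < 1 + eps)) /\
    (* the U_i are non-empty open subsets of R^n x R^n with q_1 < ... < q_n *)
    (forall U, (U = U1 \/ U = U2 \/ U = U3) ->
       (exists q v, U q v) /\ openRn2 n U /\
       (forall q v, U q v -> forall i, (S i < n)%nat -> q i < q (S i))) /\
    (forall m q v, W1 m -> U1 q v -> run n m q v (n - 1)%nat) /\
    (forall m q v, W2 m -> U2 q v -> run n m q v (binom n 2)) /\
    (forall m q v, W3 m -> U3 q v -> run n m q v (binom (n + 1) 3)).
Proof.
  assert (one : forall i, (i < n)%nat -> 0 < 1 /\ Rabs (1 - 1) < eps).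
  { intros i _. rewrite Rminus_diag, Rabs_R0. lra. }
  assert (A1 : exists B q v T q' v', ss 0 n (fun _ => 1) B q v T (n - 1) q' v' /\
            strict_on 0 n q /\ strict_on 0 n v').
  { destruct n as [|b].
    - destruct (few_particles 0) as (B & s). exists B, INR, INR, 0, INR, INR.
      split; [exact s|]. split; apply INR_strict.
    (* The last particle is the only one that moves to the left and crosses the expanding others. *)
    - set (v := fun i => if Nat.ltb i b then INR i else - 1).
      assert (vlo : forall i, (i < b)%nat -> v i = INR i).
      { intros i hi. unfold v. destruct (Nat.ltb_spec i b); [reflexivity|lia]. }
      assert (vb : v b = - 1) by (unfold v; destruct (Nat.ltb_spec b b); [lia|reflexivity]).
      destruct (ss_fan 0 b (fun _ => 1) INR v) as (B & T & q' & v' & s & _ & sv & _); auto; try lia.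
      + apply INR_strict.
      + intros i i1 i2. rewrite !vlo by lia. apply lt_INR. lia.
      + intros i _ hi. rewrite vb, vlo by assumption. pose proof (pos_INR i). lra.
      + replace (S b - 1)%nat with (b - 0)%nat by lia. exists B, INR, v, T, q', v'.
        split; [exact s|]. split; [apply INR_strict|exact sv]. }
  assert (A2 : exists B q v T q' v', ss 0 n (fun _ => 1) B q v T (binom n 2) q' v' /\
            strict_on 0 n q /\ strict_on 0 n v').
  { assert (sp : strict_on 0 n (pp 2)) by (intros i _ _; apply pp_increasing; lra).
    destruct (ss_reversal 0 n (fun _ => 1) (pp 2) (fun i => - gam 2 i) (1 / 2) 0)
      as (B & T & q' & v' & s & _ & sv & _); auto; try lra.
    - rewrite flow_0. exact sp.
    - intros i _ _. pose proof (gam_increasing 2 i (S i) ltac:(lra) ltac:(lra) ltac:(lia)). lra.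
    - intros i _ _. unfold pp, gam. rewrite pow_inv. field. apply pow_nonzero. lra.
    - rewrite flow_0, Nat.sub_0_r in s. eexists B, _, _, T, q', v'. split; [exact s|]. auto. }
  assert (A3 : exists m B q v T q' v', (forall i, (i < n)%nat -> 0 < m i /\ Rabs (m i - 1) < eps) /\
            ss 0 n m B q v T (binom (n + 1) 3) q' v' /\ strict_on 0 n q /\ strict_on 0 n v').
  { rewrite Nat.add_1_r.
    (* With fewer than two particles both the binomial coefficient and the number of collisions
       vanish; the induction starts with two particles. *)
    destruct n as [|[|K]].
    - destruct (few_particles 0) as (B & s). exists (fun _ => 1), B, INR, INR, 0, INR, INR.
      split; [exact one|]. split; [exact s|]. split; apply INR_strict.
    - destruct (few_particles 1) as (B & s). exists (fun _ => 1), B, INR, INR, 0, INR, INR.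
      split; [exact one|]. split; [exact s|]. split; apply INR_strict.
    - destruct (reachable_all (S K) ltac:(lia) 2 ltac:(lra) ltac:(lra)) as (C & _ & H).
      destruct (H 1 ltac:(lra)) as (d0 & hd0 & D).
      destruct (bounded_range (fun i => 2 ^ i) (S (S K))) as (P & hP & bP).
      (* The second bound keeps all masses 1 + d 2^i within [eps] of 1. *)
      set (d := Rmin (d0 / 2) (eps / P)).
      assert (hd : 0 < d) by (apply Rmin_pos; [lra|apply Rdiv_lt_0_compat; lra]).
      assert (hd1 : d <= d0 / 2) by apply Rmin_l. assert (hd2 : d <= eps / P) by apply Rmin_r.
      destruct (D d ltac:(lra)) as (B & q & v & T & x & w & s & sq & _ & sw & pm & _).
      exists (mass d 2), B, q, v, T, x, w. split; [|auto].
      intros i hi. split; [apply pm; [lia|exact hi]|]. unfold mass.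
      replace (1 + d * 2 ^ i - 1) with (d * 2 ^ i) by ring.
      rewrite Rabs_mult, (Rabs_right d) by lra.
      apply Rlt_le_trans with (d * P); [apply Rmult_lt_compat_l; [exact hd|]; apply (bP i hi)|].
      apply Rle_trans with (eps / P * P); [apply Rmult_le_compat_r; lra|]. right. field. lra. }
  destruct A1 as (B1 & q1 & v1 & T1 & q1' & v1' & s1 & sq1 & sv1).
  destruct A2 as (B2 & q2 & v2 & T2 & q2' & v2' & s2 & sq2 & sv2).
  destruct A3 as (m3 & B3 & q3 & v3 & T3 & q3' & v3' & hm3 & s3 & sq3 & sv3).
  destruct (open_sets_of_ss n eps _ _ _ _ _ _ _ _ one s1 sq1 sv1) as (W1 & U1 & w1 & u1 & r1).
  destruct (open_sets_of_ss n eps _ _ _ _ _ _ _ _ one s2 sq2 sv2) as (W2 & U2 & w2 & u2 & r2).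
  destruct (open_sets_of_ss n eps _ _ _ _ _ _ _ _ hm3 s3 sq3 sv3) as (W3 & U3 & w3 & u3 & r3).
  exists W1, W2, W3, U1, U2, U3. split; [|split; [|split; [|split]]].
  - intros W [-> |[-> | ->]]; assumption.
  - intros U [-> |[-> | ->]]; assumption.
  - exact r1.
  - exact r2.
  - exact r3.
Qed.
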